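(* Let $(\rho,\mathbf u,P)\in \mathcal C^1([0,T];\mathcal M\times\mathcal V\times\mathcal Q)$ be a solution of the inviscid, unforced ($\mathbf f=0$) semi-discrete Galerkin method described in the context, with parameters $\alpha_\rho,\alpha_{\mathbf m},\alpha_P\in\mathbb R$, $\alpha_{\mathbf u\cdot\mathbf u}\in\{0,1\}$, $\bar\rho\in\mathbb R$ (spatially constant, possibly depending on time) and polynomial degrees $k_\rho,k_{\mathbf u},k_P$; put $\mathbf m=\rho\mathbf u$. (The condition $\nabla\cdot\mathbf u=0$ is not assumed pointwise.) Then the following hold. 1. (Kinetic energy) If $\alpha_{\mathbf u\cdot\mathbf u}=1$ and $\alpha_{\mathbf m}-\alpha_P-\tfrac12\alpha_\rho=\tfrac12$, then $\partial_t\int_\Omega \rho\,\mathbf u\cdot\mathbf u\,d\mathbf x=0$. 2. (Momentum) If $\alpha_{\mathbf u\cdot\mathbf u}=0$ and $\alpha_{\mathbf m}=1$, then $\partial_t\int_\Omega \mathbf m\,d\mathbf x=0$. 3. (Angular momentum) If $\alpha_{\mathbf u\cdot\mathbf u}=0$ and $\alpha_{\mathbf m}=1$, then $\partial_t\int_\Omega \mathbf m\times\mathbf x\,d\mathbf x=0$. 4. If $\alpha_\rho=\tfrac12$, then $\partial_t\,\tfrac12\int_\Omega\rho^2\,d\mathbf x-\int_\Omega\bar\rho\,\partial_t\rho\,d\mathbf x=0$. 5. If $\alpha_\rho=\tfrac12$ and $\bar\rho=\frac1{|\Omega|}\int_\Omega\rho\,d\mathbf x$, then $\partial_t\Big(\int_\Omega\rho^2\,d\mathbf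 x-\frac1{|\Omega|}\big(\int_\Omega\rho\,d\mathbf x\big)^2\Big)=0$. 6. (Squared density) If either ($\alpha_\rho=\tfrac12$ and $k_\rho\le k_P$) or $2k_\rho\le k_P$, then $\partial_t\int_\Omega\rho^2\,d\mathbf x=0$. 7. (Mass) If $k_\rho\le k_P$ or $\alpha_\rho=1$, then $\partial_t\int_\Omega\rho\,d\mathbf x=0$. 8. (Shift invariance) If $\alpha_\rho=0$ or $\bar\rho=\frac1{|\Omega|}\int_\Omega\rho\,d\mathbf x$, then the density equation is shift-invariant in the sense defined in the context.
   Context: **Domain and spaces.** $\Omega\subset\mathbb R^d$ ($d=2,3$) is a bounded domain with periodic boundary conditions. $\mathcal T_h$ is a shape-regular triangulation of $\Omega$ into disjoint elements $K$. $\mathbb P_k$ denotes polynomials of total degree at most $k$ on $K$, and $k_\rho,k_{\mathbf u},k_P\ge1$, with $k_P<k_{\mathbf u}$ (required for inf-sup stability). The spaces (with periodicity understood) are $$\mathcal M=\{w\in\mathcal C^0(\Omega): w|_K\in\mathbb P_{k_\rho}\ \forall K\},\qquad \mathcal V=\big[\{v\in\mathcal C^0(\Omega): v|_K\in\mathbb P_{k_{\mathbf u}}\ \forall K\}\big]^d,$$ $$\mathcal Q=\Big\{q\in\mathcal C^0(\Omega): q|_K\in\mathbb P_{k_P}\ \forall K,\ \int_\Omega q\,d\mathbf x=0\Big\}.$$ **Notation.** $(\cdot,\cdot)$ is the $L^2(\Omega)$ inner product (scalar or vector valued). $(\nabla\mathbf u)_{ij}=\partial_{x_i}u_j$, and $b(\mathbf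 u,\mathbf v,\mathbf w)=(\mathbf u\cdot\nabla\mathbf v,\mathbf w)=\int_\Omega\sum_{i,j}u_i(\partial_{x_i}v_j)w_j\,d\mathbf x$. The density satisfies $\rho>0$, and $\mathbf m:=\rho\mathbf u$. The function $\overline{\mathbf u\cdot\mathbf u}\in\mathcal M$ is the $L^2$-projection defined by $(\overline{\mathbf u\cdot\mathbf u},w)=(\mathbf u\cdot\mathbf u,w)$ for all $w\in\mathcal M$. Put $s:=\alpha_{\mathbf u\cdot\mathbf u}\,\overline{\mathbf u\cdot\mathbf u}+(1-\alpha_{\mathbf u\cdot\mathbf u})\,\mathbf u\cdot\mathbf u$. In 2D, vectors are extended by a zero last component in cross products. **Semi-discrete method (with $\mathbf f=0$).** Find $(\rho,\mathbf u,P)\in\mathcal C^1([0,T];\mathcal M\times\mathcal V\times\mathcal Q)$ such that at every time, for all $w\in\mathcal M$, $\mathbf v\in\mathcal V$, $q\in\mathcal Q$: Density equation: $$(\partial_t\rho,w)+(\mathbf u\cdot\nabla\rho,w)+\alpha_\rho((\nabla\cdot\mathbf u)(\rho-\bar\rho),w)=0;$$ Momentum equation: $$\begin{aligned}&(\partial_t\mathbf m,\mathbf v)+b(\mathbf u,\mathbf m,\mathbf v)+\alpha_{\mathbf m}((\nabla\cdot\mathbf u)\mathbf m,\mathbf v)+(\nabla P,\mathbf v)+(\alpha_P-\tfrac12)\,b(\mathbf v,\mathbf m,\mathbf u)+(\alpha_P+\tfrac12)\,b(\mathbf v,\mathbf u,\mathbf m)\\&\quad+\tfrac12\alpha_\rho(\nabla(\mathbf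 m\cdot\mathbf u),\mathbf v)+\tfrac12\Big((\mathbf v\cdot\nabla\rho,\,s)-\alpha_\rho\big(\nabla((\rho-\bar\rho)\,s),\mathbf v\big)\Big)=0;\end{aligned}$$ Weak divergence-free condition: $(\nabla\cdot\mathbf u,q)=0$. **Shift invariance.** The density equation is called shift-invariant if, for every $c\in\mathbb R\setminus\{0\}$, $\rho$ satisfies the density equation (with velocity $\mathbf u$) if and only if $\rho+c$ satisfies it with the same $\mathbf u$, where, when $\bar\rho$ is defined as the mean $\frac1{|\Omega|}\int_\Omega\rho\,d\mathbf x$, it is replaced for $\rho+c$ by the mean $\frac1{|\Omega|}\int_\Omega(\rho+c)\,d\mathbf x$.
   Formalization: Item 3 (angular momentum) is false on a periodic domain as stated, since x is not periodic and boundary terms remain; it is proved assuming that at every time u, and P up to an additive constant, have compact support in Ω. *)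

(* Defs.v *)
From HB Require Import structures.
From mathcomp Require Import all_boot all_order all_algebra.
From mathcomp Require mpoly.
From mathcomp Require Import all_classical all_reals all_analysis.

Set Implicit Arguments.
Unset Strict Implicit.
Unset Printing Implicit Defensive.

Import Order.TTheory GRing.Theory Num.Theory.
Import numFieldNormedType.Exports.

Local Open Scope classical_set_scope.
Local Open Scope ring_scope.

(** * Lebesgue measure on R^n *)

Section lebesgue_rV.
Context {R : realType}.

Definition rV_coord (n : nat) (i : 'I_n) (x : 'rV[R]_n) : measurableTypeR R :=
  x ord0 i.

Let rV_set0 n : g_sigma_preimage (@rV_coord n) set0.
Proof. exact: sigma_algebra0. Qed.

Let rV_setC n A :
  g_sigma_preimage (@rV_coord n) A -> g_sigma_preimage (@rV_coord n) (~` A).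
Proof. exact: sigma_algebraC. Qed.

Let rV_bigcup n (F : (set 'rV[R]_n)^nat) :
  (forall i, g_sigma_preimage (@rV_coord n) (F i)) ->
  g_sigma_preimage (@rV_coord n) (\bigcup_i (F i)).
Proof. exact: sigma_algebra_bigcup. Qed.

(* The sigma-algebra generated by the coordinates, i.e. the Borel sets. *)
HB.instance Definition _ (n : nat) :=
  @isMeasurable.Build default_measure_display 'rV[R]_n
    (g_sigma_preimage (@rV_coord n)) (rV_set0 (n := n))
    (@rV_setC n) (@rV_bigcup n).

Definition rV_cons (n : nat) (z : measurableTypeR R * 'rV[R]_n) : 'rV[R]_n.+1 :=
  \row_i oapp (z.2 ord0) (z.1 : R) (unlift ord0 i).

Lemma rV_cons0 n z : @rV_cons n z ord0 ord0 = z.1.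
Proof. by rewrite mxE unlift_none. Qed.

Lemma rV_consS n z i : @rV_cons n z ord0 (lift ord0 i) = z.2 ord0 i.
Proof. by rewrite mxE liftK. Qed.

Lemma measurable_rV_coord n (i : 'I_n) :
  measurable_fun [set: 'rV[R]_n] (@rV_coord n i).
Proof.
move=> _ Y mY; rewrite setTI; apply: sub_sigma_algebra => /=.
rewrite -bigcup_seq/=; exists i => /=; first by rewrite mem_index_enum.
by exists Y => //; rewrite setTI.
Qed.

Lemma measurable_to_rV d (T : measurableType d) n (f : T -> 'rV[R]_n) :
  (forall i, measurable_fun [set: T] (rV_coord i \o f)) ->
  measurable_fun [set: T] f.
Proof.
move=> mf _ Y mY; rewrite setTI.
suff : <<s \big[setU/set0]_(i < n)
    preimage_set_system setT (@rV_coord n i) measurable >>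
    `<=` [set B | measurable (f @^-1` B)] by apply.
apply: smallest_sub.
  split => /=.
  - by rewrite preimage_set0.
  - by move=> A mA; rewrite setTD preimage_setC; exact: measurableC.
  - by move=> A mA; rewrite preimage_bigcup; exact: bigcup_measurable.
move=> A; rewrite -bigcup_seq => -[i _ [B mB <-]] /=.
by rewrite setTI; have := mf i measurableT B mB; rewrite setTI.
Qed.

Lemma measurable_rV_cons n : measurable_fun setT (@rV_cons n).
Proof.
apply: measurable_to_rV => i; case: (unliftP ord0 i) => [j ->|->].
- rewrite (_ : _ \o _ = rV_coord j \o snd); last first.
    by apply/funext => z; rewrite /rV_coord /= rV_consS.
  by apply: measurableT_comp => //; exact: measurable_rV_coord.
- rewrite (_ : _ \o _ = fst)//.
  by apply/funext => z; rewrite /rV_coord /= rV_cons0.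
Qed.

Section step.
Context (n : nat) (mu : {sigma_finite_measure set 'rV[R]_n -> \bar R}).

Definition lebesgue_rV_step : set 'rV[R]_n.+1 -> \bar R :=
  pushforward (@lebesgue_measure R \x mu)%E (@rV_cons n).

Let measurable_pre A : measurable A -> measurable (@rV_cons n @^-1` A).
Proof. by move=> mA; rewrite -[X in measurable X]setTI; exact: measurable_rV_cons. Qed.

Let step0 : lebesgue_rV_step set0 = 0%E.
Proof. by rewrite /lebesgue_rV_step /pushforward preimage_set0 measure0. Qed.

Let step_ge0 A : (0 <= lebesgue_rV_step A)%E.
Proof. by rewrite /lebesgue_rV_step /pushforward measure_ge0. Qed.

Let step_sigma_additive : semi_sigma_additive lebesgue_rV_step.
Proof.
move=> F mF tF mUF; rewrite /lebesgue_rV_step /pushforward preimage_bigcup.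
apply: measure_semi_sigma_additive.
- by move=> k; exact: measurable_pre.
- apply/trivIsetP => /= i j _ _ ij; rewrite -preimage_setI.
  by move/trivIsetP : tF => /(_ _ _ _ _ ij) ->//; rewrite preimage_set0.
- by rewrite -preimage_bigcup; exact: measurable_pre.
Qed.

HB.instance Definition _ := isMeasure.Build _ _ _ lebesgue_rV_step
  step0 step_ge0 step_sigma_additive.

Let step_sigma_finite : sigma_finite setT lebesgue_rV_step.
Proof.
have /sigma_finiteP[F [FT ndF Foo]] := sigma_finiteT (@lebesgue_measure R).
have /sigma_finiteP[G [GT ndG Goo]] := sigma_finiteT mu.
pose tl (x : 'rV[R]_n.+1) : 'rV[R]_n := \row_i x ord0 (lift ord0 i).
have mtl : measurable_fun setT tl.
  apply: measurable_to_rV => i.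
  rewrite (_ : _ \o _ = rV_coord (lift ord0 i)); last first.
    by apply/funext => x; rewrite /rV_coord /= mxE.
  exact: measurable_rV_coord.
exists (fun k => (@rV_coord n.+1 ord0 @^-1` F k) `&` (tl @^-1` G k)).
  apply/esym; rewrite -subTset => x _.
  have : (\bigcup_i F i) (rV_coord ord0 x) by rewrite -FT.
  have : (\bigcup_i G i) (tl x) by rewrite -GT.
  move=> [i _ Gi] [j _ Fj]; exists (maxn i j) => //; split => /=.
    by move: Fj; apply/subsetPset/ndF/leq_maxr.
  by move: Gi; apply/subsetPset/ndG/leq_maxl.
move=> k; have [mF Fk] := Foo k; have [mG Gk] := Goo k; split.
  apply: measurableI.
    by have := @measurable_rV_coord n.+1 ord0 measurableT _ mF; rewrite setTI.
  by have := mtl measurableT _ mG; rewrite setTI.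
rewrite /lebesgue_rV_step /pushforward (_ : _ @^-1` _ = F k `*` G k).
  by rewrite product_measure1E// lte_mul_pinfty// ge0_fin_numE.
apply/seteqP; split => -[t v] /=; rewrite /rV_coord rV_cons0.
  move=> [Ft]; rewrite (_ : tl _ = v)//.
  by apply/rowP => i; rewrite mxE rV_consS.
move=> [Ft Gv]; split => //; rewrite (_ : tl _ = v)//.
by apply/rowP => i; rewrite mxE rV_consS.
Qed.

HB.instance Definition _ := Measure_isSigmaFinite.Build _ _ _ lebesgue_rV_step
  step_sigma_finite.

End step.

Fixpoint lebesgue_rV (n : nat) : {sigma_finite_measure set 'rV[R]_n -> \bar R} :=
  if n is m.+1 then lebesgue_rV_step (lebesgue_rV m) else \d_(0 : 'rV[R]_0).

End lebesgue_rV.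

(** * Periodic domains and triangulations *)

Section polynomial.
(* The notations of mpoly clash with those of MathComp-Analysis. *)
Import -(notations) mpoly.

(* [f] coincides on [K] with a polynomial of total degree at most [k]. *)
Definition polynomial_on (R : realType) (d k : nat) (K : set 'rV[R]_d)
    (f : 'rV[R]_d -> R) : Prop :=
  exists2 p : mpoly d R, (msize p <= k.+1)%N &
    forall x, K x -> f x = meval (x ord0) p.

End polynomial.

Section periodic_mesh.
Context {R : realType} {d : nat}.
Implicit Types (x y : 'rV[R]_d) (L : 'M[R]_d) (Omega : set 'rV[R]_d).

(* The period lattice is generated by the rows of [L]. *)
Definition lattice_vec L (k : 'rV[int]_d) : 'rV[R]_d :=
  map_mx intr k *m L.

(* Periodic boundary conditions on [Omega] identify points that differ by a
   lattice vector, so [Omega] is a fundamental domain: its translates are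
   disjoint and their closures cover the space. A box with opposite faces
   identified is the case of a diagonal [L]. Regular openness excludes domains
   with slits or with a boundary of positive measure. *)
Record periodic_domain Omega L : Prop := PeriodicDomain {
  pdomain_regular_open : (closure Omega)° = Omega ;
  pdomain_bounded : bounded_set Omega ;
  pdomain_connected : connected Omega ;
  pdomain_lattice : L \in unitmx ;
  pdomain_disjoint : forall k : 'rV[int]_d, k != 0 ->
    [set x | Omega x /\ Omega (x - lattice_vec L k)] = set0 ;
  pdomain_cover : forall x,
    exists k : 'rV[int]_d, closure Omega (x - lattice_vec L k) }.

Definition periodic (V : Type) L (f : 'rV[R]_d -> V) : Prop :=
  forall x (k : 'rV[int]_d), f (x + lattice_vec L k) = f x.

(* Convex hull of the points [p j] with [A j]. *)
Definition hull (J : finType) (p : J -> 'rV[R]_d) (A : pred J) : set 'rV[R]_d :=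
  [set x | exists c : J -> R,
    [/\ forall j, 0 <= c j, forall j, ~~ A j -> c j = 0,
        \sum_j c j = 1 & x = \sum_j c j *: p j] ].

(* An element is given by its [d.+1] vertices; [element v] is the closed
   simplex. *)
Definition element (v : 'I_d.+1 -> 'rV[R]_d) : set 'rV[R]_d := hull v predT.

Definition affinely_independent (v : 'I_d.+1 -> 'rV[R]_d) : bool :=
  \matrix_(j < d) (v (lift ord0 j) - v ord0) \in unitmx.

(* Conformity is required on the periodic extension of the mesh, so that
   elements also match across identified parts of the boundary. For a single
   mesh shape-regularity is the bound [sigma] on diameter over inradius (here
   for the maximum norm of ['rV], which only changes the constant). *)
Record triangulation Omega L (I : finType) (v : I -> 'I_d.+1 -> 'rV[R]_d)
    (sigma : R) : Prop := Triangulation {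
  tri_nondegenerate : forall i, affinely_independent (v i) ;
  tri_cover : closure Omega = \bigcup_(i in [set: I]) element (v i) ;
  tri_disjoint : forall i j, i != j ->
    (element (v i))° `&` (element (v j))° = set0 ;
  tri_conforming : forall i j (k : 'rV[int]_d),
    element (v i) `&` [set x | element (v j) (x - lattice_vec L k)] =
    hull (v i) [pred a | [exists b, v i a == v j b + lattice_vec L k]] ;
  tri_shape_regular : forall i, exists2 r : R, 0 < r &
    (exists y, ball y r `<=` element (v i)) /\
    (forall x y, element (v i) x -> element (v i) y -> `|x - y| <= sigma * r) }.

(** Functions on the periodic domain are represented by periodic functions on
    the whole space. *)

Definition fe_space L (I : finType) (v : I -> 'I_d.+1 -> 'rV[R]_d) (k : nat) :
    set ('rV[R]_d -> R) :=
  [set w | [/\ continuous w, periodic L w &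
    forall i, polynomial_on k (element (v i)) w] ].

Definition fe_vspace L (I : finType) (v : I -> 'I_d.+1 -> 'rV[R]_d) (k : nat) :
    set ('rV[R]_d -> 'rV[R]_d) :=
  [set u | forall j, fe_space L v k (fun x => u x ord0 j)].

Definition fe_space0 Omega L (I : finType) (v : I -> 'I_d.+1 -> 'rV[R]_d)
    (k : nat) : set ('rV[R]_d -> R) :=
  [set q | fe_space L v k q /\ \int[lebesgue_rV d]_(x in Omega) q x = 0].

(* Rigid rotations are not periodic, so the angular momentum is considered for
   flows with compact support in the open cell [Omega]. *)
Definition compact_support_in Omega (V : zmodType) (f : 'rV[R]_d -> V) : Prop :=
  exists2 K : set 'rV[R]_d, compact K /\ K `<=` Omega &
    forall x, (Omega `\` K) x -> f x = 0.

End periodic_mesh.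

(** * Spatial operators *)

Section operators.
Context {R : realType} {d : nat}.
Implicit Types (Omega : set 'rV[R]_d) (f g : 'rV[R]_d -> R)
  (u v w : 'rV[R]_d -> 'rV[R]_d).

Definition dotv (n : nat) (a b : 'rV[R]_n) : R := \sum_i a ord0 i * b ord0 i.

(* Pointwise partial derivative. A finite element function is differentiable
   inside every element; the value on the skeleton, a null set, is irrelevant
   to the integrals. *)
Definition partial (i : 'I_d) f (x : 'rV[R]_d) : R :=
  'D_(delta_mx ord0 i : 'rV[R]_d) f x.

Definition grad f (x : 'rV[R]_d) : 'rV[R]_d := \row_i partial i f x.

Definition divergence u (x : 'rV[R]_d) : R :=
  \sum_i partial i (fun y => u y ord0 i) x.

Definition ip Omega f g : R := \int[lebesgue_rV d]_(x in Omega) (f x * g x).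

Definition ipv Omega u v : R :=
  \int[lebesgue_rV d]_(x in Omega) dotv (u x) (v x).

Definition tri_form Omega u v w : R :=
  \int[lebesgue_rV d]_(x in Omega)
    (\sum_i \sum_j u x ord0 i * partial i (fun y => v y ord0 j) x * w x ord0 j).

Definition vintegral (n : nat) Omega (F : 'rV[R]_d -> 'rV[R]_n) : 'rV[R]_n :=
  \row_i \int[lebesgue_rV d]_(x in Omega) F x ord0 i.

Definition mean Omega f : R :=
  (fine (lebesgue_rV d Omega))^-1 * \int[lebesgue_rV d]_(x in Omega) f x.

Definition is_L2_projection Omega (X : set ('rV[R]_d -> R)) f g : Prop :=
  X g /\ forall h, X h -> ip Omega g h = ip Omega f h.

(* Coordinates extended by zero, so that planar vectors can be crossed. *)
Definition coord (a : 'rV[R]_d) (n : nat) : R :=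
  if insub n is Some i then a ord0 i else 0.

Definition cross (a b : 'rV[R]_d) : 'rV[R]_3 :=
  \row_(k < 3) (coord a ((k + 1) %% 3) * coord b ((k + 2) %% 3)
              - coord a ((k + 2) %% 3) * coord b ((k + 1) %% 3)).

End operators.

(** * Time dependence *)

Section time.
Context {R : realType}.
Implicit Types (T t : R).

(* Derivative on the interval [0, T], one-sided at its end points. *)
Definition is_dt (V : normedModType R) T (g : R -> V) t (l : V) : Prop :=
  (s - t)^-1 *: (g s - g t) @[s --> within `[0, T] t^'] --> l.

Definition dt (V : normedModType R) T (g : R -> V) t : V :=
  lim ((s - t)^-1 *: (g s - g t) @[s --> within `[0, T] t^']).

Definition conserved (V : normedModType R) T (g : R -> V) : Prop :=
  forall t, t \in `[0, T] -> is_dt T g t 0.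

Context {d : nat}.

Definition pdt (V : normedModType R) T (f : R -> 'rV[R]_d -> V) t
    (x : 'rV[R]_d) : V := dt T (f ^~ x) t.

(* C^1([0, T]; X) for a space X of functions with the uniform norm; on the
   finite-dimensional spaces used here the choice of norm is immaterial. *)
Definition C1_in (V : normedModType R) T (X : set ('rV[R]_d -> V))
    (f : R -> 'rV[R]_d -> V) : Prop :=
  forall t, t \in `[0, T] ->
    [/\ X (f t), X (pdt T f t),
        {uniform, (fun s x => (s - t)^-1 *: (f s x - f t x)) @
                    within `[0, T] t^' --> pdt T f t} &
        {uniform, pdt T f @ within `[0, T] (nbhs t) --> pdt T f t}].

End time.

(** * The semi-discrete method *)

(* The reference density is either prescribed or defined as the mean of the
   density it is used with. *)
Inductive reference_density (R : Type) : Type :=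
  | Prescribed (r : R -> R)
  | MeanDensity.
Arguments MeanDensity {R}.

Section method.
Context {R : realType} {d : nat}.
Implicit Types (Omega : set 'rV[R]_d) (rho P : R -> 'rV[R]_d -> R)
  (u : R -> 'rV[R]_d -> 'rV[R]_d) (rd : reference_density R).

Definition ref_value Omega rd rho (t : R) : R :=
  match rd with
  | Prescribed r => r t
  | MeanDensity => mean Omega (rho t)
  end.

Definition momentum rho u : R -> 'rV[R]_d -> 'rV[R]_d :=
  fun t x => rho t x *: u t x.

Definition density_equation Omega (T alpha_rho : R) rd
    (M : set ('rV[R]_d -> R)) rho u : Prop :=
  forall t, t \in `[0, T] -> forall w, M w ->
    ip Omega (pdt T rho t) w
    + ip Omega (fun x => dotv (u t x) (grad (rho t) x)) w
    + alpha_rho * ip Omega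
        (fun x => divergence (u t) x * (rho t x - ref_value Omega rd rho t)) w
    = 0.

Definition momentum_equation Omega (T alpha_rho alpha_m alpha_P alpha_uu : R) rd
    (V : set ('rV[R]_d -> 'rV[R]_d)) rho u P (uu_bar : R -> 'rV[R]_d -> R) :
    Prop :=
  let m := momentum rho u in
  let s t x := alpha_uu * uu_bar t x + (1 - alpha_uu) * dotv (u t x) (u t x) in
  forall t, t \in `[0, T] -> forall v, V v ->
    ipv Omega (pdt T m t) v
    + tri_form Omega (u t) (m t) v
    + alpha_m * ipv Omega (fun x => divergence (u t) x *: m t x) v
    + ipv Omega (grad (P t)) v
    + (alpha_P - 2^-1) * tri_form Omega v (m t) (u t)
    + (alpha_P + 2^-1) * tri_form Omega v (u t) (m t)
    + 2^-1 * alpha_rho *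
        ipv Omega (grad (fun x => dotv (m t x) (u t x))) v
    + 2^-1 *
        (ip Omega (fun x => dotv (v x) (grad (rho t) x)) (s t)
         - alpha_rho * ipv Omega
             (grad (fun x => (rho t x - ref_value Omega rd rho t) * s t x)) v)
    = 0.

Definition weakly_divergence_free Omega (T : R) (Q : set ('rV[R]_d -> R)) u :
    Prop :=
  forall t, t \in `[0, T] -> forall q, Q q -> ip Omega (divergence (u t)) q = 0.

Record semidiscrete_solution Omega (T alpha_rho alpha_m alpha_P alpha_uu : R) rd
    (M : set ('rV[R]_d -> R)) (V : set ('rV[R]_d -> 'rV[R]_d))
    (Q : set ('rV[R]_d -> R)) rho u P uu_bar : Prop := SemidiscreteSolution {
  sol_rho_C1 : C1_in T M rho ;
  sol_u_C1 : C1_in T V u ;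
  sol_P_C1 : C1_in T Q P ;
  sol_rho_gt0 : forall t, t \in `[0, T] -> forall x, 0 < rho t x ;
  sol_uu_bar : forall t, t \in `[0, T] ->
    is_L2_projection Omega M (fun x => dotv (u t x) (u t x)) (uu_bar t) ;
  sol_density : density_equation Omega T alpha_rho rd M rho u ;
  sol_momentum : momentum_equation Omega T alpha_rho alpha_m alpha_P alpha_uu rd
    V rho u P uu_bar ;
  sol_divergence : weakly_divergence_free Omega T Q u }.

Definition shift_invariant Omega (T alpha_rho : R) rd
    (M : set ('rV[R]_d -> R)) (V : set ('rV[R]_d -> 'rV[R]_d)) : Prop :=
  forall c : R, c != 0 -> forall rho u, C1_in T M rho -> C1_in T V u ->
    density_equation Omega T alpha_rho rd M rho u <->
    density_equation Omega T alpha_rho rd M (fun t x => rho t x + c) u.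

End method.

(* Main.v *)
Require Import Defs.
From HB Require Import structures.
From mathcomp Require Import all_boot all_order all_algebra.
From mathcomp Require Import all_classical all_reals all_analysis.
From mathcomp Require Import measurable_realfun.
From mathcomp Require Import ring lra.
From mathcomp Require mpoly.

Import Order.TTheory GRing.Theory Num.Theory.
Import numFieldNormedType.Exports.
Local Open Scope classical_set_scope.
Local Open Scope ring_scope.
Set Implicit Arguments.
Unset Strict Implicit.
Unset Printing Implicit Defensive.

(* The key fact is that the integral over the cell Omega of a partial derivative
   of a continuous, periodic, piecewise polynomial function F vanishes. Since
   Omega is a fundamental domain of the lattice, the integral of F (x + h) does
   not depend on h, so the difference quotients of F integrate to zero; F is
   globally Lipschitz, hence they are bounded, and they converge off the
   skeleton of the mesh, a null set. Integration by parts on Omega follows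
   without face terms, and the conservation laws are obtained by testing the
   density equation with 1, rho and the projected speed, and the momentum
   equation with u, constants and, for the angular momentum, the P1 interpolant
   that equals a rotation at the vertices in Omega and 0 at those on the
   boundary: by compactness of the support, the flow and the pressure (up to a
   constant) vanish on every element with a boundary vertex. *)

(** * Lebesgue measure on row vectors *)

(** An elementwise Green formula would require surface measures, normals and the matching of faces
    across the periodic identification; global difference quotients of a single-valued periodic
    function need none of these. The price is the skeleton, where [partial] is a limit that need not
    exist. [cells] removes it, and integrals over [Omega] and over [cells] agree without any
    measurability of the integrand.

    The velocity is only weakly solenoidal, so [dive] is never discarded. Each tested equation is
    put under one integral as a pointwise sum of exact terms [adv W f + dive W * f] and a remainder.
    The exact terms integrate to zero for products of finite element functions of any degree; the
    parameter conditions cancel part of the remainder, and the degree conditions make the rest an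
    instance of the weak divergence constraint. *)

Section rV_norm.
Context {R : realType} {n : nat}.
Implicit Types x y : 'rV[R]_n.

Lemma rV_norm_leP x (e : R) : 0 <= e ->
  reflect (forall i, `|x ord0 i| <= e) (`|x| <= e).
Proof.
move=> e0; apply: (iffP idP) => [xe i|xe].
  apply: le_trans xe; rewrite [leRHS]/Num.norm/= mx_normrE.
  exact: (le_bigmax _ (fun ij => `|x ij.1 ij.2|) (ord0, i)).
rewrite [leLHS]/Num.norm/= mx_normrE; apply/bigmax_leP; split => // -[i j] _ /=.
by rewrite ord1.
Qed.

Lemma coord_le_norm x i : `|x ord0 i| <= `|x|.
Proof. exact: (rV_norm_leP _ (normr_ge0 x)). Qed.

End rV_norm.

Section continuous_functions.
Context {R : realType} {T : topologicalType}.
Implicit Types f g : T -> R.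

Lemma continuous_funD f g : continuous f -> continuous g ->
  continuous (fun x => f x + g x).
Proof. by move=> cf cg x; apply: cvgD; [exact: cf|exact: cg]. Qed.

Lemma continuous_funM f g : continuous f -> continuous g ->
  continuous (fun x => f x * g x).
Proof. by move=> cf cg x; apply: cvgM; [exact: cf|exact: cg]. Qed.

Lemma continuous_fun_cst (c : R) : continuous (fun _ : T => c).
Proof. by move=> x; exact: cvg_cst. Qed.

Lemma continuous_fun_sum (I : Type) (r : seq I) (P : pred I) (F : I -> T -> R) :
  (forall i, P i -> continuous (F i)) ->
  continuous (fun x => \sum_(i <- r | P i) F i x).
Proof.
move=> cF; elim: r => [|i r IH].
  rewrite (_ : (fun x => _) = (fun=> 0)); first exact: continuous_fun_cst.
  by apply/funext => x; rewrite big_nil.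
case Pi : (P i).
  rewrite (_ : (fun x => _) = (fun x => F i x + \sum_(i <- r | P i) F i x)).
    by apply: continuous_funD => //; exact: cF.
  by apply/funext => x; rewrite big_cons Pi.
rewrite (_ : (fun x => _) = (fun x => \sum_(i <- r | P i) F i x))//.
by apply/funext => x; rewrite big_cons Pi.
Qed.

End continuous_functions.

Section lebesgue_rV_theory.
Context {R : realType}.

(** Balls of the maximum norm are boxes, hence finite intersections of coordinate preimages, and an
    open set is the countable union of the balls with rational centre and radius [1/(k+1)] that it
    contains. *)
Lemma rV_open_measurable n (U : set 'rV[R]_n) : open U -> measurable U.
Proof.
move=> oU.
pose B (k : 'rV[rat]_n * nat) := ball (map_mx ratr k.1 : 'rV[R]_n) k.2.+1%:R^-1.
have mB k : measurable (B k).
  rewrite (_ : B k = \bigcap_(i in [set: 'I_n])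
      [set x | `|ratr (k.1 ord0 i) - x ord0 i| < k.2.+1%:R^-1]); last first.
    apply/seteqP; split => x /=; rewrite /B.
      by case=> _ + i _ => /(_ ord0 i); rewrite mxE.
    by move=> H; split => [|i j]; rewrite ?invr_gt0// mxE ord1; exact: H.
  apply: fin_bigcap_measurable => // i _.
  have mb : measurable (ball (ratr (k.1 ord0 i) : R) k.2.+1%:R^-1 : set (measurableTypeR R)).
    by apply: open_measurable; exact: ball_open.
  have := @measurable_rV_coord R n i measurableT _ mb.
  by rewrite setTI.
rewrite (_ : U = \bigcup_(k in [set: 'rV[rat]_n * nat])
    (if `[< B k `<=` U >] then B k else set0)).
  apply: countable_bigcupT_measurable => // k.
  by case: ifP => _; [exact: mB|exact: measurable0].
apply/seteqP; split => [x Ux|x [k _]]; last by case: ifPn => // /asboolP; exact.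
have /nbhs_ballP[e e0 eU] : nbhs x U by apply: open_nbhs_nbhs.
(* With a radius below [e / 2], a ball that contains [x] stays within distance [e] of [x]. *)
have [m me] : exists m, m.+1%:R^-1 < e / 2.
  have e20 : 0 < e / 2 by rewrite divr_gt0.
  exists (Num.truncn (e / 2)^-1); rewrite invf_plt ?posrE//.
  exact: truncnS_gt.
have qP i : {q : rat | `|ratr q - x ord0 i| < m.+1%:R^-1}.
  apply/cid.
  have : x ord0 i < x ord0 i + m.+1%:R^-1 by rewrite ltrDl invr_gt0.
  move=> /rat_in_itvoo[q]; rewrite in_itv/= => /andP[q1 q2]; exists q.
  by rewrite gtr0_norm ?subr_gt0// ltrBlDl.
exists (\row_i sval (qP i), m) => //.
have Bx : B (\row_i sval (qP i), m) x.
  split => [|i j]; first by rewrite invr_gt0.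
  by rewrite !mxE (ord1 i); exact: (svalP (qP j)).
rewrite asboolT// => y By; apply: eU.
rewrite [e]splitr; apply: (@ball_triangle _ _ (map_mx ratr (\row_i sval (qP i)) : 'rV[R]_n)).
  by apply: (@le_ball _ _ _ m.+1%:R^-1); [exact: ltW|exact: ball_sym].
by apply: (@le_ball _ _ _ m.+1%:R^-1); [exact: ltW|exact: By].
Qed.

Lemma rV_closed_measurable n (A : set 'rV[R]_n) : closed A -> measurable A.
Proof. by move/closed_openC/rV_open_measurable/measurableC; rewrite setCK. Qed.

Lemma rV_continuous_measurable n (f : 'rV[R]_n -> R) :
  continuous f -> measurable_fun [set: 'rV[R]_n] f.
Proof.
move=> /continuousP cf; apply: (measurability _ (RGenOpens.measurableE R)).
move=> _ [_ [a [b ->] <-]]; rewrite setTI.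
by apply: rV_open_measurable; apply: cf; exact: interval_open.
Qed.

(** Half-open intervals determine Lebesgue measure, and a translation preserves their lengths. *)
Lemma lebesgue_measure_translation (a : R) (A : set (measurableTypeR R)) :
  measurable A -> lebesgue_measure ((fun x => x + a) @^-1` A) = lebesgue_measure A.
Proof.
have mt : measurable_fun [set: measurableTypeR R] ((fun x => x + a) : _ -> measurableTypeR R).
  exact: measurable_funD.
pose mt' := isMeasurableFun.Build _ _ _ _ _ mt.
pose t : {mfun measurableTypeR R >-> measurableTypeR R} := HB.pack (fun x : R => x + a) mt'.
move=> mA; apply/esym.
apply: (@lebesgue_measure_unique R (pushforward lebesgue_measure t)) => //.
move=> _ [[u v]] _ <-.
transitivity (lebesgue_measure (`]u - a, v - a]%classic : set R)).
  rewrite !lebesgue_measure_itv/= !lte_fin ltrD2r.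
  by case: ifP => // _; congr (_%:E); rewrite opprB addrA subrK.
congr (lebesgue_measure _).
by apply/seteqP; split => x /=; rewrite !in_itv/= ltrBlDr lerBrDr.
Qed.

Lemma measurable_rV_translation n (h : 'rV[R]_n) :
  measurable_fun [set: 'rV[R]_n] (fun x => x + h).
Proof.
apply: measurable_to_rV => i.
rewrite (_ : _ \o _ = (fun x => rV_coord i x + h ord0 i)); last first.
  by apply/funext => x; rewrite /rV_coord /= mxE.
by apply: measurable_funD => //; exact: measurable_rV_coord.
Qed.

(** Induction on the dimension: a product measure is determined by rectangles, on which a
    translation acts factor by factor. *)
Lemma lebesgue_rV_translation n (h : 'rV[R]_n) (A : set 'rV[R]_n) :
  measurable A -> lebesgue_rV n ((fun x => x + h) @^-1` A) = lebesgue_rV n A.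
Proof.
elim: n h A => [h A _|n IH h A mA].
  congr (lebesgue_rV 0 _); apply/seteqP.
  by split => x /=; rewrite (thinmx0 h) addr0.
pose h' : 'rV[R]_n := \row_i h ord0 (lift ord0 i).
pose f (z : measurableTypeR R * 'rV[R]_n) : measurableTypeR R * 'rV[R]_n :=
  (z.1 + h ord0 ord0, z.2 + h').
have mf : measurable_fun setT f.
  apply/measurable_fun_pairP; split => /=.
    rewrite (_ : _ \o _ =
      ((fun x : R => x + h ord0 ord0) : measurableTypeR R -> measurableTypeR R) \o fst)//.
    apply: measurableT_comp => //; exact: measurable_funD.
  rewrite (_ : _ \o _ = (fun x => x + h') \o snd)//.
  apply: measurableT_comp => //; exact: measurable_rV_translation.
pose mf' := isMeasurableFun.Build _ _ _ _ _ mf.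
pose g : {mfun (measurableTypeR R * 'rV[R]_n)%type >-> (measurableTypeR R * 'rV[R]_n)%type} :=
  HB.pack f mf'.
have mA' : measurable (@rV_cons R n @^-1` A).
  by rewrite -[X in measurable X]setTI; exact: measurable_rV_cons.
rewrite /= /lebesgue_rV_step /pushforward.
rewrite [RHS](@product_measure_unique _ _ _ _ _ lebesgue_measure (lebesgue_rV n)
    (pushforward (lebesgue_measure \x lebesgue_rV n)%E g)) //.
- rewrite /pushforward -comp_preimage -[in RHS]comp_preimage.
  congr (product_measure1 _ _ (_ @^-1` A)); apply/funext => z /=.
  apply/rowP => i; case: (unliftP ord0 i) => [j ->|->].
    by rewrite mxE !rV_consS !mxE.
  by rewrite mxE !rV_cons0.
- move=> B C mB mC; rewrite /pushforward.
  transitivity ((lebesgue_measure \x lebesgue_rV n)%E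
      (((fun x : measurableTypeR R => x + h ord0 ord0) @^-1` B) `*`
       ((fun x => x + h') @^-1` C))) => //.
  rewrite product_measure1E//.
  + by congr (_ * _)%E; [exact: lebesgue_measure_translation|exact: IH].
  + rewrite -[X in measurable X]setTI.
    by apply: (measurable_funD (f := fun x : measurableTypeR R => x) (g := fun=> h ord0 ord0)).
  + by rewrite -[X in measurable X]setTI; exact: measurable_rV_translation.
Qed.

(** A bounded set sits in a cube, and peeling off one coordinate turns the cube into the product of
    an interval and a cube of lower dimension. *)
Lemma lebesgue_rV_bounded n (A : set 'rV[R]_n) :
  measurable A -> bounded_set A -> (lebesgue_rV n A < +oo)%E.
Proof.
move=> mA [M [_ /(_ (M + 1))]]; rewrite ltrDl ltr01 => /(_ isT) AM.
have {AM} : A `<=` [set x | forall i, x ord0 i \in `[- (M + 1), M + 1]].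
  move=> x /AM/= xM i; rewrite in_itv/= -ler_norml.
  exact: le_trans (coord_le_norm x i) xM.
move: (M + 1) => {M} M; elim: n A mA => [A mA _|n IH A mA AM].
  by rewrite /= diracE; case: (_ \in _); rewrite ltry.
have mA' : measurable (@rV_cons R n @^-1` A).
  by rewrite -[X in measurable X]setTI; exact: measurable_rV_cons.
rewrite /= /lebesgue_rV_step /pushforward.
pose C := [set x : 'rV[R]_n | forall i, x ord0 i \in `[- M, M]].
have mC : measurable C.
  rewrite (_ : C = \bigcap_(i in [set: 'I_n]) (rV_coord i @^-1` `[- M, M]%classic)).
    apply: fin_bigcap_measurable => // i _.
    rewrite -[X in measurable X]setTI.
    by apply: measurable_rV_coord => //; exact: measurable_itv.
  by apply/seteqP; split => x Cx i => [_|]; exact: Cx.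
apply: (@le_lt_trans _ _ ((lebesgue_measure \x lebesgue_rV n)%E
    ((`[- M, M]%classic : set (measurableTypeR R)) `*` C))).
  apply: le_measure; rewrite ?inE//.
    by apply: measurableX => //; exact: measurable_itv.
  move=> -[t v]/= /AM Atv; split => [|i].
    by have := Atv ord0; rewrite rV_cons0.
  by have := Atv (lift ord0 i); rewrite rV_consS.
rewrite product_measure1E//.
pose J : set (measurableTypeR R) := `[- M, M]%classic.
have I : (lebesgue_measure J < +oo)%E.
  by rewrite lebesgue_measure_itv/=; case: ifP => _; rewrite ltry.
by rewrite lte_mul_pinfty ?ge0_fin_numE//; exact: IH.
Qed.

End lebesgue_rV_theory.

(** * Null sets and integrals of functions that need not be measurable *)

Section null_sets.
Local Open Scope ereal_scope.
Context d (T : measurableType d) (R : realType).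
Variable mu : {measure set T -> \bar R}.
Import HBNNSimple.

(** The integral of a nonnegative function is a supremum over the simple functions below it,
    measurable or not, and setting a simple function to zero on [N] keeps its integral. This
    generality is wanted because pointwise derivatives have no controlled values on the skeleton. *)
Lemma ge0_integral_setD_null_nonmeasurable (N : set T) (f : T -> \bar R) :
  measurable N -> mu N = 0 -> (forall x, 0 <= f x) ->
  \int[mu]_x f x = \int[mu]_x (f \_ (~` N)) x.
Proof.
move=> mN N0 f0.
have fN0 x : 0 <= (f \_ (~` N)) x by rewrite /patch; case: ifP.
rewrite !ge0_integralTE//; apply/eqP; rewrite eq_le; apply/andP; split.
  apply: ge_ereal_sup => _ [h /= hf <-].
  pose h' := proj_nnsfun h (measurableC mN).
  apply: (@le_trans _ _ (sintegral mu h')).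
    rewrite -!integralT_nnsfun.
    rewrite (ge0_negligible_integral mN)//; last 2 first.
    - exact/measurable_EFinP/measurable_funP.
    - by move=> x _; rewrite lee_fin.
    rewrite [leRHS](ge0_negligible_integral mN)//; last 2 first.
    - exact/measurable_EFinP/measurable_funP.
    - by move=> x _; rewrite lee_fin.
    rewrite le_eqVlt; apply/orP; left; apply/eqP/eq_integral => x; rewrite inE => -[_ Nx].
    by rewrite /h' -mrestrict patchT// inE.
  have h'f x : (h' x)%:E <= (f \_ (~` N)) x.
    have -> : h' x = (h \_ (~` N)) x by rewrite (mrestrict h (measurableC mN)).
    by rewrite /patch; case: ifP.
  by apply: ereal_sup_ubound; exists h'.
apply: le_ereal_sup => _ [h /= hf <-]; exists h => //= x.
by apply: (le_trans (hf x)); rewrite /patch; case: ifP.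
Qed.

Lemma integral_setD_null_nonmeasurable (D N : set T) (f : T -> \bar R) :
  measurable N -> mu N = 0 ->
  \int[mu]_(x in D) f x = \int[mu]_(x in D `\` N) f x.
Proof.
move=> mN N0; rewrite integralE [RHS]integralE.
congr (_ - _).
- rewrite integral_mkcond (ge0_integral_setD_null_nonmeasurable mN N0).
    rewrite [RHS]integral_mkcond; apply: eq_integral => x _.
    by rewrite -patch_setI setIC setDE setIC.
  by move=> x; rewrite /patch; case: ifP.
- rewrite integral_mkcond (ge0_integral_setD_null_nonmeasurable mN N0).
    rewrite [RHS]integral_mkcond; apply: eq_integral => x _.
    by rewrite -patch_setI setIC setDE setIC.
  by move=> x; rewrite /patch; case: ifP.
Qed.

Lemma ge0_integral_setI_cover (A : set T) (C : (set T)^nat) (f : T -> \bar R) :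
  measurable A -> (forall n, measurable (C n)) -> trivIset setT C ->
  mu (~` \bigcup_n C n) = 0 -> measurable_fun setT f -> (forall x, 0 <= f x) ->
  \int[mu]_(x in A) f x = \sum_(n <oo) \int[mu]_(x in A `&` C n) f x.
Proof.
move=> mA mC tC C0 mf f0.
have mU : measurable (\bigcup_n C n) by exact: bigcup_measurable.
rewrite (integral_setD_null_nonmeasurable _ _ (measurableC mU))//.
rewrite setDE setCK setI_bigcupr ge0_integral_bigcup//.
- by move=> n; exact: measurableI.
- exact: measurable_funTS.
- apply/trivIsetP => i j _ _ ij.
  by move/trivIsetP : tC => /(_ i j Logic.I Logic.I ij) Cij; rewrite setIACA setIid Cij setI0.
Qed.

Lemma measure_bigcup_null (K : countType) (F : K -> set T) :
  (forall k, measurable (F k)) -> (forall k, mu (F k) = 0) ->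
  mu (\bigcup_k F k) = 0.
Proof.
move=> mF F0.
rewrite (_ : \bigcup_k F k =
    \bigcup_n (if unpickle n is Some k then F k else set0)); last first.
  apply/seteqP; split => x [k _ Fx]; first by exists (pickle k); rewrite ?pickleK.
  by move: Fx; case: unpickle => // l Fx; exists l.
have mG n : measurable (if @unpickle K n is Some k then F k else set0).
  by case: unpickle => // k; exact: measurable0.
apply/negligibleP; first exact: bigcup_measurable.
apply: negligible_bigcup => n; apply/negligibleP => //.
by case: unpickle => //; exact: measure0.
Qed.

Lemma Rintegral_eq0 (D : set T) (f : T -> R) :
  (forall x, D x -> f x = 0%R) -> (\int[mu]_(x in D) f x)%R = 0%R.
Proof. by move=> f0; rewrite /Rintegral integral0_eq// => x /f0 ->. Qed.

Lemma Rintegral_null (D : set T) (f : T -> R) : measurable D -> mu D = 0 ->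
  (\int[mu]_(x in D) f x)%R = 0%R.
Proof.
move=> mD D0; rewrite /Rintegral (integral_setD_null_nonmeasurable _ _ mD D0).
by rewrite setDv integral_set0.
Qed.

End null_sets.

(** * Fundamental domains of a lattice *)

Section fundamental_domain.
Context {R : realType} {d : nat}.
Local Notation mu := (lebesgue_rV d).
Implicit Types (A B : set 'rV[R]_d) (L : 'M[R]_d).

Definition translate A (h : 'rV[R]_d) : set 'rV[R]_d := [set x | A (x - h)].

Lemma measurable_translate A h : measurable A -> measurable (translate A h).
Proof.
move=> mA; rewrite -[X in measurable X]setTI.
by apply: (measurable_rV_translation (- h)).
Qed.

Lemma lebesgue_translate A h : measurable A -> mu (translate A h) = mu A.
Proof. exact: lebesgue_rV_translation. Qed.

Lemma ge0_integral_translate A (h : 'rV[R]_d) (f : 'rV[R]_d -> \bar R) :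
  measurable A -> measurable_fun setT f -> (forall x, (0 <= f x)%E) ->
  (\int[mu]_(x in A) f (x + h)%R = \int[mu]_(x in translate A h) f x)%E.
Proof.
move=> mA mf f0.
have mh := measurable_rV_translation h.
have := @ge0_integral_pushforward _ _ _ _ R (fun x : 'rV[R]_d => x + h) mh mu (translate A h) f
  (measurable_translate h mA) (measurable_funTS mf) (fun x _ => f0 x).
rewrite /translate/= (_ : _ @^-1` _ = A); last first.
  by apply/seteqP; split => x /=; rewrite addrK.
move=> <-; apply: eq_measure_integral => B mB _.
exact: lebesgue_rV_translation.
Qed.

Lemma lattice_vecB L k l : lattice_vec L (k - l) = lattice_vec L k - lattice_vec L l :> 'rV[R]_d.
Proof.
rewrite /lattice_vec -mulmxBl; congr (_ *m _).
by apply/rowP => i; rewrite !mxE rmorphB.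
Qed.

Lemma lattice_vecN L k : lattice_vec L (- k) = - lattice_vec L k :> 'rV[R]_d.
Proof.
rewrite /lattice_vec -mulNmx; congr (_ *m _).
by apply/rowP => i; rewrite !mxE rmorphN.
Qed.

Lemma lattice_vecD L k l : lattice_vec L (k + l) = lattice_vec L k + lattice_vec L l :> 'rV[R]_d.
Proof. by rewrite -[l]opprK lattice_vecB !lattice_vecN !opprK. Qed.

Lemma lattice_vec0 L : lattice_vec L 0 = 0 :> 'rV[R]_d.
Proof. by rewrite -(subrr 0) lattice_vecB subrr. Qed.

(** Translates of an open cell miss their boundaries, hence the cover up to a null set. Only the
    properties that serve to compare integrals are kept, and they survive an arbitrary translation
    of [A]. *)
Record ae_fundamental_domain L A : Prop := AeFundamentalDomain {
  aefd_measurable : measurable A ;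
  aefd_disjoint : forall k x, A x -> A (x - lattice_vec L k) -> k = 0 ;
  aefd_cover : mu (~` \bigcup_k translate A (lattice_vec L k)) = 0 }.

Lemma ae_fundamental_domain_translate L A h :
  ae_fundamental_domain L A -> ae_fundamental_domain L (translate A h).
Proof.
move=> [mA dA cA]; split; first exact: measurable_translate.
- by move=> k x; rewrite /translate/= => Ax Axk; apply: (dA k) Ax _; rewrite addrAC.
- rewrite (_ : ~` _ = translate (~` \bigcup_k translate A (lattice_vec L k)) h).
    rewrite lebesgue_translate//; apply: measurableC.
    apply: countable_bigcupT_measurable => // k; exact: measurable_translate.
  apply/seteqP; split => x /= nx [k _]; rewrite /translate/= => Ax.
    by apply: nx; exists k => //; rewrite /translate/= addrAC.
  by apply: nx; exists k => //; rewrite /translate/= addrAC.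
Qed.

(** Unfolding argument: [A] is cut by the translates of [B], and [B] by those of [A]. The part of
    [A] in [B + k] and the part of [B] in [A - k] differ by a lattice vector, so periodicity and
    translation invariance equate the two series term by term. *)
Lemma ge0_integral_ae_fundamental_domain L A B (f : 'rV[R]_d -> \bar R) :
  ae_fundamental_domain L A -> ae_fundamental_domain L B ->
  measurable_fun setT f -> (forall x, (0 <= f x)%E) -> Defs.periodic L f ->
  (\int[mu]_(x in A) f x = \int[mu]_(x in B) f x)%E.
Proof.
move=> [mA dA cA] [mB dB cB] mf f0 fL.
(* [s] is the identity when [A] is cut and the opposite when [B] is cut, so that both series run
   over the lattice in matching order. Codes without a lattice vector contribute the empty set. *)
pose cells (s : 'rV[int]_d -> 'rV[int]_d) (D : set 'rV[R]_d) n : set 'rV[R]_d :=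
  if pickle_inv n is Some k then translate D (lattice_vec L (s k)) else set0.
have mcells s D n : measurable D -> measurable (cells s D n).
  by move=> mD; rewrite /cells; case: pickle_inv => // k; exact: measurable_translate.
have tcells s D : injective s ->
    (forall k x, D x -> D (x - lattice_vec L k) -> k = 0) ->
    trivIset setT (cells s D).
  move=> sI dD; apply/trivIsetP => i j _ _ ij; apply/eqP/negPn/negP.
  move=> /set0P[x []]; rewrite /cells.
  case Ei : (pickle_inv i) => [k|]//; case Ej : (pickle_inv j) => [l|]//.
  rewrite /translate/= => Dk Dl.
  have := dD (s l - s k) (x - lattice_vec L (s k)) Dk.
  rewrite lattice_vecB opprB addrA subrK => /(_ Dl) /eqP.
  rewrite subr_eq0 => /eqP/sI kl; move: ij.
  have := @pickle_invK 'rV[int]_d i; have := @pickle_invK 'rV[int]_d j.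
  by rewrite Ei Ej kl /= => -> ->; rewrite eqxx.
have ccells s D : (forall k, exists l, s l = k) ->
    mu (~` \bigcup_k translate D (lattice_vec L k)) = 0%E ->
    mu (~` \bigcup_n cells s D n) = 0%E.
  move=> sS cD; rewrite -cD; congr (mu (~` _)); apply/seteqP; split => x /= [k _].
    rewrite /cells; case: (pickle_inv k) => // l xl; by exists (s l).
  move=> xk; have [l lk] := sS k; exists (pickle l) => //.
  by rewrite /cells pickleK_inv lk.
have eA : (\int[mu]_(x in A) f x = \sum_(n <oo) \int[mu]_(x in A `&` cells id B n) f x)%E.
  apply: ge0_integral_setI_cover => //.
  - by move=> n; exact: mcells.
  - exact: tcells.
  - by apply: ccells => // k; exists k.
have eB : (\int[mu]_(x in B) f x = \sum_(n <oo) \int[mu]_(x in B `&` cells -%R A n) f x)%E.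
  apply: ge0_integral_setI_cover => //.
  - by move=> n; exact: mcells.
  - by apply: tcells => //; exact: oppr_inj.
  - by apply: ccells => // k; exists (- k); rewrite opprK.
apply: etrans eA _; apply: etrans _ (esym eB).
apply: eq_eseriesr => n _; rewrite /cells; case: pickle_inv => [k|]; last first.
  by rewrite !setI0 !integral_set0.
rewrite (_ : A `&` _ = translate (B `&` translate A (lattice_vec L (- k))) (lattice_vec L k)).
  rewrite -ge0_integral_translate//; last first.
    by apply: measurableI => //; exact: measurable_translate.
  by apply: eq_integral => x _; rewrite fL.
rewrite lattice_vecN /translate; apply/seteqP.
by split => x /=; rewrite opprK subrK => -[].
Qed.

End fundamental_domain.

(** * Simplices *)

Section barycentric.
Context {R : realType} {d : nat}.
Local Notation mu := (lebesgue_rV d).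
Implicit Types (v : 'I_d.+1 -> 'rV[R]_d) (x y : 'rV[R]_d).

Definition edge_matrix v : 'M[R]_d := \matrix_(j < d) (v (lift ord0 j) - v ord0).

(** Solving in the edge basis at vertex 0 yields affine functions on the whole space, outside the
    simplex as well; the coordinate of vertex 0 is what the others lack to sum to 1. *)
Definition bary v x (a : 'I_d.+1) : R :=
  let t := (x - v ord0) *m invmx (edge_matrix v) in
  if unlift ord0 a is Some j then t ord0 j else 1 - \sum_j t ord0 j.

Lemma bary_ord0 v x : bary v x ord0 =
  1 - \sum_j ((x - v ord0) *m invmx (edge_matrix v)) ord0 j.
Proof. by rewrite /bary unlift_none. Qed.

Lemma bary_lift v x j : bary v x (lift ord0 j) =
  ((x - v ord0) *m invmx (edge_matrix v)) ord0 j.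
Proof. by rewrite /bary liftK. Qed.

Lemma bary_sum v x : \sum_a bary v x a = 1.
Proof.
rewrite big_ord_recl bary_ord0.
under [X in _ + X]eq_bigr do rewrite bary_lift.
by rewrite subrK.
Qed.

Lemma baryK v x : affinely_independent v -> \sum_a bary v x a *: v a = x.
Proof.
move=> vi; rewrite big_ord_recl bary_ord0.
under [X in _ + X]eq_bigr do rewrite bary_lift.
set t := _ *m _; rewrite scalerBl scale1r scaler_suml -addrA.
rewrite (_ : - _ + _ = t *m edge_matrix v); last first.
  rewrite mulmx_sum_row addrC -sumrB; apply: eq_bigr => j _.
  by rewrite rowK scalerBr.
by rewrite mulmxKV// addrC subrK.
Qed.

Lemma bary_unique v x (c : 'I_d.+1 -> R) : affinely_independent v ->
  \sum_a c a = 1 -> \sum_a c a *: v a = x -> bary v x =1 c.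
Proof.
move=> vi c1 xE.
have cE : \row_j c (lift ord0 j) = (x - v ord0) *m invmx (edge_matrix v).
  apply: (canRL (mulmxK vi)); rewrite mulmx_sum_row -xE.
  rewrite -[v ord0 in RHS]scale1r -c1 scaler_suml !big_ord_recl.
  rewrite opprD addrACA subrr add0r -sumrB; apply: eq_bigr => j _.
  by rewrite rowK mxE scalerBr.
move=> a; case: (unliftP ord0 a) => [j ->|->].
  by rewrite bary_lift -cE mxE.
rewrite bary_ord0 -cE -c1 big_ord_recl.
by under [X in _ - X]eq_bigr do rewrite mxE; rewrite addrK.
Qed.

Lemma bary_affine v (a : 'I_d.+1) :
  exists b (l : 'I_d -> R), forall x, bary v x a = b + \sum_i l i * x ord0 i.
Proof.
pose M := invmx (edge_matrix v).
have tE x j : ((x - v ord0) *m M) ord0 j =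
    - (v ord0 *m M) ord0 j + \sum_i M i j * x ord0 i.
  rewrite mulmxBl !mxE addrC; congr (_ + _).
  by apply: eq_bigr => i _; rewrite mulrC.
case: (unliftP ord0 a) => [j ->|->].
  by exists (- (v ord0 *m M) ord0 j), (fun i => M i j) => x; rewrite bary_lift tE.
exists (1 + \sum_j (v ord0 *m M) ord0 j), (fun i => - \sum_j M i j) => x.
rewrite bary_ord0; under eq_bigr do rewrite tE.
rewrite big_split/= opprD sumrN opprK addrA; congr (_ + _).
rewrite exchange_big -sumrN; apply: eq_bigr => i _.
by rewrite mulNr mulr_suml.
Qed.

Lemma continuous_bary v a : continuous (fun x => bary v x a).
Proof.
have [b [l blE]] := bary_affine v a.
rewrite (_ : (fun x => _) = (fun x => b + \sum_i l i * x ord0 i)); last first.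
  exact/funext.
apply: continuous_funD; first exact: continuous_fun_cst.
apply: continuous_fun_sum => i _; apply: continuous_funM.
  exact: continuous_fun_cst.
exact: coord_continuous.
Qed.

Lemma bary_conv v a x y (t : R) :
  bary v ((1 - t) *: x + t *: y) a = (1 - t) * bary v x a + t * bary v y a.
Proof.
have [b [l blE]] := bary_affine v a; rewrite !blE.
rewrite !mulrDr addrACA -mulrDl subrK mul1r !mulr_sumr -big_split/=.
congr (_ + _); apply: eq_bigr => i _; rewrite !mxE; ring.
Qed.

(** The direction [v a - v b] has coordinates 1 at [a], -1 at [b] and 0 elsewhere, so a move along
    this edge leaves the facet opposite [a] at unit rate. *)
Lemma bary_vertex_shift v a b x (s : R) : affinely_independent v -> a != b ->
  bary v (x + s *: (v a - v b)) a = bary v x a + s.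
Proof.
move=> vi ab.
pose c e := bary v x e + s * ((e == a)%:R - (e == b)%:R).
have dE (V : lmodType R) (f : 'I_d.+1 -> V) e0 : \sum_e (e == e0)%:R *: f e = f e0.
  rewrite (bigD1 e0)//= eqxx scale1r big1 ?addr0// => e /negbTE ->.
  by rewrite scale0r.
have d1 e0 : \sum_(e : 'I_d.+1) (e == e0)%:R = 1 :> R.
  rewrite -[RHS](dE R^o (fun=> 1) e0); apply: eq_bigr => e _.
  exact: esym (mulr1 _).
rewrite (@bary_unique _ _ c) //.
- by rewrite /c eqxx (negbTE ab) subr0 mulr1.
- by rewrite /c big_split/= bary_sum -mulr_sumr sumrB !d1 subrr mulr0 addr0.
- rewrite /c; under eq_bigr do rewrite scalerDl -scalerA scalerBl.
  by rewrite big_split/= baryK// -scaler_sumr sumrB !dE.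
Qed.

Lemma elementP v x : affinely_independent v ->
  element v x <-> forall a, 0 <= bary v x a.
Proof.
move=> vi; split => [[c [c0 _ c1 xE]] a|x0].
  by rewrite (bary_unique vi c1)// -xE.
by exists (bary v x); split => //; [exact: bary_sum|rewrite baryK].
Qed.

Lemma element_closed v : affinely_independent v -> closed (element v).
Proof.
move=> vi; rewrite (_ : element v =
    \bigcap_(a in [set: 'I_d.+1]) ((fun x => bary v x a) @^-1` [set r | 0 <= r])).
  apply: closed_bigI => a _; apply: closed_comp => [x _|]; last exact: closed_ge.
  exact: continuous_bary.
apply/seteqP; split => x.
  by move=> /(elementP _ vi) x0 a _; exact: x0.
by move=> x0; apply/elementP => // a; exact: x0.
Qed.

Lemma element_bounded v : bounded_set (element v).
Proof.
exists (\sum_a `|v a|); split; first exact: num_real.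
move=> M vM x [c [c0 _ c1 ->]]; apply: le_trans (ltW vM).
apply: le_trans (ler_norm_sum _ _ _) _; apply: ler_sum => a _.
rewrite normrZ ger0_norm//; apply: ler_piMl => //.
by rewrite -c1 (bigD1 a)//= lerDl sumr_ge0.
Qed.

Lemma element_interior v x : affinely_independent v ->
  (forall a, 0 < bary v x a) -> (element v)° x.
Proof.
move=> vi x0; rewrite /interior/=.
suff : \forall y \near x, forall a, 0 < bary v y a.
  by apply: filterS => y y0; apply/elementP => // a; exact/ltW.
apply: (@filter_forall _ _ _ (nbhs x) (nbhs_filter x)) => a.
apply: (@continuous_bary v a x [set r | 0 < r]).
by apply: open_nbhs_nbhs; split; [exact: open_gt|exact: x0].
Qed.

Definition facet v a := element v `&` [set x | bary v x a = 0].

Lemma facet_closed v a : affinely_independent v -> closed (facet v a).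
Proof.
move=> vi; apply: closedI; first exact: element_closed.
rewrite (_ : [set x | _] = (fun x => bary v x a) @^-1` [set r | r = 0])//.
apply: closed_comp => [x _|]; last exact: closed_eq.
exact: continuous_bary.
Qed.

(* The translates of a facet along an edge leaving it are disjoint, have the
   same measure, and stay in a bounded set. *)
Lemma lebesgue_facet v a : (0 < d)%N -> affinely_independent v ->
  mu (facet v a) = 0%E.
Proof.
move=> d0 vi; have [b ab] : exists b, a != b.
  have [->|a0] := eqVneq a ord0; last by exists ord0.
  by exists (inord 1); rewrite -val_eqE/= inordK.
pose w := v a - v b.
pose s (n : nat) : R := n.+1%:R^-1.
pose F n := translate (facet v a) (s n *: w).
have mF0 : measurable (facet v a) by apply: rV_closed_measurable; exact: facet_closed.
have mF n : measurable (F n) by exact: measurable_translate.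
have FE n x : F n x -> bary v x a = s n.
  rewrite /F /translate/= => -[_ /= x0].
  by rewrite -[x](subrK (s n *: w)) bary_vertex_shift// x0 add0r.
have tF : trivIset setT F.
  apply/trivIsetP => i j _ _; apply: contraNeq => /set0P[x [/FE + /FE]].
  by move=> -> /invr_inj/eqP; rewrite eqr_nat eqSS.
have bF : bounded_set (\bigcup_n F n).
  have [M [_ HM]] := element_bounded v.
  exists (M + 1 + `|w|); split; first exact: num_real.
  move=> N MN x [n _ [/= /(HM (M + 1))]]; rewrite ltrDl ltr01 => /(_ isT) xM _.
  apply: le_trans (ltW MN); rewrite -[x](subrK (s n *: w)).
  apply: le_trans (ler_normD _ _) _; apply: lerD => //.
  rewrite normrZ ger0_norm ?invr_ge0//; apply: ler_piMl => //.
  by rewrite invf_le1 ?ler1n.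
have mU : measurable (\bigcup_n F n) by exact: bigcup_measurable.
have muF n : mu (F n) = mu (facet v a) by exact: lebesgue_translate.
have foo : (mu (facet v a) < +oo)%E.
  apply: lebesgue_rV_bounded => //.
  have [M [Mr HM]] := element_bounded v.
  by exists M; split => // N MN x [/(HM _ MN)].
have fE : ((fine (mu (facet v a)))%:E = mu (facet v a))%E.
  by rewrite fineK// ge0_fin_numE.
have := lebesgue_rV_bounded mU bF.
rewrite measure_bigcup// => Foo.
(* All translates have the measure of the facet, so a finite total means a convergent series with
   constant terms. *)
have /cvg_series_cvg_0 : cvgn (series (fun _ : nat => fine (mu (facet v a)))).
  apply: nnseries_is_cvg => [_|]; first exact: fine_ge0.
  apply: le_lt_trans Foo; rewrite le_eqVlt; apply/orP; left; apply/eqP.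
  congr (limn _); apply/funext => n; apply: eq_big => [i|i _].
    by rewrite in_setT.
  exact: etrans fE (esym (muF i)).
move=> /(cvg_lim (@Rhausdorff R)); rewrite lim_cst//.
by move=> F0; rewrite -fE F0.
Qed.

End barycentric.

(** * Polynomial functions *)

Section polynomial_functions.
Import -(notations) mpoly.
Context {R : realType} {d : nat}.
Implicit Types (f g : 'rV[R]_d -> R) (K : set 'rV[R]_d) (p : mpoly.mpoly d R).

(** Polynomial functions are generated by constants and coordinates under sums and products, by
    expansion into monomials. Analytic properties then need checking on the generators and the two
    operations only. *)
Lemma mpoly_fun_ind (P : ('rV[R]_d -> R) -> Prop) :
  (forall c, P (fun=> c)) -> (forall i, P (fun x => x ord0 i)) ->
  (forall f g, P f -> P g -> P (fun x => f x + g x)) ->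
  (forall f g, P f -> P g -> P (fun x => f x * g x)) ->
  forall p, P (fun x => mpoly.meval (x ord0) p).
Proof.
move=> Pc PX PD PM p.
have Pprod J (r : seq J) (F : J -> 'rV[R]_d -> R) :
    (forall j, P (F j)) -> P (fun x => \prod_(j <- r) F j x).
  move=> PF; elim: r => [|j r IH].
    by rewrite (_ : (fun x => _) = fun=> 1)//; apply/funext => x; rewrite big_nil.
  rewrite (_ : (fun x => _) = (fun x => F j x * \prod_(j <- r) F j x)).
    exact: PM.
  by apply/funext => x; rewrite big_cons.
have Psum J (r : seq J) (F : J -> 'rV[R]_d -> R) :
    (forall j, P (F j)) -> P (fun x => \sum_(j <- r) F j x).
  move=> PF; elim: r => [|j r IH].
    by rewrite (_ : (fun x => _) = fun=> 0)//; apply/funext => x; rewrite big_nil.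
  rewrite (_ : (fun x => _) = (fun x => F j x + \sum_(j <- r) F j x)).
    exact: PD.
  by apply/funext => x; rewrite big_cons.
rewrite (_ : (fun x => _) = (fun x : 'rV[R]_d =>
    \sum_(m <- mpoly.msupp p) mpoly.mcoeff m p * \prod_i x ord0 i ^+ mpoly.fun_of_multinom m i)).
  apply: Psum => m; apply: (PM); first exact: Pc.
  apply: Pprod => i; elim: (mpoly.fun_of_multinom m i) => [|n IH].
    by rewrite (_ : (fun x => _) = fun=> 1)//; apply/funext => x; rewrite expr0.
  rewrite (_ : (fun x => _) = (fun x : 'rV[R]_d => x ord0 i * x ord0 i ^+ n)).
    exact: PM.
  by apply/funext => x; rewrite exprS.
by apply/funext => x; rewrite mpoly.mevalE.
Qed.

(** The induction carries a bound along with the Lipschitz constant, since the constant of a product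
    involves bounds on both factors. *)
Lemma mpoly_fun_lipschitz p (M : R) : exists2 C, 0 <= C &
  forall x y : 'rV[R]_d, `|x| <= M -> `|y| <= M ->
    `|mpoly.meval (x ord0) p - mpoly.meval (y ord0) p| <= C * `|x - y|.
Proof.
pose P f := exists C, [/\ 0 <= C, forall x, `|x| <= M -> `|f x| <= C &
  forall x y, `|x| <= M -> `|y| <= M -> `|f x - f y| <= C * `|x - y|].
suff [C [C0 _ CL]] : P (fun x => mpoly.meval (x ord0) p) by exists C.
apply: mpoly_fun_ind => [c|i|f g [C [C0 Cb CL]] [D [D0 Db DL]]|
  f g [C [C0 Cb CL]] [D [D0 Db DL]]].
- exists `|c|; split => // x y _ _.
  by rewrite subrr normr0 mulr_ge0.
(* One constant plays both roles: [M] bounds a coordinate and 1 is its Lipschitz constant. *)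
- exists (Num.max 1 M); split; first by rewrite le_max ler01.
    by move=> x xM; rewrite le_max (le_trans (coord_le_norm x i) xM) orbT.
  move=> x y _ _; have := coord_le_norm (x - y) i; rewrite !mxE => /le_trans; apply.
  by apply: ler_peMl => //; rewrite le_max lexx.
- exists (C + D); split; first exact: addr_ge0.
    by move=> x xM; rewrite (le_trans (ler_normD _ _))// lerD ?Cb ?Db.
  move=> x y xM yM; rewrite opprD addrACA mulrDl (le_trans (ler_normD _ _))//.
  by rewrite lerD ?CL ?DL.
- exists (C * D + C * D); split; first by rewrite addr_ge0 ?mulr_ge0.
    move=> x xM; rewrite normrM -[leLHS]addr0 lerD ?mulr_ge0//.
    by apply: ler_pM => //; [exact: Cb|exact: Db].
  move=> x y xM yM.
  rewrite (_ : _ - _ = f x * (g x - g y) + (f x - f y) * g y); last by ring.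
  rewrite (le_trans (ler_normD _ _))// !normrM mulrDl lerD//.
    by rewrite -mulrA ler_pM ?Cb ?DL.
  by rewrite mulrAC ler_pM ?Db ?CL.
Qed.

Lemma mpoly_fun_derivable p (x w : 'rV[R]_d) :
  derivable (fun x : 'rV[R]_d => mpoly.meval (x ord0) p) x w.
Proof.
apply: (mpoly_fun_ind (P := fun f => derivable f x w)) => [c|i|f g|f g].
- exact: derivable_cst.
- apply: diff_derivable; exact: differentiable_coord.
- exact: derivableD.
- exact: derivableM.
Qed.

Lemma mpoly_fun_line p (x w : 'rV[R]_d) :
  exists q : {poly R}, forall t, mpoly.meval ((x + t *: w) ord0) p = q.[t].
Proof.
apply: (mpoly_fun_ind (P := fun f => exists q : {poly R}, forall t, f (x + t *: w) = q.[t])).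
- by move=> c; exists c%:P => t; rewrite hornerC.
- move=> i; exists ((x ord0 i)%:P + w ord0 i *: 'X) => t.
  by rewrite !hornerE !mxE mulrC.
- by move=> f g [q qE] [r rE]; exists (q + r) => t; rewrite hornerD qE rE.
- by move=> f g [q qE] [r rE]; exists (q * r) => t; rewrite hornerM qE rE.
Qed.

(* Along a line through the interior point the polynomial has infinitely many
   zeros. *)
Lemma mpoly_fun_eq0 p (y : 'rV[R]_d) :
  (\forall x \near y, mpoly.meval ((x : 'rV[R]_d) ord0) p = 0) ->
  forall x : 'rV[R]_d, mpoly.meval (x ord0) p = 0.
Proof.
move=> /nbhs_ballP[e /= e0 ye] x.
have [q qE] := mpoly_fun_line p y (x - y).
have [q0|q0] := eqVneq q 0.
  by have := qE 1; rewrite q0 horner0 scale1r addrC subrK.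
(* Distinct parameters for which the point of the line stays within [e / 2] of [y]; the summand 1
   keeps the denominator positive when [x = y]. Taking [size q] of them gives one root too many for
   a nonzero [q]. *)
pose h n : R := e / 2 / (1 + `|x - y|) / n.+1%:R.
pose s := [seq h n | n <- iota 0 (size q)].
have D0 : 0 < 1 + `|x - y| by rewrite ltr_wpDr.
have hI : injective h.
  move=> m n; have ne0 : e / 2 / (1 + `|x - y|) != 0.
    by rewrite !mulf_neq0 ?invr_eq0 ?gt_eqF// divr_gt0.
  by move=> /(mulfI ne0)/invr_inj/eqP; rewrite eqr_nat => /eqP[].
have : (size s < size q)%N.
  apply: max_poly_roots => //.
    apply/allP => _ /mapP[n _ ->]; rewrite rootE -qE; apply/eqP/ye.
    have h0 : 0 <= h n by rewrite !divr_ge0// ltW.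
    rewrite -ball_normE/= opprD addrA subrr sub0r normrN normrZ ger0_norm//.
    rewrite (@le_lt_trans _ _ (e / 2))//; last by lra.
    rewrite /h -!mulrA mulrA; apply: ler_piMr; first by rewrite divr_ge0// ltW.
    rewrite ler_pdivrMl// mulr1; apply: (@le_trans _ _ `|x - y|); last by rewrite lerDr.
    by apply: ler_piMl => //; rewrite invf_le1 ?ler1n.
  by rewrite map_inj_uniq ?iota_uniq.
by rewrite size_map size_iota ltnn.
Qed.

Lemma polynomial_on_cst K k (c : R) : polynomial_on k K (fun=> c).
Proof.
exists (mpoly.mpolyC d c) => [|x _]; last by rewrite mpoly.mevalC.
by rewrite mpoly.msizeC; case: eqP.
Qed.

Lemma polynomial_on_coord K i : polynomial_on 1 K (fun x => x ord0 i).
Proof.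
exists (mpoly.mpolyX R (mpoly.mnm1 i)) => [|x _]; last by rewrite mpoly.mevalXU.
by rewrite mpoly.msizeX mpoly.mdeg1.
Qed.

Lemma polynomial_onW K k l f : (k <= l)%N ->
  polynomial_on k K f -> polynomial_on l K f.
Proof. by move=> kl [p pk fp]; exists p => //; exact: leq_trans pk _. Qed.

Lemma polynomial_onD K k f g : polynomial_on k K f -> polynomial_on k K g ->
  polynomial_on k K (fun x => f x + g x).
Proof.
move=> [p pk fp] [q qk gq]; exists (p + q) => [|x Kx].
  by rewrite (leq_trans (mpoly.msizeD_le _ _))// geq_max pk.
by rewrite mpoly.mevalD fp// gq.
Qed.

Lemma polynomial_onM K k l f g : polynomial_on k K f -> polynomial_on l K g ->
  polynomial_on (k + l) K (fun x => f x * g x).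
Proof.
move=> [p pk fp] [q ql gq]; exists (p * q) => [|x Kx]; last first.
  by rewrite mpoly.mevalM fp// gq.
have [->|p0] := eqVneq p 0; first by rewrite mul0r mpoly.msize0.
have [->|q0] := eqVneq q 0; first by rewrite mulr0 mpoly.msize0.
have : (mpoly.msize p + mpoly.msize q <= (k + l).+2)%N.
  by rewrite -addnS -addSn leq_add.
by rewrite mpoly.msizeM//; case: (_ + _)%N.
Qed.

End polynomial_functions.

(** * Mesh *)

Section cover_lipschitz.
Context {R : realType}.

Lemma closed_right_end (U : set R) (a l : R) : closed U -> a < l ->
  (forall t, a <= t < l -> U t) -> U l.
Proof.
move=> cU al aU; apply: cU => B /nbhs_ballP[e /= e0 eB].
exists (Num.max a (l - e / 2)); split.
  by apply: aU; rewrite le_max lexx/= gt_max al/= ltrBlDr ltrDl divr_gt0.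
apply: eB; rewrite -ball_normE/= ger0_norm ?subr_ge0; last first.
  by rewrite ge_max ltW//= lerBlDr lerDl divr_ge0// ltW.
by rewrite ltrBlDr addrC -ltrBlDr lt_max; apply/orP; right; lra.
Qed.

Lemma closed_left_end (U : set R) (r b : R) : closed U -> r < b ->
  (forall t, r < t <= b -> U t) -> U r.
Proof.
move=> cU rb bU; apply: cU => B /nbhs_ballP[e /= e0 eB].
exists (Num.min b (r + e / 2)); split.
  by apply: bU; rewrite ge_min lexx/= lt_min rb/= ltrDl divr_gt0.
apply: eB; rewrite -ball_normE/= distrC ger0_norm ?subr_ge0; last first.
  by rewrite le_min ltW//= lerDl divr_ge0// ltW.
by rewrite ltrBlDr addrC gt_min; apply/orP; right; lra.
Qed.

(** Induction on the number of sets. The first one meets [[a, b]] in a compact set with extreme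
    points [l] and [r]; its own estimate crosses from [l] to [r] in one stroke, whatever happens in
    between, and the other sets cover [[a, l]] and [[r, b]]. On a line the three distances add up,
    so the constant does not grow. *)
Lemma closed_cover_lipschitz (J : choiceType) (s : seq J) (A : J -> set R)
    (g : R -> R) (C a b : R) :
  (forall j, j \in s -> closed (A j)) ->
  (forall j, j \in s -> forall x y, A j x -> A j y -> `|g x - g y| <= C * `|x - y|) ->
  (forall t, a <= t <= b -> exists2 j, j \in s & A j t) ->
  a <= b -> `|g a - g b| <= C * `|a - b|.
Proof.
elim: s a b => [|j s IH] a b cA lA cov ab.
  by have [|] := cov a; rewrite ?lexx.
have cAs i : i \in s -> closed (A i) by move=> si; apply: cA; rewrite inE si orbT.
have lAs i : i \in s -> forall x y, A i x -> A i y -> `|g x - g y| <= C * `|x - y|.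
  by move=> si; apply: lA; rewrite inE si orbT.
pose U := \bigcup_(i in [set` s]) A i.
have cU : closed U.
  by rewrite /U; apply: closed_bigcup => [|i]; [exact: finite_seq|exact: cAs].
have UP t : U t -> exists2 i, i \in s & A i t by case=> i; exists i.
pose K := A j `&` `[a, b]%classic.
have cK : compact K.
  apply: (@subclosed_compact _ _ `[a, b]%classic) => //.
  - apply: closedI; first by apply: cA; rewrite mem_head.
    exact: interval_closed.
  - exact: segment_compact.
  - by move=> x [].
have covU t : a <= t <= b -> ~ K t -> U t.
  move=> tab Kt; have [i] := cov t tab; rewrite inE => /orP[/eqP-> Ajt|si Ait].
    by exfalso; apply: Kt; split => //=; rewrite in_itv.
  by exists i.
have [K0|/set0P K0] := eqVneq K set0.
  apply: IH => // t tab; apply: UP; apply: covU => //; rewrite K0; exact.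
have cid : {within K, continuous (@id R)} by apply: continuous_subspaceT => x; exact: cvg_id.
have [r /set_mem Kr rmax] := compact_EVT_max K0 cK cid.
have [l /set_mem Kl lmin] := compact_EVT_min K0 cK cid.
have [Al] := Kl; rewrite /= in_itv/= => /andP[al lb].
have [Ar] := Kr; rewrite /= in_itv/= => /andP[ar rb].
have lr : l <= r by apply: lmin; rewrite inE.
have ga_l : `|g a - g l| <= C * `|a - l|.
  move: al; rewrite le_eqVlt => /predU1P[->|al]; first by rewrite !subrr !normr0 mulr0.
  apply: IH => //; last exact: ltW.
  (* Before [l] the set [A j] is absent, so the other sets cover [[a, l)]; their union is closed and
     therefore contains [l] too. *)
  have al' t : a <= t < l -> U t.
    move=> /andP[at_ tl]; apply: covU; first by rewrite at_ ltW// (lt_le_trans tl).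
    by move=> Kt; have := lmin t; rewrite inE => /(_ Kt); rewrite leNgt tl.
  move=> t /andP[at_ tl]; apply: UP; move: tl; rewrite le_eqVlt => /predU1P[->|tl].
    exact: (@closed_right_end U a l).
  by apply: al'; rewrite at_.
have gr_b : `|g r - g b| <= C * `|r - b|.
  move: rb; rewrite le_eqVlt => /predU1P[->|rb]; first by rewrite !subrr !normr0 mulr0.
  apply: IH => //; last exact: ltW.
  have rb' t : r < t <= b -> U t.
    move=> /andP[rt tb]; apply: covU; first by rewrite tb andbT ltW// (le_lt_trans ar).
    by move=> Kt; have := rmax t; rewrite inE => /(_ Kt); rewrite leNgt rt.
  move=> t /andP[rt tb]; apply: UP; move: rt; rewrite le_eqVlt => /predU1P[<-|rt].
    exact: (@closed_left_end U r b).
  by apply: rb'; rewrite rt.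
have gl_r := lA j (mem_head _ _) l r Al Ar.
rewrite (_ : g a - g b = (g a - g l) + (g l - g r) + (g r - g b)); last by ring.
apply: le_trans (ler_normD _ _) _; apply: le_trans (lerD (ler_normD _ _) (lexx _)) _.
apply: le_trans (lerD (lerD ga_l gl_r) gr_b) _.
rewrite -!mulrDr !ler0_norm ?subr_le0//.
by rewrite le_eqVlt; apply/orP; left; apply/eqP; ring.
Qed.

End cover_lipschitz.

Section mesh.
Context {R : realType} {d : nat}.
Local Notation mu := (lebesgue_rV d).

(** Multiplication by [invmx L] recovers the integer coordinates, which are thus bounded. This is
    what makes the periodic extension of the mesh locally finite. *)
Lemma lattice_finite (L : 'M[R]_d) (M : R) : L \in unitmx ->
  exists s : seq 'rV[int]_d, forall k, `|lattice_vec L k| <= M -> k \in s.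
Proof.
move=> Lu.
pose B := \sum_i \sum_j M * `|invmx L j i|.
pose N := (Num.truncn B).+1.
pose dec (f : 'rV['I_(N + N).+1]_d) : 'rV[int]_d :=
  map_mx (fun a : 'I_(N + N).+1 => (a : nat)%:Z - N%:Z) f.
exists (codom dec) => k kM.
have M0 : 0 <= M by rewrite (le_trans _ kM).
have kN i : `|k ord0 i| <= N%:Z.
  rewrite -(@ler_int R) intr_norm.
  have -> : (k ord0 i)%:~R = (lattice_vec L k *m invmx L) ord0 i.
    by rewrite /lattice_vec mulmxK// mxE.
  rewrite mxE; apply: le_trans (ler_norm_sum _ _ _) _.
  apply: (@le_trans _ _ B); last by apply: ltW; exact: truncnS_gt.
  rewrite /B [leRHS](bigD1 i)//=; apply: ler_wpDr.
    by apply: sumr_ge0 => ? _; apply: sumr_ge0 => ? _; rewrite mulr_ge0.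
  apply: ler_sum => j _; rewrite normrM ler_wpM2r//.
  exact: le_trans (coord_le_norm _ _) kM.
apply/codomP; exists (\row_i inord (absz (k ord0 i + N%:Z))).
apply/rowP => i; rewrite !mxE.
have := kN i; rewrite ler_norml => /andP[k1 k2].
have k0 : 0 <= k ord0 i + N%:Z by rewrite -lerBlDr sub0r.
rewrite inordK; first by rewrite gez0_abs// addrK.
by rewrite ltnS -lez_nat gez0_abs// PoszD lerD2r.
Qed.

Context {Omega : set 'rV[R]_d} {L : 'M[R]_d} {I : finType}
  {v : I -> 'I_d.+1 -> 'rV[R]_d} {sigma : R}.
Hypotheses (d_gt0 : (0 < d)%N) (hO : periodic_domain Omega L)
  (hT : triangulation Omega L v sigma).

Let vi i : affinely_independent (v i) := tri_nondegenerate hT i.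

Lemma mesh_cover x : exists k i, element (v i) (x - lattice_vec L k).
Proof.
have [k] := pdomain_cover hO x; rewrite (tri_cover hT) => -[i _ ki].
by exists k, i.
Qed.

Lemma mesh_bounded : exists2 M, 0 <= M & forall i x, element (v i) x -> `|x| <= M.
Proof.
have H i : exists M, forall x, element (v i) x -> `|x| <= M.
  have [M [_ /(_ (M + 1))]] := element_bounded (v i).
  by rewrite ltrDl ltr01 => /(_ isT) HM; exists (M + 1).
have [f fP] := choice H.
exists (\sum_i `|f i|); first exact: sumr_ge0.
move=> i x /fP xf; apply: le_trans xf _.
rewrite (bigD1 i)//=; apply: le_trans (ler_norm _) _.
by rewrite lerDl sumr_ge0.
Qed.

(** The segment from [x] to [y] meets finitely many translated elements, their lattice vectors being
    bounded. The sets of parameters at which it lies in each of them are closed and cover [[0, 1]],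
    so [closed_cover_lipschitz] applies. *)
Lemma mesh_lipschitz (F : 'rV[R]_d -> R) (C : R) :
  (forall i k x y, element (v i) (x - lattice_vec L k) ->
    element (v i) (y - lattice_vec L k) -> `|F x - F y| <= C * `|x - y|) ->
  forall x y, `|F x - F y| <= C * `|x - y|.
Proof.
move=> FC x y.
have [M M0 HM] := mesh_bounded.
have [s sP] := lattice_finite (`|x| + `|y - x| + M) (pdomain_lattice hO).
pose g (t : R) := F (x + t *: (y - x)).
pose A (j : I * 'rV[int]_d) := [set t : R |
  element (v j.1) (x + t *: (y - x) - lattice_vec L j.2)].
have gC : `|g 0 - g 1| <= C * `|y - x| * `|0 - 1|.
  apply: (@closed_cover_lipschitz R (I * 'rV[int]_d)%type
    [seq (i, k) | i <- enum I, k <- s] A) => //.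
  - move=> j _; apply: closed_comp; last exact: element_closed (vi j.1).
    move=> t _; apply: cvgD; last exact: cvg_cst.
    apply: cvgD; first exact: cvg_cst.
    by apply: cvgZr_tmp; exact: cvg_id.
  - move=> j _ t1 t2 At1 At2; rewrite /g.
    apply: le_trans (FC j.1 j.2 _ _ At1 At2) _.
    by rewrite opprD addrACA subrr add0r -scalerBl normrZ mulrAC mulrA.
  - move=> t /andP[t0 t1]; have [k [i ki]] := mesh_cover (x + t *: (y - x)).
    exists (i, k) => //; apply: allpairs_f; first by rewrite mem_enum.
    apply: sP; rewrite -[lattice_vec L k](subKr (x + t *: (y - x))).
    apply: le_trans (ler_normB _ _) _; apply: lerD; last exact: HM ki.
    apply: le_trans (ler_normD _ _) _; rewrite lerD2l normrZ ger0_norm//.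
    exact: ler_piMl.
by move: gC; rewrite /g scale0r addr0 scale1r (addrC x) subrK sub0r normrN1 mulr1 (distrC y).
Qed.

(** Only facets of the elements of the cell itself; lattice translates are added where the whole
    space has to be covered. *)
Definition skeleton : set 'rV[R]_d :=
  \bigcup_(p in [set: I * 'I_d.+1]) facet (v p.1) p.2.

Lemma skeleton_closed : closed skeleton.
Proof.
by apply: closed_bigcup => [|p _]; [exact: finite_finset|exact: facet_closed].
Qed.

Lemma skeleton_measurable : measurable skeleton.
Proof. apply: rV_closed_measurable; exact: skeleton_closed. Qed.

Lemma skeleton_null : mu skeleton = 0%E.
Proof.
apply: measure_bigcup_null => p; last exact: lebesgue_facet.
apply: rV_closed_measurable; exact: facet_closed.
Qed.

Lemma off_skeleton x i : element (v i) x -> ~ skeleton x ->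
  forall a, 0 < bary (v i) x a.
Proof.
move=> xi xs a; rewrite lt_neqAle (elementP _ (vi i)).1// andbT.
by apply/eqP => x0; apply: xs; exists (i, a).
Qed.

Lemma off_skeleton_interior x i : element (v i) x -> ~ skeleton x ->
  (element (v i))° x.
Proof. by move=> xi xs; apply: element_interior => //; exact: off_skeleton. Qed.

Lemma domain_open : open Omega.
Proof. by rewrite -(pdomain_regular_open hO); exact: open_interior. Qed.

Lemma domain_element x : closure Omega x -> exists i, element (v i) x.
Proof. by rewrite (tri_cover hT) => -[i]; exists i. Qed.

Lemma element_domain i : element (v i) `<=` closure Omega.
Proof. by rewrite (tri_cover hT) => x; exists i. Qed.

(** Regular openness at work: a point off the skeleton is interior to an element, hence to the
    closure of [Omega], whose interior is [Omega]. *)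
Lemma closure_domain x : closure Omega x -> ~ skeleton x -> Omega x.
Proof.
move=> cx xs; have [i xi] := domain_element cx.
rewrite -(pdomain_regular_open hO).
exact: (interiorS (@element_domain i)) (off_skeleton_interior xi xs).
Qed.

Definition cells := Omega `\` skeleton.

Lemma cells_measurable : measurable cells.
Proof.
apply: measurableD; last exact: skeleton_measurable.
by apply: rV_open_measurable; exact: domain_open.
Qed.

Lemma domain_measurable : measurable Omega.
Proof. apply: rV_open_measurable; exact: domain_open. Qed.

Lemma domain_bound : exists2 M, 0 <= M & forall x, closure Omega x -> `|x| <= M.
Proof.
by have [M M0 HM] := mesh_bounded; exists M => // x /domain_element[i /HM].
Qed.

Lemma domain_finite : (mu Omega < +oo)%E.
Proof. exact: lebesgue_rV_bounded domain_measurable (pdomain_bounded hO). Qed.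

Lemma cells_finite : (mu cells < +oo)%E.
Proof.
apply: le_lt_trans domain_finite; apply: le_measure; rewrite ?inE//.
- exact: cells_measurable.
- exact: domain_measurable.
- exact: subDsetl.
Qed.

Lemma cells_element x : cells x -> exists2 i, element (v i) x & (element (v i))° x.
Proof.
move=> [Ox xs]; have [i xi] := domain_element (subset_closure Ox).
by exists i => //; exact: off_skeleton_interior.
Qed.

(** A point missed by all translates of [Omega] still lies in a translate of its closure, hence on a
    translate of the skeleton, and there are countably many of these. *)
Lemma domain_ae_fundamental : ae_fundamental_domain L Omega.
Proof.
split; first exact: domain_measurable.
- move=> k x Ox Oxk; apply/eqP/negPn/negP => k0.
  have := pdomain_disjoint hO k0; rewrite -subset0 => /(_ x).
  by apply; split.
- apply/eqP; rewrite eq_le measure_ge0 andbT.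
  pose N := \bigcup_k translate skeleton (lattice_vec L k).
  have mN : measurable N.
    apply: countable_bigcupT_measurable => // k; apply: measurable_translate.
    exact: skeleton_measurable.
  apply: (@le_trans _ _ (mu N)).
    apply: le_measure; rewrite ?inE//.
      apply: measurableC; apply: countable_bigcupT_measurable => // k.
      apply: measurable_translate; exact: domain_measurable.
    move=> x /= nx; have [k ck] := pdomain_cover hO x; exists k => //.
    apply: contrapT => nxs; apply: nx; exists k => //.
    exact: closure_domain.
  rewrite /N measure_bigcup_null// => k.
    apply: measurable_translate; exact: skeleton_measurable.
  exact: etrans (lebesgue_translate _ skeleton_measurable) skeleton_null.
Qed.

Lemma Rintegral_cells (f : 'rV[R]_d -> R) :
  \int[mu]_(x in Omega) f x = \int[mu]_(x in cells) f x.
Proof.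
rewrite /Rintegral; congr fine; apply: integral_setD_null_nonmeasurable.
  exact: skeleton_measurable.
exact: skeleton_null.
Qed.

End mesh.

Arguments skeleton {R d I} v.
Arguments cells {R d} Omega {I} v.

(** * Bounded measurable functions on a set of finite measure *)

Section bounded_measurable.
Context {d : measure_display} {T : measurableType d} {R : realType}.
Variables (mu : {measure set T -> \bar R}) (D : set T).
Implicit Types f g : T -> R.

(** Unlike integrability, this class is stable under products; on a set of finite measure it implies
    integrability, so that integrals of products and sums can be split freely. *)
Definition bounded_measurable f := measurable_fun D f /\
  exists B, forall x, D x -> `|f x| <= B.

Lemma bounded_measurableD f g : bounded_measurable f -> bounded_measurable g ->
  bounded_measurable (fun x => f x + g x).
Proof.
move=> [mf [A fA]] [mg [B gB]]; split; first exact: measurable_funD.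
exists (A + B) => x Dx; apply: le_trans (ler_normD _ _) _.
by rewrite lerD ?fA ?gB.
Qed.

Lemma bounded_measurableM f g : bounded_measurable f -> bounded_measurable g ->
  bounded_measurable (fun x => f x * g x).
Proof.
move=> [mf [A fA]] [mg [B gB]]; split; first exact: measurable_funM.
by exists (A * B) => x Dx; rewrite normrM ler_pM ?fA ?gB.
Qed.

Lemma bounded_measurable_cst c : bounded_measurable (fun=> c).
Proof. by split; [exact: measurable_cst|exists `|c|]. Qed.

Lemma bounded_measurableN f : bounded_measurable f ->
  bounded_measurable (fun x => - f x).
Proof.
move=> bf; rewrite (_ : (fun x => _) = (fun x => (-1) * f x)).
  by apply: bounded_measurableM => //; exact: bounded_measurable_cst.
by apply/funext => x; rewrite mulN1r.
Qed.

Lemma bounded_measurableB f g : bounded_measurable f -> bounded_measurable g ->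
  bounded_measurable (fun x => f x - g x).
Proof.
by move=> bf bg; apply: bounded_measurableD => //; exact: bounded_measurableN.
Qed.

Lemma bounded_measurable_sum (J : Type) (r : seq J) (F : J -> T -> R) :
  (forall j, bounded_measurable (F j)) ->
  bounded_measurable (fun x => \sum_(j <- r) F j x).
Proof.
move=> bF; elim: r => [|j r IH].
  rewrite (_ : (fun x => _) = (fun=> 0)); first exact: bounded_measurable_cst.
  by apply/funext => x; rewrite big_nil.
rewrite (_ : (fun x => _) = (fun x => F j x + \sum_(j <- r) F j x)).
  exact: bounded_measurableD.
by apply/funext => x; rewrite big_cons.
Qed.

Hypotheses (mD : measurable D) (Doo : (mu D < +oo)%E).

Lemma bounded_measurable_integrable f : bounded_measurable f ->
  mu.-integrable D (EFin \o f).
Proof.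
move=> [mf [B fB]]; apply: measurable_bounded_integrable => //.
exists B; split; first exact: num_real.
by move=> M BM x Dx; exact: le_trans (fB x Dx) (ltW BM).
Qed.

Lemma bRintegralD f g : bounded_measurable f -> bounded_measurable g ->
  \int[mu]_(x in D) (f x + g x) = \int[mu]_(x in D) f x + \int[mu]_(x in D) g x.
Proof. by move=> bf bg; apply: RintegralD => //; exact: bounded_measurable_integrable. Qed.

Lemma bRintegralZ (c : R) f : bounded_measurable f ->
  \int[mu]_(x in D) (c * f x) = c * \int[mu]_(x in D) f x.
Proof. by move=> bf; apply: RintegralZl => //; exact: bounded_measurable_integrable. Qed.

Lemma bRintegralB f g : bounded_measurable f -> bounded_measurable g ->
  \int[mu]_(x in D) (f x - g x) = \int[mu]_(x in D) f x - \int[mu]_(x in D) g x.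
Proof. by move=> bf bg; apply: RintegralB => //; exact: bounded_measurable_integrable. Qed.

Lemma bRintegral_sum (J : Type) (r : seq J) (F : J -> T -> R) :
  (forall j, bounded_measurable (F j)) ->
  \int[mu]_(x in D) (\sum_(j <- r) F j x) = \sum_(j <- r) \int[mu]_(x in D) F j x.
Proof.
move=> bF; elim: r => [|j r IH].
  by rewrite big_nil; apply: Rintegral_eq0 => x _; rewrite big_nil.
rewrite big_cons -IH -bRintegralD//; last exact: bounded_measurable_sum.
by apply: eq_Rintegral => x _; rewrite big_cons.
Qed.

Lemma bRintegral_EFin f : bounded_measurable f ->
  ((\int[mu]_(x in D) f x)%:E = \int[mu]_(x in D) (f x)%:E)%E.
Proof.
move=> /bounded_measurable_integrable fi.
by rewrite /Rintegral fineK//; exact: integrable_fin_num.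
Qed.

End bounded_measurable.

(** * Finite element functions *)

Section fe_spaces.
Context {R : realType} {d : nat}.
Local Notation mu := (lebesgue_rV d).
Context {Omega : set 'rV[R]_d} {L : 'M[R]_d} {I : finType}
  {v : I -> 'I_d.+1 -> 'rV[R]_d} {sigma : R}.

Lemma fe_cst k c : fe_space L v k (fun=> c).
Proof.
split; [exact: continuous_fun_cst|by []|move=> i].
exact: polynomial_on_cst.
Qed.

Lemma feW k l f : (k <= l)%N -> fe_space L v k f -> fe_space L v l f.
Proof. by move=> kl [cf pf Pf]; split => // i; exact: polynomial_onW kl (Pf i). Qed.

Lemma feD k f g : fe_space L v k f -> fe_space L v k g ->
  fe_space L v k (fun x => f x + g x).
Proof.
move=> [cf pf Pf] [cg pg Pg]; split.
- exact: continuous_funD.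
- by move=> x l; rewrite pf pg.
- by move=> i; exact: polynomial_onD.
Qed.

Lemma feM k l f g : fe_space L v k f -> fe_space L v l g ->
  fe_space L v (k + l) (fun x => f x * g x).
Proof.
move=> [cf pf Pf] [cg pg Pg]; split.
- exact: continuous_funM.
- by move=> x j; rewrite pf pg.
- by move=> i; exact: polynomial_onM.
Qed.

Lemma feZ k c f : fe_space L v k f -> fe_space L v k (fun x => c * f x).
Proof. by move=> ff; apply: (@feM 0 k) => //; exact: fe_cst. Qed.

Lemma feB k f g : fe_space L v k f -> fe_space L v k g ->
  fe_space L v k (fun x => f x - g x).
Proof.
move=> ff fg; rewrite (_ : (fun x => _) = (fun x => f x + (-1) * g x)).
  by apply: feD => //; exact: feZ.
by apply/funext => x; rewrite mulN1r.
Qed.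

Lemma lipschitz_continuous (f : 'rV[R]_d -> R) C : 0 <= C ->
  (forall x y, `|f x - f y| <= C * `|x - y|) -> continuous f.
Proof.
move=> C0 CL x B /nbhs_ballP[e /= e0 eB]; apply/nbhs_ballP.
have C1 : 0 < C + 1 by rewrite ltr_wpDl.
exists (e / (C + 1)) => /=; first by rewrite divr_gt0.
move=> y; rewrite -ball_normE/= ltr_pdivlMr// => xy; apply: eB.
rewrite -ball_normE/=; apply: le_lt_trans xy; apply: le_trans (CL x y) _.
by rewrite mulrC ler_wpM2l// lerDl.
Qed.

(** Products of discrete functions occur throughout and integration by parts is indifferent to their
    degree; a specific degree matters only for membership in a test space. *)
Definition fe_fun f := exists k, fe_space L v k f.

Lemma fe_fun_cst c : fe_fun (fun=> c).
Proof. by exists 0%N; exact: fe_cst. Qed.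

Lemma fe_funM f g : fe_fun f -> fe_fun g -> fe_fun (fun x => f x * g x).
Proof. by move=> [k kf] [l lg]; exists (k + l)%N; exact: feM. Qed.

Lemma fe_funD f g : fe_fun f -> fe_fun g -> fe_fun (fun x => f x + g x).
Proof.
move=> [k kf] [l lg]; exists (maxn k l).
by apply: feD; [apply: feW kf; exact: leq_maxl|apply: feW lg; exact: leq_maxr].
Qed.

Lemma fe_funB f g : fe_fun f -> fe_fun g -> fe_fun (fun x => f x - g x).
Proof.
move=> [k kf] [l lg]; exists (maxn k l).
by apply: feB; [apply: feW kf; exact: leq_maxl|apply: feW lg; exact: leq_maxr].
Qed.

Lemma fe_fun_sum (J : Type) (r : seq J) (F : J -> 'rV[R]_d -> R) :
  (forall j, fe_fun (F j)) -> fe_fun (fun x => \sum_(j <- r) F j x).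
Proof.
move=> fF; elim: r => [|j r IH].
  rewrite (_ : (fun x => _) = (fun=> 0)); first exact: fe_fun_cst.
  by apply/funext => x; rewrite big_nil.
rewrite (_ : (fun x => _) = (fun x => F j x + \sum_(j <- r) F j x)).
  exact: fe_funD.
by apply/funext => x; rewrite big_cons.
Qed.

Lemma fe_fun_continuous f : fe_fun f -> continuous f.
Proof. by case=> k []. Qed.

Hypotheses (d_gt0 : (0 < d)%N) (hO : periodic_domain Omega L)
  (hT : triangulation Omega L v sigma).

(** On each bounded element the function is a polynomial, hence Lipschitz; periodicity carries the
    constant to translated elements, and the sum over the finite mesh dominates all of them. *)
Lemma fe_fun_lipschitz f : fe_fun f ->
  exists2 C, 0 <= C & forall x y, `|f x - f y| <= C * `|x - y|.
Proof.
move=> [k [cf pf Pf]]; have [M M0 HM] := mesh_bounded (v := v).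
have H i : exists C, 0 <= C /\ forall x y, element (v i) x -> element (v i) y ->
    `|f x - f y| <= C * `|x - y|.
  have [p _ fp] := Pf i; have [C C0 CL] := mpoly_fun_lipschitz p M.
  exists C; split => // x y xi yi; rewrite !fp//.
  by apply: CL; [exact: HM xi|exact: HM yi].
have [c cP] := choice H.
have S0 i : c i <= \sum_i c i.
  by rewrite (bigD1 i)//= lerDl sumr_ge0// => j _; exact: (cP j).1.
exists (\sum_i c i); first by apply: sumr_ge0 => i _; exact: (cP i).1.
apply: (mesh_lipschitz hO hT) => i l x y xi yi.
have fE z : f z = f (z - lattice_vec L l) by rewrite -(pf (z - lattice_vec L l) l) subrK.
rewrite (fE x) (fE y); apply: le_trans ((cP i).2 _ _ xi yi) _.
by rewrite opprB addrA subrK ler_wpM2r.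
Qed.

Lemma fe_fun_bounded f : fe_fun f -> exists B, forall x, `|f x| <= B.
Proof.
move=> ff; have [C C0 CL] := fe_fun_lipschitz ff; have [k [_ pf _]] := ff.
have [M M0 HM] := domain_bound hT.
exists (`|f 0| + C * M) => x.
have [l xl] := pdomain_cover hO x.
rewrite -[x](subrK (lattice_vec L l)) pf.
rewrite -[f _](subrK (f 0)) addrC; apply: le_trans (ler_normD _ _) _.
rewrite lerD2l; apply: le_trans (CL _ _) _; rewrite subr0 ler_wpM2l//.
exact: HM.
Qed.

Lemma fe_fun_derivable f x w : fe_fun f -> cells Omega v x -> derivable f x w.
Proof.
move=> [k [_ _ Pf]] /(cells_element hT)[i _ xi]; have [p _ fp] := Pf i.
have pd := @mpoly_fun_derivable R d p x w.
apply: (@near_eq_derivable R 'rV[R]_d R^o _ f x w _ pd).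
by apply: filterS xi => y yi /=; rewrite fp.
Qed.

Lemma fe_fun_bounded_measurable D f : fe_fun f -> bounded_measurable D f.
Proof.
move=> ff; split; last by have [B fB] := fe_fun_bounded ff; exists B.
by apply: measurable_funTS; apply: rV_continuous_measurable; exact: fe_fun_continuous.
Qed.

Lemma shift_bounded_measurable (D : set 'rV[R]_d) f (h : 'rV[R]_d) : fe_fun f ->
  bounded_measurable D (fun x => f (x + h)).
Proof.
move=> ff; split; last by have [B fB] := fe_fun_bounded ff; exists B.
apply: measurable_funTS; apply: rV_continuous_measurable.
have [C C0 CL] := fe_fun_lipschitz ff.
apply: (lipschitz_continuous (C := C)) => // y z.
by apply: le_trans (CL _ _) _; rewrite opprD addrACA subrr addr0.
Qed.

Lemma Rintegral_shift f (h : 'rV[R]_d) : fe_fun f ->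
  \int[mu]_(x in Omega) f (x + h) = \int[mu]_(x in Omega) f x.
Proof.
move=> ff; have [B fB] := fe_fun_bounded ff; have [k [_ pf _]] := ff.
have mO := domain_measurable hO; have Ooo := domain_finite hO.
have bc := bounded_measurable_cst Omega B.
have bf : bounded_measurable Omega f by exact: fe_fun_bounded_measurable.
have bfh := shift_bounded_measurable Omega h ff.
have fB0 x : 0 <= f x + B by have := fB x; rewrite ler_norml => /andP[]; rewrite -subr_ge0 opprK.
(* Fundamental domains were compared for nonnegative functions; adding the bound [B] makes both
   integrands nonnegative. *)
suff : \int[mu]_(x in Omega) (f (x + h) + B) = \int[mu]_(x in Omega) (f x + B).
  by rewrite !(bRintegralD mO Ooo)// => /addIr.
rewrite /Rintegral; congr fine.
have mfB : measurable_fun setT (fun x => (f x + B)%:E).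
  apply/measurable_EFinP; apply: rV_continuous_measurable.
  by apply: continuous_funD; [exact: fe_fun_continuous|exact: continuous_fun_cst].
have fO := domain_ae_fundamental d_gt0 hO hT.
rewrite (@ge0_integral_translate _ _ _ h (fun x => (f x + B)%:E))//.
apply: (ge0_integral_ae_fundamental_domain (L := L)) => //.
- exact: ae_fundamental_domain_translate.
- by move=> x l; rewrite pf.
Qed.

Lemma partial_bounded_measurable_integral0 f i : fe_fun f ->
  bounded_measurable (cells Omega v) (partial i f) /\
  \int[mu]_(x in cells Omega v) partial i f x = 0.
Proof.
move=> ff; have [C C0 CL] := fe_fun_lipschitz ff.
set D := cells Omega v.
have mD : measurable D by exact: cells_measurable hO hT.
have Doo : (mu D < +oo)%E by exact: cells_finite hO hT.
pose e : 'rV[R]_d := delta_mx ord0 i.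
pose h n : R := n.+1%:R^-1.
pose q n x := (h n)^-1 * (f (x + h n *: e) - f x).
have h0 n : 0 < h n by rewrite invr_gt0.
have e1 : `|e| <= 1.
  apply/rV_norm_leP => // j; rewrite mxE eqxx /=.
  by case: (j == i); rewrite ?normr1 ?normr0.
have qC n x : `|q n x| <= C.
  rewrite normrM gtr0_norm ?invr_gt0// ler_pdivrMl// mulrC.
  apply: le_trans (CL _ _) _; rewrite ler_wpM2l// addrAC subrr add0r normrZ gtr0_norm//.
  exact: ler_piMr (ltW (h0 n)) e1.
have bq n : bounded_measurable D (q n).
  apply: bounded_measurableM; first exact: bounded_measurable_cst.
  by apply: bounded_measurableB; [exact: shift_bounded_measurable|exact: fe_fun_bounded_measurable].
have q0 n : \int[mu]_(x in D) q n x = 0.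
  rewrite (bRintegralZ mD Doo); last first.
    apply: bounded_measurableB; first exact: shift_bounded_measurable.
    exact: fe_fun_bounded_measurable.
  rewrite (bRintegralB mD Doo); last 2 first.
  - exact: shift_bounded_measurable.
  - exact: fe_fun_bounded_measurable.
  by rewrite -!(Rintegral_cells d_gt0 hT) Rintegral_shift// subrr mulr0.
(* [derivable] is a limit over punctured neighbourhoods of 0, which the nonzero steps [h n]
   eventually enter. *)
have hcvg : h n @[n --> \oo] --> (0 : R)^'.
  have hc : h n @[n --> \oo] --> (0 : R) by exact: cvg_harmonic.
  move=> B /hc; rewrite /= !near_simpl => B0.
  by apply: filterS B0 => n; apply; rewrite gt_eqF.
have qcvg x : D x -> q n x @[n --> \oo] --> partial i f x.
  move=> Dx; have df : derivable f x e by exact: fe_fun_derivable.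
  have := cvg_comp _ _ hcvg df.
  rewrite (_ : _ \o _ = q ^~ x)//.
  by apply/funext => n; rewrite /q /= [_ + x]addrC.
(* On [D] the derivative is a pointwise limit of measurable quotients, which is where its
   measurability comes from. *)
have mp : measurable_fun D (partial i f).
  exact: (measurable_fun_cvg (fun n => (bq n).1) qcvg).
have pC x : D x -> `|partial i f x| <= C.
  move=> Dx; suff : partial i f x \in `[- C, C] by rewrite in_itv/= ler_norml.
  apply: (closed_cvg (fun r => r \in `[- C, C]) _ _ _ (qcvg x Dx)).
    exact: interval_closed.
  by near=> n; rewrite in_itv/= -ler_norml.
have bp : bounded_measurable D (partial i f) by split => //; exists C.
split => //.
have : (\int[mu]_(x in D) (q n x)%:E)%E @[n --> \oo] -->
    (\int[mu]_(x in D) (partial i f x)%:E)%E.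
  apply: (@dominated_cvg _ _ _ mu D mD _ _ (fun=> C%:E)) => //.
  - by move=> n; apply/measurable_EFinP; exact: (bq n).1.
  - by move=> x Dx; apply/cvg_EFin; [exact: nearW|exact: qcvg].
  - by apply: bounded_measurable_integrable => //; exact: bounded_measurable_cst.
  - by move=> n x _; rewrite lee_fin.
have -> : (fun n => \int[mu]_(x in D) (q n x)%:E)%E = (fun=> 0%E).
  by apply/funext => n; rewrite -bRintegral_EFin// q0.
move=> /(cvg_lim (@ereal_hausdorff R)); rewrite lim_cst//.
by rewrite /Rintegral => <-.
Unshelve. all: by end_near. Qed.

End fe_spaces.

(** * Integration by parts *)

Section calculus.
Context {R : realType} {d : nat}.
Local Notation mu := (lebesgue_rV d).
Context {Omega : set 'rV[R]_d} {L : 'M[R]_d} {I : finType}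
  {v : I -> 'I_d.+1 -> 'rV[R]_d} {sigma : R}.
Hypotheses (d_gt0 : (0 < d)%N) (hO : periodic_domain Omega L)
  (hT : triangulation Omega L v sigma).
Local Notation D := (cells Omega v).
Local Notation fe := (@fe_fun R d L I v).
Local Notation bm := (bounded_measurable D).
Local Notation "'\intD' f" := (\int[mu]_(x in D) f x) (at level 10, f at level 9).

Let mD : measurable D := cells_measurable hO hT.
Let Doo : (mu D < +oo)%E := cells_finite hO hT.

Implicit Types (f g : 'rV[R]_d -> R) (U V : 'I_d -> 'rV[R]_d -> R).

Lemma partial_bm i f : fe f -> bm (partial i f).
Proof. by move=> /(partial_bounded_measurable_integral0 d_gt0 hO hT i)[]. Qed.

Lemma fe_bm f : fe f -> bm f.
Proof. exact: fe_fun_bounded_measurable hO hT _ _. Qed.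

Lemma partialM i f g x : fe f -> fe g -> D x ->
  partial i (fun y => f y * g y) x = f x * partial i g x + g x * partial i f x.
Proof.
move=> ff fg Dx; rewrite /partial (@deriveM _ _ f g)//; exact: (fe_fun_derivable hT).
Qed.

Lemma partialD i f g x : fe f -> fe g -> D x ->
  partial i (fun y => f y + g y) x = partial i f x + partial i g x.
Proof.
move=> ff fg Dx; rewrite /partial (@deriveD _ _ _ f g)//; exact: (fe_fun_derivable hT).
Qed.

Lemma partialB i f g x : fe f -> fe g -> D x ->
  partial i (fun y => f y - g y) x = partial i f x - partial i g x.
Proof.
move=> ff fg Dx; rewrite /partial (@deriveB _ _ _ f g)//; exact: (fe_fun_derivable hT).
Qed.

Lemma partial_cst i (c : R) (x : 'rV[R]_d) : partial i (fun=> c) x = 0.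
Proof. by rewrite /partial derive_cst. Qed.

(** The convective derivative. The field is given by its scalar components so that each of them can
    be a finite element function in its own right. *)
Definition adv U f x := \sum_i U i x * partial i f x.

Definition dive U x := \sum_i partial i (U i) x.

Lemma adv_bm U f : (forall i, fe (U i)) -> fe f -> bm (adv U f).
Proof.
move=> fU ff; apply: bounded_measurable_sum => i.
by apply: bounded_measurableM; [exact: fe_bm|exact: partial_bm].
Qed.

Lemma dive_bm U : (forall i, fe (U i)) -> bm (dive U).
Proof. by move=> fU; apply: bounded_measurable_sum => i; exact: partial_bm. Qed.

Lemma advM U f g x : fe f -> fe g -> D x ->
  adv U (fun y => f y * g y) x = f x * adv U g x + g x * adv U f x.
Proof.
move=> ff fg Dx; rewrite /adv !mulr_sumr -big_split; apply: eq_bigr => i _ /=.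
by rewrite partialM//; ring.
Qed.

Lemma advD U f g x : fe f -> fe g -> D x ->
  adv U (fun y => f y + g y) x = adv U f x + adv U g x.
Proof.
move=> ff fg Dx; rewrite /adv -big_split; apply: eq_bigr => i _ /=.
by rewrite partialD//; ring.
Qed.

Lemma advB U f g x : fe f -> fe g -> D x ->
  adv U (fun y => f y - g y) x = adv U f x - adv U g x.
Proof.
move=> ff fg Dx; rewrite /adv -sumrB; apply: eq_bigr => i _ /=.
by rewrite partialB//; ring.
Qed.

Lemma adv_cst U (c : R) x : adv U (fun=> c) x = 0.
Proof. by rewrite /adv big1// => i _; rewrite partial_cst mulr0. Qed.

Lemma adv_sum U (J : Type) (r : seq J) (F : J -> 'rV[R]_d -> R) x :
  (forall j, fe (F j)) -> D x ->
  adv U (fun y => \sum_(j <- r) F j y) x = \sum_(j <- r) adv U (F j) x.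
Proof.
move=> fF Dx; elim: r => [|j r IH].
  rewrite big_nil -[RHS](adv_cst U 0 x); congr adv.
  by apply/funext => y; rewrite big_nil.
rewrite big_cons -IH -advD//; last exact: fe_fun_sum.
by congr adv; apply/funext => y; rewrite big_cons.
Qed.

(** By the product rule the integrand is the divergence of [f U], a sum of partial derivatives that
    all have zero integral. *)
Lemma integral_by_parts U f : (forall i, fe (U i)) -> fe f ->
  \int[mu]_(x in D) (adv U f x + dive U x * f x) = 0.
Proof.
move=> fU ff.
rewrite (_ : 0 = \int[mu]_(x in D) (\sum_i partial i (fun y => U i y * f y) x)).
  apply: eq_Rintegral => x /set_mem Dx; rewrite mulr_suml -big_split.
  by apply: eq_bigr => i _ /=; rewrite partialM//; ring.
rewrite (bRintegral_sum mD Doo) ?big1// => [i _|i].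
  by have [_ ->] := partial_bounded_measurable_integral0 d_gt0 hO hT i (fe_funM (fU i) ff).
by apply: partial_bm; exact: fe_funM.
Qed.

End calculus.

Ltac bm_leaf :=
  match goal with
  | H : bounded_measurable ?D ?f |- bounded_measurable ?D ?f => exact H
  | H : bounded_measurable ?D ?f |- bounded_measurable ?D (fun x => ?f x) => exact H
  | H : forall j, bounded_measurable ?D (?F j) |- bounded_measurable ?D (?F _) =>
      exact (H _)
  | H : forall j, bounded_measurable ?D (?F j) |-
      bounded_measurable ?D (fun x => ?F _ x) => exact (H _)
  | H : forall j, bounded_measurable ?D (adv ?W (?F j)) |-
      bounded_measurable ?D (adv ?W (?F _)) => exact (H _)
  | H : forall j, bounded_measurable ?D (adv ?W (?F j)) |-
      bounded_measurable ?D (fun x => adv ?W (?F _) x) => exact (H _)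
  end.

(** Descends through sums, products and opposites; [adv], [dive] and the discrete functions are
    leaves, to be closed by hypotheses already in the context. *)
Ltac bm_solve :=
  lazymatch goal with
  | |- bounded_measurable _ (fun _ => ?c) => exact: bounded_measurable_cst
  | |- bounded_measurable _ (fun x => - _) => apply: bounded_measurableN; bm_solve
  | |- bounded_measurable _ (fun x => _ + _) =>
      apply: bounded_measurableD; bm_solve
  | |- bounded_measurable _ (fun x => _ * _) =>
      apply: bounded_measurableM; bm_solve
  | |- bounded_measurable _ (fun x => \sum_(j <- _) _) =>
      apply: bounded_measurable_sum => ?; bm_solve
  | |- bounded_measurable _ _ => bm_leaf
  end.

(** * Balances of the tested density and momentum equations *)

Section balance.
Local Opaque adv dive bounded_measurable.
Context {R : realType} {d : nat}.
Local Notation mu := (lebesgue_rV d).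
Context {Omega : set 'rV[R]_d} {L : 'M[R]_d} {I : finType}
  {v : I -> 'I_d.+1 -> 'rV[R]_d} {sigma : R}.
Hypotheses (d_gt0 : (0 < d)%N) (hO : periodic_domain Omega L)
  (hT : triangulation Omega L v sigma).
Local Notation D := (cells Omega v).
Local Notation fe := (@fe_fun R d L I v).
Local Notation bm := (bounded_measurable D).

Let mD : measurable D := cells_measurable hO hT.
Let Doo : (mu D < +oo)%E := cells_finite hO hT.

Variables (rho P s : 'rV[R]_d -> R) (U V : 'I_d -> 'rV[R]_d -> R).
Variables (alpha_rho alpha_m alpha_P r : R).
Hypotheses (frho : fe rho) (fP : fe P) (fs : fe s) (fU : forall i, fe (U i))
  (fV : forall i, fe (V i)).

Let m j x := rho x * U j x.
Let q x := \sum_j U j x * U j x.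

Let fm j : fe (m j). Proof. exact: fe_funM. Qed.
Let fq : fe q. Proof. by apply: fe_fun_sum => j; exact: fe_funM. Qed.

(** Removing the exact terms for [rho] and for the constant 1 eliminates convection and the
    reference value [r]. The rest vanishes for [alpha_rho = 1], or when [rho] is admissible in the
    weak divergence constraint. *)
Lemma mass_balance :
  \int[mu]_(x in D) (adv U rho x * 1)
  + alpha_rho * \int[mu]_(x in D) (dive U x * (rho x - r) * 1)
  = (alpha_rho - 1) * \int[mu]_(x in D) (dive U x * rho x).
Proof.
have f1 : fe (fun=> 1) by exact: fe_fun_cst.
have ibp1 := integral_by_parts d_gt0 hO hT fU f1.
have ibpr := integral_by_parts d_gt0 hO hT fU frho.
have bU := dive_bm d_gt0 hO hT fU.
have bUrho := adv_bm d_gt0 hO hT fU frho.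
have bm_rho := fe_bm hO hT frho.
transitivity (\int[mu]_(x in D) (adv U rho x * 1
    + alpha_rho * (dive U x * (rho x - r) * 1))).
  rewrite (bRintegralD mD Doo); try by bm_solve.
  by rewrite (bRintegralZ mD Doo)//; bm_solve.
transitivity (\int[mu]_(x in D)
    ((adv U rho x + dive U x * rho x) + (alpha_rho - 1) * (dive U x * rho x)
     - alpha_rho * r * (dive U x * 1))).
  by apply: eq_Rintegral => x _; ring.
have div0 : \int[mu]_(x in D) (dive U x * 1) = 0.
  rewrite -[RHS]ibp1; apply: eq_Rintegral => x _.
  by rewrite adv_cst add0r.
rewrite (bRintegralB mD Doo); try by bm_solve.
rewrite (bRintegralD mD Doo); try by bm_solve.
rewrite !(bRintegralZ mD Doo); try by bm_solve.
by rewrite ibpr div0 mulr0 subr0 add0r.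
Qed.

(** [rho] times its convective derivative is half the convective derivative of [rho ^ 2]: this is
    the origin of the special value [2^-1] of [alpha_rho]. *)
Lemma square_balance :
  \int[mu]_(x in D) (adv U rho x * rho x)
  + alpha_rho * \int[mu]_(x in D) (dive U x * (rho x - r) * rho x)
  = (alpha_rho - 2^-1) * \int[mu]_(x in D) (dive U x * (rho x * rho x))
    - alpha_rho * r * \int[mu]_(x in D) (dive U x * rho x).
Proof.
have frr : fe (fun x => rho x * rho x) by exact: fe_funM.
have ibpr := integral_by_parts d_gt0 hO hT fU frr.
have bU := dive_bm d_gt0 hO hT fU.
have bUrho := adv_bm d_gt0 hO hT fU frho.
have bUrr := adv_bm d_gt0 hO hT fU frr.
have bm_rho := fe_bm hO hT frho.
transitivity (\int[mu]_(x in D) (adv U rho x * rho x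
    + alpha_rho * (dive U x * (rho x - r) * rho x))).
  rewrite (bRintegralD mD Doo); try by bm_solve.
  by rewrite (bRintegralZ mD Doo)//; bm_solve.
transitivity (\int[mu]_(x in D)
    (2^-1 * (adv U (fun y => rho y * rho y) x + dive U x * (rho x * rho x))
     + ((alpha_rho - 2^-1) * (dive U x * (rho x * rho x))
     - alpha_rho * r * (dive U x * rho x)))).
  by apply: eq_Rintegral => x /set_mem Dx; rewrite (advM hT)//; field.
rewrite (bRintegralD mD Doo); try by bm_solve.
rewrite (bRintegralB mD Doo); try by bm_solve.
rewrite !(bRintegralZ mD Doo); try by bm_solve.
by rewrite ibpr mulr0 add0r.
Qed.

(** The momentum equation without its time derivative. [s] is left free: the energy law uses the
    projected squared speed, the momentum laws the pointwise one [q]. *)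
Definition momentum_form : R :=
  \int[mu]_(x in D) (\sum_j adv U (m j) x * V j x)
  + alpha_m * \int[mu]_(x in D) (dive U x * \sum_j m j x * V j x)
  + \int[mu]_(x in D) adv V P x
  + (alpha_P - 2^-1) * \int[mu]_(x in D) (\sum_j adv V (m j) x * U j x)
  + (alpha_P + 2^-1) * \int[mu]_(x in D) (\sum_j adv V (U j) x * m j x)
  + 2^-1 * alpha_rho * \int[mu]_(x in D) adv V (fun y => rho y * q y) x
  + 2^-1 * (\int[mu]_(x in D) (adv V rho x * s x)
     - alpha_rho * \int[mu]_(x in D) adv V (fun y => (rho y - r) * s y) x).

(** The same terms under one integral sign, so that cancellations become ring identities at each
    point of [D]. *)
Definition momentum_integrand x : R :=
  \sum_j adv U (m j) x * V j x
  + alpha_m * (dive U x * \sum_j m j x * V j x)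
  + adv V P x
  + (alpha_P - 2^-1) * (\sum_j adv V (m j) x * U j x)
  + (alpha_P + 2^-1) * (\sum_j adv V (U j) x * m j x)
  + 2^-1 * alpha_rho * adv V (fun y => rho y * q y) x
  + 2^-1 * (adv V rho x * s x - alpha_rho * adv V (fun y => (rho y - r) * s y) x).

Lemma momentum_formE :
  momentum_form = \int[mu]_(x in D) momentum_integrand x.
Proof.
have bU := dive_bm d_gt0 hO hT fU.
have bUm j := adv_bm d_gt0 hO hT fU (fm j).
have bVm j := adv_bm d_gt0 hO hT fV (fm j).
have bVU j := adv_bm d_gt0 hO hT fV (fU j).
have bVP := adv_bm d_gt0 hO hT fV fP.
have bVrho := adv_bm d_gt0 hO hT fV frho.
have bVq := adv_bm d_gt0 hO hT fV (fe_funM frho fq).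
have bVs := adv_bm d_gt0 hO hT fV (fe_funM (fe_funB frho (fe_fun_cst r)) fs).
have bm_m j := fe_bm hO hT (fm j).
have bm_U j := fe_bm hO hT (fU j).
have bm_V j := fe_bm hO hT (fV j).
have bm_s := fe_bm hO hT fs.
rewrite /momentum_form /momentum_integrand.
rewrite [RHS](bRintegralD mD Doo); try by bm_solve.
rewrite [X in _ = X + _](bRintegralD mD Doo); try by bm_solve.
rewrite [X in _ = X + _ + _](bRintegralD mD Doo); try by bm_solve.
rewrite [X in _ = X + _ + _ + _](bRintegralD mD Doo); try by bm_solve.
rewrite [X in _ = X + _ + _ + _ + _](bRintegralD mD Doo); try by bm_solve.
rewrite [X in _ = X + _ + _ + _ + _ + _](bRintegralD mD Doo); try by bm_solve.
congr (_ + _ + _ + _ + _ + _ + _).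
- by apply/esym/(bRintegralZ mD Doo); bm_solve.
- by apply/esym/(bRintegralZ mD Doo); bm_solve.
- by apply/esym/(bRintegralZ mD Doo); bm_solve.
- by apply/esym/(bRintegralZ mD Doo); bm_solve.
- rewrite [RHS](bRintegralZ mD Doo); try by bm_solve.
  congr (_ * _); rewrite [RHS](bRintegralB mD Doo); try by bm_solve.
  by congr (_ - _); apply/esym/(bRintegralZ mD Doo); bm_solve.
Qed.

Let ibp f : fe f -> \int[mu]_(x in D) (adv V f x + dive V x * f x) = 0.
Proof. exact: integral_by_parts d_gt0 hO hT _ _ fV. Qed.

Lemma adv_momentum W j x : D x ->
  adv W (m j) x = rho x * adv W (U j) x + U j x * adv W rho x.
Proof. by move=> Dx; rewrite (advM hT). Qed.

Lemma adv_speed W x : D x -> adv W q x = 2 * \sum_j U j x * adv W (U j) x.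
Proof.
move=> Dx; rewrite (adv_sum hT)//; last by move=> j; exact: fe_funM.
by rewrite mulr_sumr; apply: eq_bigr => j _; rewrite (advM hT)//; ring.
Qed.

(** With [s = q] the density gradients left by the two forms in [alpha_P] are cancelled by the
    correction term, and all terms containing derivatives along [V] merge into the gradient of the
    single potential [phi]; [alpha_m = 1] makes the transport of [m] exact. After integration by
    parts every term carries a derivative of the test field. The constant [c] is free because only
    the gradient of the pressure enters. *)
Lemma momentum_balance c : alpha_m = 1 -> s = q ->
  momentum_form = - \int[mu]_(x in D) (\sum_j m j x * adv U (V j) x
    + dive V x * (P x - c + alpha_P * (rho x * q x) + 2^-1 * alpha_rho * r * q x)).
Proof.
move=> alphaE sq; rewrite momentum_formE.
pose phi x := P x - c + alpha_P * (rho x * q x) + 2^-1 * alpha_rho * r * q x.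
pose psi x := \sum_j m j x * V j x.
have fphi : fe phi.
  exact: fe_funD (fe_funD (fe_funB fP (fe_fun_cst c))
    (fe_funM (fe_fun_cst alpha_P) (fe_funM frho fq))) (fe_funM (fe_fun_cst _) fq).
have fpsi : fe psi by apply: fe_fun_sum => j; exact: fe_funM.
have ibpV := ibp fphi.
have ibpU := integral_by_parts d_gt0 hO hT fU fpsi.
have bU := dive_bm d_gt0 hO hT fU.
have bV := dive_bm d_gt0 hO hT fV.
have bUV j := adv_bm d_gt0 hO hT fU (fV j).
have bUpsi := adv_bm d_gt0 hO hT fU fpsi.
have bVphi := adv_bm d_gt0 hO hT fV fphi.
have bm_m j := fe_bm hO hT (fm j).
have bm_psi := fe_bm hO hT fpsi.
have bm_phi := fe_bm hO hT fphi.
rewrite -/phi; transitivity (\int[mu]_(x in D)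
    ((adv U psi x + dive U x * psi x) + (adv V phi x + dive V x * phi x)
     - (\sum_j m j x * adv U (V j) x + dive V x * phi x))); last first.
  rewrite (bRintegralB mD Doo); try by bm_solve.
  rewrite (bRintegralD mD Doo); try by bm_solve.
  by rewrite ibpV ibpU addr0 sub0r.
apply: eq_Rintegral => x /set_mem Dx; rewrite /momentum_integrand alphaE sq.
have -> : adv U psi x = \sum_j adv U (m j) x * V j x + \sum_j m j x * adv U (V j) x.
  rewrite (adv_sum hT)//; last by move=> j; exact: fe_funM.
  rewrite -big_split; apply: eq_bigr => j _ /=; rewrite (advM hT)//; ring.
have fc k : fe (fun=> k) by exact: fe_fun_cst.
have -> : adv V phi x = adv V P x + alpha_P * adv V (fun y => rho y * q y) x
    + 2^-1 * alpha_rho * r * adv V q x.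
  rewrite /phi (advD hT V (fe_funD (fe_funB fP (fc c)) (fe_funM (fc alpha_P)
    (fe_funM frho fq))) (fe_funM (fc _) fq) Dx).
  rewrite (advD hT V (fe_funB fP (fc c)) (fe_funM (fc alpha_P) (fe_funM frho fq)) Dx).
  rewrite (advB hT V fP (fc c) Dx) adv_cst subr0.
  rewrite (advM hT V (fc alpha_P) (fe_funM frho fq) Dx).
  rewrite (advM hT V (fc (2^-1 * alpha_rho * r)) fq Dx) !adv_cst; ring.
rewrite (advM hT V frho fq Dx) (advM hT V (fe_funB frho (fc r)) fq Dx).
rewrite (advB hT V frho (fc r) Dx) adv_cst subr0 adv_speed//.
pose E := \sum_j U j x * adv V (U j) x.
have -> : \sum_j adv V (m j) x * U j x = rho x * E + q x * adv V rho x.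
  rewrite /E /q mulr_sumr mulr_suml -big_split; apply: eq_bigr => j _ /=.
  rewrite adv_momentum//; ring.
have -> : \sum_j adv V (U j) x * m j x = rho x * E.
  rewrite /E mulr_sumr; apply: eq_bigr => j _; rewrite /m; ring.
by rewrite -/E /psi; field.
Qed.

(** For [V = U] the two convective forms of [m] and [U] combine to [alpha_P + 2^-1] times
    [adv U psi], and the gradient of [m . u] adds [2^-1 * alpha_rho]. The parameter condition says
    that the total is [alpha_m], the factor of [dive U * psi], so that these terms are exact. What
    remains is half of the density form tested with [s]. *)
Lemma energy_balance : V = U -> alpha_m - alpha_P - 2^-1 * alpha_rho = 2^-1 ->
  \int[mu]_(x in D) (dive U x * P x) = 0 ->
  momentum_form = 2^-1 * (\int[mu]_(x in D) (adv U rho x * s x)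
    + alpha_rho * \int[mu]_(x in D) (dive U x * (rho x - r) * s x)).
Proof.
move=> VU alphaE divP; rewrite momentum_formE.
pose g x := (rho x - r) * s x.
pose psi x := rho x * q x.
have fpsi : fe psi by exact: fe_funM.
have fr : fe (fun y => rho y - r) by apply: fe_funB => //; exact: fe_fun_cst.
have fg : fe g by exact: fe_funM.
have ibpq := integral_by_parts d_gt0 hO hT fU fpsi.
have ibpP := integral_by_parts d_gt0 hO hT fU fP.
have ibpg := integral_by_parts d_gt0 hO hT fU fg.
have bU := dive_bm d_gt0 hO hT fU.
have bUpsi := adv_bm d_gt0 hO hT fU fpsi.
have bUP := adv_bm d_gt0 hO hT fU fP.
have bUg := adv_bm d_gt0 hO hT fU fg.
have bUrho := adv_bm d_gt0 hO hT fU frho.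
have bm_psi := fe_bm hO hT fpsi.
have bm_P := fe_bm hO hT fP.
have bm_g := fe_bm hO hT fg.
have bm_s := fe_bm hO hT fs.
have bm_rho := fe_bm hO hT frho.
transitivity (\int[mu]_(x in D)
    (alpha_m * (adv U psi x + dive U x * psi x)
     + (adv U P x + dive U x * P x) - dive U x * P x
     + 2^-1 * (adv U rho x * s x + alpha_rho * (dive U x * (rho x - r) * s x))
     - 2^-1 * alpha_rho * (adv U g x + dive U x * g x))); last first.
  rewrite (bRintegralB mD Doo); try by bm_solve.
  rewrite (bRintegralD mD Doo); try by bm_solve.
  rewrite (bRintegralB mD Doo); try by bm_solve.
  rewrite (bRintegralD mD Doo); try by bm_solve.
  rewrite !(bRintegralZ mD Doo); try by bm_solve.
  rewrite ibpq ibpP ibpg divP.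
  rewrite (bRintegralD mD Doo); try by bm_solve.
  rewrite (bRintegralZ mD Doo); try by bm_solve.
  by rewrite !mulr0 !addr0 !subr0 add0r.
apply: eq_Rintegral => x /set_mem Dx; rewrite /momentum_integrand VU.
have -> : alpha_m = alpha_P + 2^-1 * alpha_rho + 2^-1 by move: alphaE; lra.
have -> : \sum_j m j x * U j x = psi x.
  by rewrite /psi /q mulr_sumr; apply: eq_bigr => j _; rewrite mulrA.
have -> : adv U psi x = \sum_j adv U (m j) x * U j x + \sum_j adv U (U j) x * m j x.
  rewrite -big_split /psi.
  rewrite (_ : (fun x => _) = (fun y => \sum_j m j y * U j y)); last first.
    by apply/funext => y; rewrite /q mulr_sumr; apply: eq_bigr => j _; rewrite mulrA.
  rewrite (adv_sum hT)//; last by move=> j; exact: fe_funM.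
  by apply: eq_bigr => j _ /=; rewrite (advM hT)//; ring.
by rewrite -/psi -/g /g; field.
Qed.

End balance.

(** * Time derivatives *)

Section time_derivative.
Context {R : realType}.
Variables (T : R) (T_gt0 : 0 < T).

Local Notation at_time t := (within `[0, T] (t^')).

(** A positive [T] leaves room to approach [t] from within the interval, from the left when [t = T].
    Uniqueness of time derivatives rests on this. *)
Lemma at_time_proper (t : R) : t \in `[0, T] -> ProperFilter (at_time t).
Proof.
rewrite in_itv/= => /andP[t0 tT]; apply: Build_ProperFilter_ex => //.
move=> P /= [e /= e0 eP].
have [tT'|Tt] := ltP t T.
  pose s := Num.min T (t + e / 2).
  have ts : t < s by rewrite lt_min tT' ltrDl divr_gt0.
  exists s; apply: eP.
  - rewrite /= distrC gtr0_norm ?subr_gt0// ltrBlDl.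
    by rewrite gt_min; apply/orP; right; lra.
  - by rewrite gt_eqF.
  - by rewrite /= in_itv/= (le_trans t0 (ltW ts)) ge_min lexx.
have tE : t = T by apply/eqP; rewrite eq_le tT.
pose s := Num.max 0 (t - e / 2).
have st : s < t by rewrite gt_max {1}tE T_gt0/= ltrBlDr ltrDl divr_gt0.
exists s; apply: eP.
- rewrite /= gtr0_norm ?subr_gt0// ltrBlDr -ltrBlDl.
  by rewrite lt_max; apply/orP; right; lra.
- by rewrite lt_eqF.
- by rewrite /= in_itv/= le_max lexx (ltW (lt_le_trans st tT)).
Qed.

Lemma at_time_near (t e : R) : 0 < e ->
  \forall s \near at_time t, [/\ s \in `[0, T], s - t != 0 & `|s - t| < e].
Proof.
move=> e0; exists e => //= s; rewrite /= distrC => se st s0T.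
by split => //; rewrite subr_eq0.
Qed.

Section uniform_derivative.
Context {X : Type}.
Variable (D : set X).
Implicit Types (f g : R -> X -> R) (t : R).

(** Strong enough to differentiate under an integral, stable under products of bounded functions,
    and on a one-point domain equivalent to the ordinary derivative. *)
Definition uniform_dt f t (f' : X -> R) := forall e, 0 < e ->
  \forall s \near at_time t, forall x, D x ->
    `|(s - t)^-1 * (f s x - f t x) - f' x| <= e.

Lemma uniform_dtM f g t (f' g' : X -> R) :
  (exists B, forall x, D x -> `|f t x| <= B) ->
  (exists B, forall x, D x -> `|g t x| <= B) ->
  (exists B, forall x, D x -> `|f' x| <= B) ->
  (exists B, forall x, D x -> `|g' x| <= B) ->
  uniform_dt f t f' -> uniform_dt g t g' ->
  uniform_dt (fun s x => f s x * g s x) t (fun x => f' x * g t x + f t x * g' x).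
Proof.
move=> [F0 HF] [G0 HG] [A0 HA] [B0 HB] df dg e e0.
(* The given bounds may be zero or negative; [1 + |r|] is a bound by which one can divide. *)
have pos (r : R) : 0 < 1 + `|r| by rewrite ltr_wpDr.
have bnd (h : X -> R) r : (forall x, D x -> `|h x| <= r) ->
    forall x, D x -> `|h x| <= 1 + `|r|.
  move=> hr x Dx; apply: le_trans (hr x Dx) _.
  by apply: le_trans (ler_norm r) _; rewrite lerDr.
move: (1 + `|F0|) (pos F0) (bnd _ _ HF) => F Fp {}HF.
move: (1 + `|G0|) (pos G0) (bnd _ _ HG) => G Gp {}HG.
move: (1 + `|A0|) (pos A0) (bnd _ _ HA) => A Ap {}HA.
move: (1 + `|B0|) (pos B0) (bnd _ _ HB) => B Bp {}HB.
have d0 : 0 < e / 3 / ((A + 1) * (B + 1)) by rewrite !divr_gt0 ?mulr_gt0 ?addr_gt0.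
have eG : 0 < e / 3 / G by rewrite !divr_gt0.
have eF : 0 < e / 3 / F by rewrite !divr_gt0.
near=> s => x Dx.
have [_ st sd] : [/\ s \in `[0, T], s - t != 0 &
    `|s - t| < e / 3 / ((A + 1) * (B + 1))] by near: s; exact: at_time_near.
have qf1 : `|(s - t)^-1 * (f s x - f t x) - f' x| <= 1.
  by move: (x) Dx; near: s; exact: df.
have qg1 : `|(s - t)^-1 * (g s x - g t x) - g' x| <= 1.
  by move: (x) Dx; near: s; exact: dg.
have qfe : `|(s - t)^-1 * (f s x - f t x) - f' x| <= e / 3 / G.
  by move: (x) Dx; near: s; exact: df.
have qge : `|(s - t)^-1 * (g s x - g t x) - g' x| <= e / 3 / F.
  by move: (x) Dx; near: s; exact: dg.
set Qf := (s - t)^-1 * (f s x - f t x) in qf1 qfe.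
set Qg := (s - t)^-1 * (g s x - g t x) in qg1 qge.
have QfA : `|Qf| <= A + 1.
  rewrite -[Qf](subrK (f' x)); apply: le_trans (ler_normD _ _) _.
  by rewrite addrC lerD// HA.
have QgB : `|Qg| <= B + 1.
  rewrite -[Qg](subrK (g' x)); apply: le_trans (ler_normD _ _) _.
  by rewrite addrC lerD// HB.
(* The first term is small because [s] is close to [t], the other two because the quotients are
   close to their limits; each receives [e / 3]. *)
rewrite (_ : _ - _ = Qf * Qg * (s - t) + (Qf - f' x) * g t x + f t x * (Qg - g' x)); last first.
  by rewrite /Qf /Qg; field.
clearbody Qf Qg; apply: le_trans (ler_normD _ _) _.
apply: le_trans (lerD (ler_normD _ _) (lexx _)) _; rewrite !normrM.
rewrite (_ : e = e / 3 + e / 3 + e / 3); last by field.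
apply: lerD; first apply: lerD.
- have := ltW sd; rewrite ler_pdivlMr ?mulr_gt0 ?addr_gt0// mulrC; apply: le_trans.
  by rewrite ler_wpM2r//; apply: ler_pM.
- have := qfe; rewrite ler_pdivlMr//; apply: le_trans.
  by rewrite ler_wpM2l// HG.
- have := qge; rewrite ler_pdivlMr//; apply: le_trans.
  by rewrite mulrC ler_wpM2l// HF.
Unshelve. all: by end_near. Qed.

Lemma uniform_dt_cst (c : X -> R) t : uniform_dt (fun=> c) t (fun=> 0).
Proof. by move=> e e0; near=> s => x Dx; rewrite subrr mulr0 subrr normr0 ltW.
Unshelve. all: by end_near. Qed.

Lemma uniform_dtD f g t (f' g' : X -> R) : uniform_dt f t f' -> uniform_dt g t g' ->
  uniform_dt (fun s x => f s x + g s x) t (fun x => f' x + g' x).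
Proof.
move=> df dg e e0; have e2 : 0 < e / 2 by rewrite divr_gt0.
near=> s => x Dx.
have qf : `|(s - t)^-1 * (f s x - f t x) - f' x| <= e / 2.
  by move: (x) Dx; near: s; exact: df.
have qg : `|(s - t)^-1 * (g s x - g t x) - g' x| <= e / 2.
  by move: (x) Dx; near: s; exact: dg.
rewrite [e]splitr opprD addrACA mulrDr opprD addrACA.
by apply: le_trans (ler_normD _ _) _; exact: lerD.
Unshelve. all: by end_near. Qed.

Lemma uniform_dt_sum (J : Type) (r : seq J) (F : J -> R -> X -> R) (F' : J -> X -> R) t :
  (forall j, uniform_dt (F j) t (F' j)) ->
  uniform_dt (fun s x => \sum_(j <- r) F j s x) t (fun x => \sum_(j <- r) F' j x).
Proof.
move=> dF; elim: r => [|j r IH].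
  rewrite (_ : (fun s x => _) = (fun=> fun=> 0)); last first.
    by apply/funext => s; apply/funext => x; rewrite big_nil.
  rewrite (_ : (fun x => _) = (fun=> 0)); first exact: uniform_dt_cst.
  by apply/funext => x; rewrite big_nil.
rewrite (_ : (fun s x => _) = (fun s x => F j s x + \sum_(j <- r) F j s x)); last first.
  by apply/funext => s; apply/funext => x; rewrite big_cons.
rewrite (_ : (fun x => _) = (fun x => F' j x + \sum_(j <- r) F' j x)).
  exact: uniform_dtD.
by apply/funext => x; rewrite big_cons.
Qed.

End uniform_derivative.

Lemma is_dt_Rintegral d (X : measurableType d) (mu : {measure set X -> \bar R})
    (D : set X) (f : R -> X -> R) t f' :
  measurable D -> (mu D < +oo)%E -> t \in `[0, T] ->
  (forall s, s \in `[0, T] -> bounded_measurable D (f s)) ->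
  bounded_measurable D f' -> uniform_dt D f t f' ->
  is_dt T (fun s => \int[mu]_(x in D) f s x) t (\int[mu]_(x in D) f' x).
Proof.
move=> mD Doo t0T bf bf' df; rewrite /is_dt.
apply/cvgrPdist_le => e e0.
pose M := fine (mu D).
have M0 : 0 <= M by rewrite fine_ge0.
(* [M + 1] instead of [M], as the measure of [D] may be zero. *)
have e1 : 0 < e / (M + 1) by rewrite divr_gt0// ltr_wpDl.
near=> s.
have [s0T st _] : [/\ s \in `[0, T], s - t != 0 & `|s - t| < 1].
  by near: s; exact: at_time_near.
have bs := bf s s0T; have bt := bf t t0T.
have bq : bounded_measurable D (fun x => (s - t)^-1 * (f s x - f t x)).
  by apply: bounded_measurableM; [exact: bounded_measurable_cst|exact: bounded_measurableB].
rewrite /GRing.scale/= -(bRintegralB mD Doo)// -(bRintegralZ mD Doo); last first.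
  exact: bounded_measurableB.
rewrite distrC -(bRintegralB mD Doo)//.
have bd : bounded_measurable D (fun x => (s - t)^-1 * (f s x - f t x) - f' x).
  exact: bounded_measurableB.
apply: le_trans (le_normr_Rintegral mD (bounded_measurable_integrable mD Doo bd)) _.
apply: (@le_trans _ _ (\int[mu]_(x in D) (e / (M + 1)))).
  apply: le_Rintegral => //.
  - apply: (bounded_measurable_integrable mD Doo
      (f := fun x => `|(s - t)^-1 * (f s x - f t x) - f' x|)).
    split; first by apply: measurableT_comp => //; exact: bd.1.
    by have [B bB] := bd.2; exists B => x Dx; rewrite normr_id; exact: bB.
  - exact: bounded_measurable_integrable (bounded_measurable_cst _ _).
  - by move=> x Dx; move: (x) Dx; near: s; exact: df.
rewrite Rintegral_cst// -/M mulrAC -mulrA ger_pMr// ler_pdivrMr ?ltr_wpDl//.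
by rewrite mul1r lerDl.
Unshelve. all: by end_near. Qed.

Lemma is_dt_unique (V : normedModType R) (g : R -> V) t l :
  t \in `[0, T] -> is_dt T g t l -> dt T g t = l.
Proof. by move=> /at_time_proper tP gl; apply: cvg_lim => //; exact: norm_hausdorff. Qed.

Lemma uniform_dt_is_dt (X : Type) (D : set X) (f : R -> X -> R) t f' x : D x ->
  uniform_dt D f t f' -> is_dt T (f ^~ x) t (f' x).
Proof.
move=> Dx df; apply/cvgrPdist_le => e e0; near=> s.
by rewrite distrC; move: (x) Dx; near: s; exact: df.
Unshelve. all: by end_near. Qed.

Context {d : nat}.

Lemma C1_near (V : normedModType R) (X : set ('rV[R]_d -> V)) f t :
  C1_in T X f -> t \in `[0, T] -> forall e, 0 < e ->
  \forall s \near at_time t, forall x,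
    `|pdt T f t x - (s - t)^-1 *: (f s x - f t x)| < e.
Proof.
move=> fC t0T e e0; have [_ _ cf _] := fC t t0T.
apply: (cf [set h | forall x, `|pdt T f t x - h x| < e]).
apply/uniform_nbhs; exists [set xy | ball xy.1 e xy.2]; split.
  exact: entourage_ball (PosNum e0).
by move=> h /= H x; have := H x Logic.I; rewrite -ball_normE.
Qed.

Lemma C1_uniform_dt (X : set ('rV[R]_d -> R)) f t :
  C1_in T X f -> t \in `[0, T] -> uniform_dt setT f t (pdt T f t).
Proof.
move=> fC t0T e e0; have := C1_near fC t0T e0; apply: filterS => s H x _.
by rewrite distrC ltW.
Qed.

Lemma C1_uniform_dt_coord n (X : set ('rV[R]_d -> 'rV[R]_n)) f t i :
  C1_in T X f -> t \in `[0, T] ->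
  uniform_dt setT (fun s x => f s x ord0 i) t (fun x => pdt T f t x ord0 i).
Proof.
move=> fC t0T e e0; have := C1_near fC t0T e0; apply: filterS => s H x _.
rewrite distrC; apply: le_trans (ltW (H x)).
apply: le_trans (coord_le_norm _ i); by rewrite !mxE.
Qed.

Lemma is_dt_rV n (g : R -> 'rV[R]_n) t (l : 'rV[R]_n) : t \in `[0, T] ->
  (forall i, is_dt T (fun s => g s ord0 i) t (l ord0 i)) -> is_dt T g t l.
Proof.
move=> t0T gl; apply/cvgrPdist_le => e e0; near=> s.
apply/rV_norm_leP; first exact: ltW.
near: s; apply: filter_forall => i.
have /cvgrPdist_le/(_ e e0) := gl i.
by apply: filterS => s; rewrite !mxE.
Unshelve. all: by end_near. Qed.

End time_derivative.

(** * Nodal interpolation *)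

Section interpolation.
Context {R : realType} {d : nat}.
Context {Omega : set 'rV[R]_d} {L : 'M[R]_d} {I : finType}
  {v : I -> 'I_d.+1 -> 'rV[R]_d} {sigma : R}.
Hypotheses (hO : periodic_domain Omega L) (hT : triangulation Omega L v sigma).

Let vi i : affinely_independent (v i) := tri_nondegenerate hT i.

Definition nodal (g : 'rV[R]_d -> R) i x := \sum_a bary (v i) x a * g (v i a).

Lemma nodal_affine g i :
  exists b (l : 'I_d -> R), forall x, nodal g i x = b + \sum_j l j * x ord0 j.
Proof.
have /choice[b /choice[l blE]] := bary_affine (v i).
exists (\sum_a b a * g (v i a)), (fun j => \sum_a l a j * g (v i a)) => x.
rewrite /nodal; under eq_bigr do rewrite blE mulrDl.
rewrite big_split/=; congr (_ + _).
under eq_bigr do rewrite mulr_suml.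
rewrite exchange_big/=; apply: eq_bigr => j _.
by rewrite mulr_suml; apply: eq_bigr => a _; rewrite mulrAC.
Qed.

Lemma nodal_lipschitz g i : exists C, 0 <= C /\
  forall x y, `|nodal g i x - nodal g i y| <= C * `|x - y|.
Proof.
have [b [l blE]] := nodal_affine g i.
exists (\sum_j `|l j|); split; first exact: sumr_ge0.
move=> x y; rewrite !blE opprD addrACA subrr add0r -sumrB mulr_suml.
apply: le_trans (ler_norm_sum _ _ _) _; apply: ler_sum => j _.
rewrite -mulrBr normrM ler_wpM2l//.
by have := coord_le_norm (x - y) j; rewrite !mxE.
Qed.

Lemma nodal_polynomial g i K : polynomial_on 1 K (nodal g i).
Proof.
have [b [l blE]] := nodal_affine g i.
rewrite (_ : nodal g i = (fun x => b + \sum_j l j * x ord0 j)); last exact/funext.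
apply: polynomial_onD; first exact: polynomial_on_cst.
elim: (index_enum _) => [|j r IH].
  rewrite (_ : (fun x => _) = fun=> 0); first exact: polynomial_on_cst.
  by apply/funext => x; rewrite big_nil.
rewrite (_ : (fun x => _) = (fun x : 'rV[R]_d => l j * x ord0 j + \sum_(j <- r) l j * x ord0 j)).
  apply: polynomial_onD => //; apply: (@polynomial_onM R d K 0 1).
    exact: polynomial_on_cst.
  exact: polynomial_on_coord.
by apply/funext => x; rewrite big_cons.
Qed.

(* Conformity: a point shared by two elements lies in the hull of their common
   vertices, and barycentric coordinates are unique. *)
Lemma nodal_unique g i j k l x :
  (forall i j a b k, v i a = v j b + lattice_vec L k -> g (v i a) = g (v j b)) ->
  element (v i) (x - lattice_vec L k) -> element (v j) (x - lattice_vec L l) ->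
  nodal g i (x - lattice_vec L k) = nodal g j (x - lattice_vec L l).
Proof.
move=> gL xi xj; set y := x - lattice_vec L k in xi *.
(* Only the relative translation [l - k] matters, which is the form in which conformity is
   stated. *)
have yl : x - lattice_vec L l = y - lattice_vec L (l - k).
  by rewrite /y lattice_vecB opprB addrA subrK.
rewrite yl in xj *; move: (l - k) xj => {yl} h xj.
have : (element (v i) `&` [set x | element (v j) (x - lattice_vec L h)]) y by [].
rewrite (tri_conforming hT) => -[c [c0 cA c1 yE]].
set A := [pred a | _] in cA.
have /choice[pi piP] : forall a, exists b, A a -> v i a = v j b + lattice_vec L h.
  move=> a; case: (boolP (A a)) => [/existsP[b /eqP ab]|_]; first by exists b.
  by exists ord0.
(* The coordinates are pushed forward along [pi], from the common vertices in element [i] to those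
   of element [j], by summation over fibres. *)
pose c' b := \sum_(a | A a && (pi a == b)) c a.
have sumA (V : lmodType R) (F : 'I_d.+1 -> V) : \sum_a c a *: F a = \sum_(a | A a) c a *: F a.
  rewrite [RHS]big_mkcond/=; apply: eq_bigr => a _; case: ifPn => // nA.
  by rewrite cA ?scale0r.
have c'E (V : lmodType R) (F : 'I_d.+1 -> V) :
    \sum_b c' b *: F b = \sum_(a | A a) c a *: F (pi a).
  rewrite [RHS](partition_big pi predT)//=; apply: eq_bigr => b _.
  by rewrite /c' scaler_suml; apply: eq_bigr => a /andP[_ /eqP <-].
have yc : bary (v i) y =1 c by apply: bary_unique.
have c1A : \sum_(a | A a) c a = 1.
  rewrite -c1; have := sumA R^o (fun=> 1).
  under eq_bigr do rewrite [_ *: _]mulr1.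
  by under [X in _ = X]eq_bigr do rewrite [_ *: _]mulr1.
have yc' : bary (v j) (y - lattice_vec L h) =1 c'.
  apply: bary_unique => //.
    have := c'E R^o (fun=> 1).
    under eq_bigr do rewrite [_ *: _]mulr1.
    by under [X in _ = X]eq_bigr do rewrite [_ *: _]mulr1; rewrite c1A.
  rewrite c'E yE sumA -[lattice_vec L h]scale1r -c1A scaler_suml -sumrB.
  by apply: eq_bigr => a Aa; rewrite (piP a Aa) -scalerBr addrK.
rewrite /nodal; under eq_bigr do rewrite yc.
under [RHS]eq_bigr do rewrite yc'.
have := sumA R^o (fun a => g (v i a)); rewrite /GRing.scale/= => ->.
have := c'E R^o (fun b => g (v j b)); rewrite /GRing.scale/= => ->.
by apply: eq_bigr => a Aa; congr (_ * _); exact: gL (piP a Aa).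
Qed.

(** Each point takes its value from some translated element that contains it, and [nodal_unique]
    makes the choice immaterial. The hypothesis asks the vertex values to respect the periodic
    identification. *)
Lemma P1_interpolant g :
  (forall i j a b k, v i a = v j b + lattice_vec L k -> g (v i a) = g (v j b)) ->
  exists2 w, fe_space L v 1 w & forall i x, element (v i) x -> w x = nodal g i x.
Proof.
move=> gL.
have /choice[w wP] : forall x, exists r, exists i k,
    element (v i) (x - lattice_vec L k) /\ r = nodal g i (x - lattice_vec L k).
  move=> x; have [k [i ki]] := mesh_cover hO hT x.
  by exists (nodal g i (x - lattice_vec L k)), i, k.
have wE x j l : element (v j) (x - lattice_vec L l) -> w x = nodal g j (x - lattice_vec L l).
  by move=> xj; have [i [k [xi ->]]] := wP x; exact: nodal_unique.
have wE0 i x : element (v i) x -> w x = nodal g i x.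
  by move=> xi; rewrite (wE x i 0) lattice_vec0 subr0.
exists w => //; split.
- have /choice[C CP] := nodal_lipschitz g.
  have S0 i : C i <= \sum_i C i.
    by rewrite (bigD1 i)//= lerDl sumr_ge0// => j _; exact: (CP j).1.
  apply: (lipschitz_continuous (C := \sum_i C i)); first by apply: sumr_ge0 => i _; exact: (CP i).1.
  apply: (mesh_lipschitz hO hT) => i k x y xi yi.
  rewrite (wE _ _ _ xi) (wE _ _ _ yi); apply: le_trans ((CP i).2 _ _) _.
  by rewrite opprB addrA subrK ler_wpM2r.
- move=> x l; have [i [k [xi ->]]] := wP x.
  have xE : x + lattice_vec L l - lattice_vec L (k + l) = x - lattice_vec L k.
    by rewrite lattice_vecD opprD addrACA subrr addr0.
  by rewrite (wE _ i (k + l)) xE.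
- move=> i; have [p pk pE] := nodal_polynomial g i (element (v i)).
  by exists p => // x xi; rewrite (wE0 i x xi) pE.
Qed.

Lemma nodal_linear (A : 'I_d -> R) i x :
  nodal (fun y => \sum_j A j * y ord0 j) i x = \sum_j A j * x ord0 j.
Proof.
rewrite /nodal; under eq_bigr do rewrite mulr_sumr.
rewrite exchange_big/=; apply: eq_bigr => j _.
rewrite -[in RHS](baryK x (vi i)) summxE mulr_sumr; apply: eq_bigr => a _.
by rewrite !mxE mulrCA.
Qed.

(** A compact set inside [Omega] keeps its distance from a vertex outside [Omega]. Close to that
    vertex the element thus contains an open set on which [f] vanishes, and a polynomial that
    vanishes on an open set is zero. *)
Lemma compact_support_element (f : 'rV[R]_d -> R) k i a :
  fe_space L v k f -> compact_support_in Omega f -> ~ Omega (v i a) ->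
  forall x, element (v i) x -> f x = 0.
Proof.
move=> [_ _ Pf] [K [cK KO] fK] nOa.
have [p _ fp] := Pf i.
have clK : closed K by apply: compact_closed => //; exact: norm_hausdorff.
have nK : nbhs (v i a) (~` K).
  by apply: open_nbhs_nbhs; split; [exact: closed_openC|move=> /KO].
have /nbhs_ballP[e /= e0 eK] := nK.
(* [g] is the barycentre of the element; a short move from the vertex towards it reaches an interior
   point [y] within distance [e] of the vertex. *)
pose g : 'rV[R]_d := \sum_b (d.+1%:R^-1 : R) *: v i b.
pose t : R := Num.min 1 (e / 2 / (1 + `|g - v i a|)).
have D0 : 0 < 1 + `|g - v i a| by rewrite ltr_wpDr.
have t0 : 0 < t by rewrite lt_min ltr01 !divr_gt0.
have t1 : t <= 1 by rewrite ge_min lexx.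
pose y := (1 - t) *: v i a + t *: g.
have gb b : bary (v i) g b = d.+1%:R^-1.
  apply: (@bary_unique _ _ _ _ (fun=> d.+1%:R^-1)) => //.
  by rewrite sumr_const card_ord -(mulr_natr _^-1) mulVf ?pnatr_eq0.
have ab b : 0 <= bary (v i) (v i a) b.
  apply: (elementP _ (vi i)).1; exists (fun b => (b == a)%:R); split.
  - by move=> c; rewrite ler0n.
  - by [].
  - by rewrite (bigD1 a)//= eqxx big1 ?addr0// => c /negbTE ->.
  - by rewrite (bigD1 a)//= eqxx scale1r big1 ?addr0// => c /negbTE ->; rewrite scale0r.
have yi : (element (v i))° y.
  apply: element_interior => // b; rewrite bary_conv gb.
  by rewrite ltr_wpDl ?mulr_ge0 ?subr_ge0// mulr_gt0 ?invr_gt0.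
have yK : nbhs y (~` K).
  apply: open_nbhs_nbhs; split; first exact: closed_openC.
  apply: eK; rewrite -ball_normE/= /y scalerBl scale1r.
  rewrite (_ : _ - _ = t *: (v i a - g)); last first.
    by rewrite scalerBr opprD opprB addrA addrCA subrr addr0.
  rewrite normrZ gtr0_norm// distrC.
  have : t <= e / 2 / (1 + `|g - v i a|) by rewrite ge_min lexx orbT.
  rewrite ler_pdivlMr// mulrDr mulr1 => te.
  by have := normr_ge0 (g - v i a); lra.
have p0 : \forall x \near y, mpoly.meval ((x : 'rV[R]_d) ord0) p = 0.
  (* The support condition speaks of points of [Omega] only, and the vertex is outside; interior
     points of an element belong to [Omega] by regular openness. *)
  have yO : nbhs y Omega.
    rewrite -(pdomain_regular_open hO); apply: open_nbhs_nbhs; split.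
      exact: open_interior.
    exact: (interiorS (@element_domain _ _ _ _ _ _ _ hT i)) yi.
  apply: filterS3 yi yK yO => x xi nKx Ox.
  by rewrite -fp// fK.
by move=> x xi; rewrite fp//; exact: (mpoly_fun_eq0 p0).
Qed.

End interpolation.

Section is_dt_calculus.
Context {R : realType}.
Variables (T : R) (T_gt0 : 0 < T).

(** Scalar functions of time are families over [unit], so the sum and product rules transfer from
    [uniform_dt]. *)
Lemma is_dt_uniform (g : R -> R) t l :
  is_dt T g t l <-> uniform_dt T [set: unit] (fun s _ => g s) t (fun=> l).
Proof.
split => [gl e e0|gl].
  have /cvgrPdist_le/(_ e e0) := gl.
  by apply: filterS => s H x _; rewrite distrC.
exact: (uniform_dt_is_dt (x := tt) (D := setT) (f := fun s _ => g s) (f' := fun=> l)).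
Qed.

Lemma is_dtD (g h : R -> R) t l k : is_dt T g t l -> is_dt T h t k ->
  is_dt T (fun s => g s + h s) t (l + k).
Proof.
move=> /is_dt_uniform gl /is_dt_uniform hk; apply/is_dt_uniform.
exact: uniform_dtD gl hk.
Qed.

Lemma is_dtM (g h : R -> R) t l k : is_dt T g t l -> is_dt T h t k ->
  is_dt T (fun s => g s * h s) t (l * h t + g t * k).
Proof.
move=> /is_dt_uniform gl /is_dt_uniform hk; apply/is_dt_uniform.
by apply: (uniform_dtM _ _ _ _ gl hk); eexists => ? _; exact: lexx.
Qed.

Lemma is_dt_cst (c : R) t : is_dt T (fun=> c) t 0.
Proof. by apply/is_dt_uniform; exact: uniform_dt_cst. Qed.

Lemma is_dtZ (c : R) g t l : is_dt T g t l -> is_dt T (fun s => c * g s) t (c * l).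
Proof.
by move=> /(is_dtM (is_dt_cst c t)); rewrite mul0r add0r.
Qed.

Lemma dt_eq0 (V : normedModType R) (g : R -> V) t : t \in `[0, T] ->
  (forall s, s \in `[0, T] -> g s = 0) -> dt T g t = 0.
Proof.
move=> t0T g0; apply: is_dt_unique => //; apply/cvgrPdist_le => e e0; near=> s.
have [s0T _ _] : [/\ s \in `[0, T], s - t != 0 & `|s - t| < 1].
  by near: s; exact: at_time_near.
by rewrite !g0// subrr scaler0 subrr normr0 ltW.
Unshelve. all: by end_near. Qed.

End is_dt_calculus.

(** * Conservation laws *)

Section solution.
Context {R : realType} {d : nat}.
Local Notation mu := (lebesgue_rV d).
Context {Omega : set 'rV[R]_d} {L : 'M[R]_d} {I : finType}
  {v : I -> 'I_d.+1 -> 'rV[R]_d} {sigma : R}.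
Hypotheses (d_gt0 : (0 < d)%N) (hO : periodic_domain Omega L)
  (hT : triangulation Omega L v sigma).
Local Notation D := (cells Omega v).
Local Notation fe := (@fe_fun R d L I v).

Let mO : measurable Omega := domain_measurable hO.
Let Ooo : (mu Omega < +oo)%E := domain_finite hO.

Definition component (u : 'rV[R]_d -> 'rV[R]_d) (j : 'I_d) (x : 'rV[R]_d) : R := u x ord0 j.

Lemma ip_cells f g : ip Omega f g = \int[mu]_(x in D) (f x * g x).
Proof. exact: Rintegral_cells d_gt0 hT _. Qed.

Lemma ipv_cells f g : ipv Omega f g = \int[mu]_(x in D) dotv (f x) (g x).
Proof. exact: Rintegral_cells d_gt0 hT _. Qed.

Lemma dotv_grad (u : 'rV[R]_d) f x : dotv u (grad f x) = \sum_i u ord0 i * partial i f x.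
Proof. by apply: eq_bigr => i _; rewrite mxE. Qed.

Lemma tri_form_cells u w z : tri_form Omega u w z =
  \int[mu]_(x in D) (\sum_j adv (component u) (component w j) x * component z j x).
Proof.
rewrite /tri_form (Rintegral_cells d_gt0 hT); apply: eq_Rintegral => x _.
by rewrite exchange_big; apply: eq_bigr => j _; rewrite mulr_suml.
Qed.

Lemma integral_dive U : (forall i, fe (U i)) -> \int[mu]_(x in D) dive U x = 0.
Proof.
move=> fU; rewrite -[RHS](integral_by_parts d_gt0 hO hT fU (fe_fun_cst 1)).
by apply: eq_Rintegral => x _; rewrite adv_cst add0r mulr1.
Qed.

Lemma Rintegral_sub_mean f : bounded_measurable Omega f ->
  \int[mu]_(x in Omega) (f x - mean Omega f) = 0.
Proof.
move=> bf; rewrite (bRintegralB mO Ooo bf (bounded_measurable_cst _ _)).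
rewrite Rintegral_cst// /mean.
(* For a null cell the inverse in [mean] has its default value 0, but all integrals vanish as
   well. *)
have [m0|m0] := eqVneq (fine (mu Omega)) 0.
  rewrite m0 mulr0 subr0; apply: Rintegral_null => //.
  by rewrite -[LHS]fineK ?ge0_fin_numE// m0.
by rewrite mulrC mulrA mulfV// mul1r subrr.
Qed.

(** The pressure space contains only functions of zero mean. This is no restriction, because the
    divergence of a periodic field integrates to zero and [f] can be replaced by [f] minus its
    mean. *)
Lemma weak_divergence_test k U f :
  (forall i, fe (U i)) ->
  (forall q, fe_space0 Omega L v k q -> \int[mu]_(x in D) (dive U x * q x) = 0) ->
  fe_space L v k f -> \int[mu]_(x in D) (dive U x * f x) = 0.
Proof.
move=> fU divU ff.
have fef : fe f by exists k.
have mD := cells_measurable hO hT; have Doo := cells_finite hO hT.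
have bf := fe_bm (Omega := Omega) hO hT fef.
have bU := dive_bm d_gt0 hO hT fU.
have Qf : fe_space0 Omega L v k (fun x => f x - mean Omega f).
  split; first by apply: feB => //; exact: fe_cst.
  apply: Rintegral_sub_mean; exact: fe_fun_bounded_measurable hO hT _ _ fef.
rewrite -(divU _ Qf); transitivity (\int[mu]_(x in D) (dive U x * f x)
    - mean Omega f * \int[mu]_(x in D) dive U x).
  by rewrite integral_dive// mulr0 subr0.
rewrite -(bRintegralZ mD Doo)// -(bRintegralB mD Doo).
- by apply: eq_Rintegral => x _; ring.
- exact: bounded_measurableM.
- by apply: bounded_measurableM => //; exact: bounded_measurable_cst.
Qed.

Variables (k_rho k_u k_P : nat) (T : R) (T_gt0 : 0 < T).
Variables (alpha_rho alpha_m alpha_P alpha_uu : R) (rd : reference_density R)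
  (rho P uu_bar : R -> 'rV[R]_d -> R) (u : R -> 'rV[R]_d -> 'rV[R]_d).
Local Notation M := (fe_space L v k_rho).
Local Notation V := (fe_vspace L v k_u).
Local Notation Q := (fe_space0 Omega L v k_P).
Local Notation m := (momentum rho u).
Local Notation rho_bar := (ref_value Omega rd rho).
Hypothesis sol : semidiscrete_solution Omega T alpha_rho alpha_m alpha_P alpha_uu rd
    M V Q rho u P uu_bar.

Variable t : R.
Hypothesis t0T : t \in `[0, T].

Let U : 'I_d -> 'rV[R]_d -> R := component (u t).
Let q x := dotv (u t x) (u t x).

Lemma rho_space s : s \in `[0, T] -> M (rho s).
Proof. by move=> s0T; have [] := sol_rho_C1 sol s0T. Qed.

Lemma dt_rho_space : M (pdt T rho t).
Proof. by have [] := sol_rho_C1 sol t0T. Qed.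

Lemma u_space s : s \in `[0, T] -> V (u s).
Proof. by move=> s0T; have [] := sol_u_C1 sol s0T. Qed.

Lemma dt_u_space : V (pdt T u t).
Proof. by have [] := sol_u_C1 sol t0T. Qed.

Lemma P_space : Q (P t).
Proof. by have [] := sol_P_C1 sol t0T. Qed.

Lemma rho_fe s : s \in `[0, T] -> fe (rho s).
Proof. by move=> /rho_space; exists k_rho. Qed.

Lemma dt_rho_fe : fe (pdt T rho t).
Proof. by exists k_rho; exact: dt_rho_space. Qed.

Lemma u_fe s j : s \in `[0, T] -> fe (component (u s) j).
Proof. by move=> /u_space us; exists k_u; exact: us. Qed.

Lemma dt_u_fe j : fe (component (pdt T u t) j).
Proof. by exists k_u; exact: dt_u_space. Qed.

Lemma P_fe : fe (P t).
Proof. by exists k_P; have [] := P_space. Qed.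

Lemma speed_fe s : s \in `[0, T] -> fe (fun x => dotv (u s x) (u s x)).
Proof. by move=> s0T; apply: fe_fun_sum => j; apply: fe_funM; exact: (u_fe j). Qed.

Lemma uu_bar_space : M (uu_bar t).
Proof. by have [] := sol_uu_bar sol t0T. Qed.

Let fU i : fe (U i). Proof. exact: u_fe. Qed.
Let frho : fe (rho t). Proof. exact: rho_fe. Qed.

Lemma weak_divergence f : fe_space L v k_P f -> \int[mu]_(x in D) (dive U x * f x) = 0.
Proof.
apply: weak_divergence_test => // r Qr.
by have := sol_divergence sol t0T Qr; rewrite ip_cells.
Qed.

Lemma density_form w : M w ->
  ip Omega (pdt T rho t) w =
  - (\int[mu]_(x in D) (adv U (rho t) x * w x)
  + alpha_rho * \int[mu]_(x in D) (dive U x * (rho t x - rho_bar t) * w x)).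
Proof.
move=> Mw; have := sol_density sol t0T Mw.
rewrite -addrA => /eqP; rewrite addr_eq0 => /eqP ->; congr (- (_ + _ * _)).
- by rewrite ip_cells; apply: eq_Rintegral => x _; rewrite dotv_grad.
- by rewrite ip_cells.
Qed.

Lemma momentum_form_eq w : V w ->
  ipv Omega (pdt T m t) w =
  - momentum_form (Omega := Omega) (v := v) (rho t) (P t)
      (fun x => alpha_uu * uu_bar t x + (1 - alpha_uu) * q x)
      U (component w) alpha_rho alpha_m alpha_P (rho_bar t).
Proof.
move=> Vw; have := sol_momentum sol t0T Vw; rewrite /=.
have mE j : component (m t) j = (fun x => rho t x * U j x).
  by apply/funext => x; rewrite /component mxE.
have mqE : (fun x => dotv (m t x) (u t x)) = (fun x => rho t x * q x).
  apply/funext => x; rewrite /q /dotv mulr_sumr; apply: eq_bigr => j _.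
  by rewrite mxE mulrA.
have gradE (f : 'rV[R]_d -> R) : ipv Omega (grad f) w = \int[mu]_(x in D) adv (component w) f x.
  rewrite ipv_cells; apply: eq_Rintegral => x _; apply: eq_bigr => j _.
  by rewrite mxE mulrC.
have e1 : tri_form Omega (u t) (m t) w = \int[mu]_(x in D)
    (\sum_j adv U (fun y => rho t y * U j y) x * component w j x).
  by rewrite tri_form_cells; apply: eq_Rintegral => x _; apply: eq_bigr => j _; rewrite mE.
have e2 : ipv Omega (fun x => divergence (u t) x *: m t x) w = \int[mu]_(x in D)
    (dive U x * \sum_j (rho t x * U j x) * component w j x).
  rewrite ipv_cells; apply: eq_Rintegral => x _; rewrite mulr_sumr.
  by apply: eq_bigr => j _; rewrite !mxE !mulrA.
have e3 : tri_form Omega w (m t) (u t) = \int[mu]_(x in D)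
    (\sum_j adv (component w) (fun y => rho t y * U j y) x * U j x).
  by rewrite tri_form_cells; apply: eq_Rintegral => x _; apply: eq_bigr => j _; rewrite mE.
have e4 : tri_form Omega w (u t) (m t) = \int[mu]_(x in D)
    (\sum_j adv (component w) (U j) x * (rho t x * U j x)).
  by rewrite tri_form_cells; apply: eq_Rintegral => x _; apply: eq_bigr => j _; rewrite mE.
have e5 f : ip Omega (fun x => dotv (w x) (grad (rho t) x)) f =
    \int[mu]_(x in D) (adv (component w) (rho t) x * f x).
  by rewrite ip_cells; apply: eq_Rintegral => x _; rewrite dotv_grad.
rewrite e1 e2 e3 e4 e5 mqE !gradE -!addrA => /eqP; rewrite addr_eq0 => /eqP ->.
by rewrite !addrA.
Qed.

Lemma rho_dt : uniform_dt T setT rho t (pdt T rho t).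
Proof. exact: C1_uniform_dt (sol_rho_C1 sol) t0T. Qed.

Lemma u_dt j : uniform_dt T setT (fun s => component (u s) j) t (component (pdt T u t) j).
Proof. exact: C1_uniform_dt_coord (sol_u_C1 sol) t0T. Qed.

Let bounded_fe f : fe f -> exists B, forall x, setT x -> `|f x| <= B.
Proof. by move=> /(fe_fun_bounded hO hT)[B fB]; exists B. Qed.

Lemma fe_uniform_dtM (f g : R -> 'rV[R]_d -> R) (f' g' : 'rV[R]_d -> R) :
  fe (f t) -> fe (g t) -> fe f' -> fe g' ->
  uniform_dt T setT f t f' -> uniform_dt T setT g t g' ->
  uniform_dt T setT (fun s x => f s x * g s x) t (fun x => f' x * g t x + f t x * g' x).
Proof.
by move=> /bounded_fe bf /bounded_fe bg /bounded_fe bf' /bounded_fe bg'; exact: uniform_dtM.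
Qed.

Lemma fe_is_dt (f : R -> 'rV[R]_d -> R) (f' : 'rV[R]_d -> R) :
  (forall s, s \in `[0, T] -> fe (f s)) -> fe f' -> uniform_dt T setT f t f' ->
  is_dt T (fun s => \int[mu]_(x in Omega) f s x) t (\int[mu]_(x in Omega) f' x).
Proof.
move=> ff ff' df; apply: is_dt_Rintegral => //.
- by move=> s s0T; exact: fe_fun_bounded_measurable hO hT _ _ (ff s s0T).
- exact: fe_fun_bounded_measurable hO hT _ _ ff'.
- by move=> e e0; have := df e e0; apply: filterS => s H x _; exact: H.
Qed.

Lemma mass_dt :
  is_dt T (fun s => \int[mu]_(x in Omega) rho s x) t
    (\int[mu]_(x in Omega) pdt T rho t x).
Proof. by apply: fe_is_dt; [exact: rho_fe|exact: dt_rho_fe|exact: rho_dt]. Qed.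

Lemma dt_massE : \int[mu]_(x in Omega) pdt T rho t x =
  (1 - alpha_rho) * \int[mu]_(x in D) (dive U x * rho t x).
Proof.
transitivity (ip Omega (pdt T rho t) (fun=> 1)).
  by apply: eq_Rintegral => x _; rewrite mulr1.
rewrite density_form; last exact: fe_cst.
by rewrite (mass_balance d_gt0 hO hT)// -mulNr opprB.
Qed.

Lemma mass_square_dt :
  is_dt T (fun s => \int[mu]_(x in Omega) (rho s x ^+ 2)) t
    (2 * ip Omega (pdt T rho t) (rho t)).
Proof.
have fd := dt_rho_fe.
have -> : 2 * ip Omega (pdt T rho t) (rho t) =
    \int[mu]_(x in Omega) (pdt T rho t x * rho t x + rho t x * pdt T rho t x).
  have bm2 : bounded_measurable Omega (fun x => pdt T rho t x * rho t x).
    exact: fe_fun_bounded_measurable hO hT _ _ (fe_funM fd frho).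
  rewrite /ip -(bRintegralZ mO Ooo)//; apply: eq_Rintegral => x _; ring.
have -> : (fun s => \int[mu]_(x in Omega) (rho s x ^+ 2)) =
    (fun s => \int[mu]_(x in Omega) (rho s x * rho s x)).
  by apply/funext => s; apply: eq_Rintegral => x _; rewrite expr2.
apply: fe_is_dt.
- by move=> s s0T; apply: fe_funM; exact: rho_fe.
- by apply: fe_funD; apply: fe_funM.
- by apply: fe_uniform_dtM => //; exact: rho_dt.
Qed.

Lemma dt_mass_squareE : ip Omega (pdt T rho t) (rho t) =
  (2^-1 - alpha_rho) * \int[mu]_(x in D) (dive U x * (rho t x * rho t x))
  + alpha_rho * rho_bar t * \int[mu]_(x in D) (dive U x * rho t x).
Proof.
rewrite density_form; last exact: rho_space.
by rewrite (square_balance d_gt0 hO hT)// opprB addrC -mulNr opprB.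
Qed.

(** Regularity in time is given for [rho] and [u] only; the derivative of [m] is obtained from the
    product rule and uniqueness of limits. *)
Lemma dt_momentumE j x : pdt T m t x ord0 j =
  pdt T rho t x * U j x + rho t x * pdt T u t x ord0 j.
Proof.
pose l : 'rV[R]_d := \row_i (pdt T rho t x * U i x + rho t x * pdt T u t x ord0 i).
have -> : pdt T m t x = l; last by rewrite mxE.
apply: is_dt_unique => //; apply: is_dt_rV => // i; rewrite mxE.
have := fe_uniform_dtM (f := rho) (g := fun s => component (u s) i) frho (fU i)
  dt_rho_fe (dt_u_fe i) rho_dt (u_dt i).
move=> dm; have := uniform_dt_is_dt (x := x) (Logic.I : [set: 'rV[R]_d] x) dm.
by rewrite (_ : (fun s => _) = (fun s => m s x ord0 i))//; apply/funext => s; rewrite mxE.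
Qed.

Lemma momentum_dt j :
  uniform_dt T setT (fun s x => m s x ord0 j) t (fun x => pdt T m t x ord0 j).
Proof.
have := fe_uniform_dtM (f := rho) (g := fun s => component (u s) j) frho (fU j)
  dt_rho_fe (dt_u_fe j) rho_dt (u_dt j).
rewrite (_ : (fun s x => _) = (fun s x => m s x ord0 j)); last first.
  by apply/funext => s; apply/funext => x; rewrite mxE.
rewrite (_ : (fun x => _ + _) = (fun x => pdt T m t x ord0 j))//.
by apply/funext => x; rewrite dt_momentumE.
Qed.

Lemma momentum_fe s j : s \in `[0, T] -> fe (fun x => m s x ord0 j).
Proof.
move=> s0T; rewrite (_ : (fun x => _) = (fun x => rho s x * component (u s) j x)).
  by apply: fe_funM; [exact: rho_fe|exact: u_fe].
by apply/funext => x; rewrite mxE.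
Qed.

Lemma dt_momentum_fe j : fe (fun x => pdt T m t x ord0 j).
Proof.
rewrite (_ : (fun x => _) =
    (fun x => pdt T rho t x * U j x + rho t x * component (pdt T u t) j x)).
  by apply: fe_funD; apply: fe_funM => //; [exact: dt_rho_fe|exact: dt_u_fe].
by apply/funext => x; rewrite dt_momentumE.
Qed.

(** Since [m = rho u], the rate of [rho |u|^2] is [2 u . dt m - |u|^2 dt rho]. The energy law
    therefore couples the momentum equation tested with [u] to the density equation weighted with
    [|u|^2]. *)
Lemma kinetic_energy_dt :
  is_dt T (fun s => \int[mu]_(x in Omega) (rho s x * dotv (u s x) (u s x))) t
    (2 * ipv Omega (pdt T m t) (u t) - ip Omega (pdt T rho t) q).
Proof.
pose q' x := \sum_j (pdt T u t x ord0 j * U j x + U j x * pdt T u t x ord0 j).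
have fq' : fe q'.
  by apply: fe_fun_sum => j; apply: fe_funD; apply: fe_funM => //; exact: dt_u_fe.
have fq : fe q by exact: speed_fe.
have fd := dt_rho_fe.
have q_dt : uniform_dt T setT (fun s x => dotv (u s x) (u s x)) t q'.
  apply: uniform_dt_sum => j.
  exact: (fe_uniform_dtM (f := fun s => component (u s) j) (g := fun s => component (u s) j))
    (fU j) (fU j) (dt_u_fe j) (dt_u_fe j) (u_dt j) (u_dt j).
have bmO f : fe f -> bounded_measurable Omega f.
  exact: fe_fun_bounded_measurable hO hT _ _.
have fdmu : fe (fun x => dotv (pdt T m t x) (u t x)).
  by apply: fe_fun_sum => j; apply: fe_funM; [exact: dt_momentum_fe|exact: fU].
have -> : 2 * ipv Omega (pdt T m t) (u t) - ip Omega (pdt T rho t) q =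
    \int[mu]_(x in Omega) (pdt T rho t x * q x + rho t x * q' x).
  rewrite /ipv -(bRintegralZ mO Ooo); last exact: bmO.
  rewrite /ip -(bRintegralB mO Ooo); last 2 first.
  - by apply: bounded_measurableM; [exact: bounded_measurable_cst|exact: bmO].
  - by apply: bmO; exact: fe_funM.
  apply: eq_Rintegral => x _; rewrite /q' /q /dotv !mulr_sumr -sumrB -big_split.
  by apply: eq_bigr => j _ /=; rewrite dt_momentumE /U /component; ring.
apply: fe_is_dt.
- by move=> s s0T; apply: fe_funM; [exact: rho_fe|exact: speed_fe].
- by apply: fe_funD; apply: fe_funM.
- exact: (fe_uniform_dtM (f := rho) (g := fun s x => dotv (u s x) (u s x)))
    frho fq fd fq' rho_dt q_dt.
Qed.

Lemma ipC f g : ip Omega f g = ip Omega g f.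
Proof. by apply: eq_Rintegral => x _; rewrite mulrC. Qed.

(** The squared speed is not a test function of the density equation in general. As [dt rho] lies in
    the density space, the projection property replaces [q] by [uu_bar], which is one; the density
    form then cancels against the remainder of [energy_balance]. *)
Lemma kinetic_energy_balance : alpha_uu = 1 ->
  alpha_m - alpha_P - 2^-1 * alpha_rho = 2^-1 ->
  2 * ipv Omega (pdt T m t) (u t) - ip Omega (pdt T rho t) q = 0.
Proof.
move=> uu1 alphaE.
have [_ uuP] := sol_uu_bar sol t0T.
have fuu : fe (uu_bar t) by exists k_rho; exact: uu_bar_space.
rewrite ipC -uuP; last exact: dt_rho_space.
rewrite momentum_form_eq; last exact: u_space.
rewrite (_ : (fun x => _) = uu_bar t); last first.
  by apply/funext => x; rewrite uu1 subrr mul0r addr0 mul1r.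
rewrite -/U (energy_balance d_gt0 hO hT (rho_bar t) frho P_fe fuu fU fU erefl alphaE).
  rewrite ipC density_form; last exact: uu_bar_space.
  by rewrite mulrN mulrA mulfV ?pnatr_eq0// mul1r opprK addNr.
by apply: weak_divergence; have [] := P_space.
Qed.

Lemma dt_momentum_test w c : alpha_uu = 0 -> alpha_m = 1 -> V w ->
  ipv Omega (pdt T m t) w =
  \int[mu]_(x in D) (\sum_j (rho t x * U j x) * adv U (component w j) x
    + dive (component w) x * (P t x - c + alpha_P * (rho t x * q x)
        + 2^-1 * alpha_rho * rho_bar t * q x)).
Proof.
move=> uu0 am Vw; rewrite momentum_form_eq//.
have fw j : fe (component w j) by exists k_u; exact: Vw.
have -> : (fun x => alpha_uu * uu_bar t x + (1 - alpha_uu) * q x) = q.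
  by apply/funext => x; rewrite uu0 subr0 mul0r add0r mul1r.
have fq : fe q by exact: speed_fe.
by rewrite (momentum_balance d_gt0 hO hT alpha_rho alpha_P (rho_bar t)
  frho P_fe fq fU fw c am erefl) opprK.
Qed.

(** Constant fields belong to the velocity space, and every term of the balance contains a
    derivative of the test field. *)
Lemma momentum_conserved j : alpha_uu = 0 -> alpha_m = 1 ->
  is_dt T (fun s => \int[mu]_(x in Omega) m s x ord0 j) t 0.
Proof.
move=> uu0 am.
have -> : 0 = \int[mu]_(x in Omega) pdt T m t x ord0 j.
  pose w (x : 'rV[R]_d) : 'rV[R]_d := delta_mx ord0 j.
  have Vw : V w by move=> i; exact: fe_cst.
  transitivity (ipv Omega (pdt T m t) w); last first.
    apply: eq_Rintegral => x _; rewrite /dotv (bigD1 j)//= big1 => [|i ij].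
      by rewrite addr0 mxE !eqxx mulr1.
    by rewrite mxE (negbTE ij) andbF mulr0.
  rewrite (dt_momentum_test 0 uu0 am Vw).
  apply/esym/Rintegral_eq0 => x _; rewrite big1 => [|i _].
    by rewrite /dive big1 ?mul0r ?addr0// => i _; rewrite /component partial_cst.
  by rewrite /component adv_cst mulr0.
apply: fe_is_dt; last exact: momentum_dt.
- by move=> s s0T; exact: momentum_fe.
- exact: dt_momentum_fe.
Qed.

(** An open set disjoint from a translate is disjoint from the closure of that translate.
    Consequently a vertex inside the cell is identified with no vertex through a nonzero lattice
    vector. *)
Lemma lattice_interior x k : Omega x -> closure Omega (x - lattice_vec L k) -> k = 0.
Proof.
move=> Ox cx; apply/eqP/negPn/negP => k0.
have /nbhs_ballP[e /= e0 eO] : nbhs x Omega.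
  by apply: open_nbhs_nbhs; split => //; exact: domain_open hO.
have : nbhs (x - lattice_vec L k) [set z | Omega (z + lattice_vec L k)].
  apply/nbhs_ballP; exists e => //= z; rewrite -ball_normE/= => ze; apply: eO.
  by rewrite -ball_normE/= opprD addrA addrAC.
move=> /cx[z [Oz /= Ozk]].
have := pdomain_disjoint hO k0; rewrite -subset0 => /(_ (z + lattice_vec L k)).
by apply; split => //; rewrite addrK.
Qed.

Lemma partial_linear (c : 'I_d -> R) i (x : 'rV[R]_d) :
  partial i (fun y => \sum_k c k * y ord0 k) x = c i.
Proof.
rewrite /partial /derive; apply: cvg_lim => //; apply/cvgrPdist_le => e e0.
near=> h.
have h0 : h != 0 by near: h; exact: nbhs_dnbhs_neq.
rewrite -sumrB (bigD1 i)//= big1 => [|k ki].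
  rewrite !mxE !eqxx mulr1 addr0 mulrDr addrK /GRing.scale/= mulrCA mulVf//.
  by rewrite mulr1 subrr normr0 ltW.
by rewrite !mxE (negbTE ki) andbF mulr0 add0r subrr.
Unshelve. all: by end_near. Qed.

(** * Angular momentum, for rotations generated by an antisymmetric matrix *)

Section angular_momentum.
Variable A : 'I_d -> 'I_d -> R.
Hypothesis A_anti : forall j i, A j i = - A i j.
Hypotheses (uu0 : alpha_uu = 0) (am1 : alpha_m = 1) (ku_gt0 : (0 < k_u)%N).
Hypothesis support : forall s, s \in `[0, T] ->
  compact_support_in Omega (u s) /\
  exists c : R, compact_support_in Omega (fun x => P s x - c).

Definition rotation (x : 'rV[R]_d) j := \sum_i A j i * x ord0 i.

Let A_diag j : A j j = 0.
Proof. by have := A_anti j j; move=> /eqP; rewrite -addr_eq0 -mulr2n mulrn_eq0 => /eqP. Qed.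

(** Exchanging the two indices shows that the sum equals its own opposite. *)
Lemma rotation_orthogonal (y : 'I_d -> R) : \sum_j y j * (\sum_i y i * A j i) = 0.
Proof.
set S := LHS; have SE : S = \sum_j \sum_i y j * (y i * A j i).
  by apply: eq_bigr => j _; rewrite mulr_sumr.
have : S = - S.
  rewrite {1}SE exchange_big SE -sumrN; apply: eq_bigr => i _.
  by rewrite -sumrN; apply: eq_bigr => j _; rewrite (A_anti j i); ring.
by move=> /eqP; rewrite -addr_eq0 -mulr2n mulrn_eq0 => /eqP.
Qed.

(* Agrees with the rotation on the elements without boundary vertices, the
   only ones that carry the flow. *)
Lemma rotation_test : exists2 w, V w & forall i, (forall a, Omega (v i a)) ->
  forall x, element (v i) x -> forall j, w x ord0 j = rotation x j.
Proof.
pose g j (y : 'rV[R]_d) : R := if `[< Omega y >] then rotation y j else 0.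
(* Vertices identified through a nonzero lattice vector are both outside [Omega], by
   [lattice_interior], and get the value 0; this makes the vertex data periodic although a rotation
   is not. *)
have gL j i i' a b k : v i a = v i' b + lattice_vec L k -> g j (v i a) = g j (v i' b).
  have cl i0 a0 : closure Omega (v i0 a0).
    apply: (element_domain hT (i := i0)); exists (fun b0 => (b0 == a0)%:R); split.
    - by move=> c; rewrite ler0n.
    - by [].
    - by rewrite (bigD1 a0)//= eqxx big1 ?addr0// => c /negbTE ->.
    - by rewrite (bigD1 a0)//= eqxx scale1r big1 ?addr0// => c /negbTE ->; rewrite scale0r.
  have [->|k0] := eqVneq k 0; first by rewrite lattice_vec0 addr0 => ->.
  move=> ab; rewrite /g !asboolF//.
    move=> Ob; move: k0; rewrite -oppr_eq0 => /eqP; apply.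
    by apply: lattice_interior Ob _; rewrite lattice_vecN opprK -ab.
  move=> Oa; move/eqP: k0; apply.
  by apply: lattice_interior Oa _; rewrite ab addrK.
have /choice[w wP] : forall j, exists w, fe_space L v 1 w /\
    forall i x, element (v i) x -> w x = nodal (v := v) (g j) i x.
  by move=> j; have [w ? ?] := P1_interpolant hO hT (gL j); exists w.
exists (fun x => \row_j w j x).
  move=> j; rewrite (_ : (fun x => _) = w j); first exact: feW ku_gt0 (wP j).1.
  by apply/funext => x; rewrite mxE.
move=> i Oi x xi j; have [_ wjE] := wP j; rewrite mxE (wjE i x xi).
rewrite /rotation -(nodal_linear hT (A j) i x).
by apply: eq_bigr => a _; rewrite /g asboolT.
Qed.

Lemma vanish_u i a s x j : s \in `[0, T] -> ~ Omega (v i a) -> element (v i) x ->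
  u s x ord0 j = 0.
Proof.
move=> s0T nO xi; have [[K [cK KO] uK] _] := support s0T.
apply: (compact_support_element hO hT (u_space s0T j) _ nO xi).
by exists K => // y yK; rewrite uK// mxE.
Qed.

Lemma dt_angular_momentum0 :
  \int[mu]_(x in Omega) (\sum_j pdt T m t x ord0 j * rotation x j) = 0.
Proof.
have [w Vw wE] := rotation_test.
have [_ [c Pc]] := support t0T.
transitivity (ipv Omega (pdt T m t) w).
  rewrite ipv_cells (Rintegral_cells d_gt0 hT); apply: eq_Rintegral => x /set_mem Dx.
  apply: eq_bigr => j _; have [i xi _] := cells_element hT Dx.
  have [Oi|/existsNP[a nOa]] := pselect (forall a, Omega (v i a)).
    by rewrite (wE i Oi x xi).
  (* On an element with a boundary vertex the momentum is zero at all times, hence so is its time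
     derivative, whatever the test field is there. *)
  suff -> : pdt T m t x = 0 by rewrite mxE !mul0r.
  apply: dt_eq0 => // s s0T; apply/rowP => k.
  by rewrite !mxE (vanish_u k s0T nOa xi) mulr0.
rewrite (dt_momentum_test c uu0 am1 Vw).
apply: Rintegral_eq0 => x Dx.
have [i xi xi0] := cells_element hT Dx.
have [Oi|/existsNP[a nOa]] := pselect (forall a, Omega (v i a)).
  have pE j k : partial k (component w j) x = A j k.
    rewrite -(partial_linear (A j) k x); apply: near_eq_derive.
    by apply: filterS xi0 => y yi; rewrite /component (wE i Oi).
  (* The gradient of the test field is [A]: its trace, the divergence, is zero, and its contraction
     with the symmetric tensor [rho u u] is zero by antisymmetry. *)
  rewrite [dive _ _]big1 ?mul0r ?addr0 => [|j _]; last by rewrite pE A_diag.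
  transitivity (rho t x * \sum_j U j x * (\sum_k U k x * A j k)).
    rewrite mulr_sumr; apply: eq_bigr => j _; rewrite mulrA; congr (_ * _).
    by apply: eq_bigr => k _; rewrite pE.
  by rewrite rotation_orthogonal mulr0.
have U0 j : U j x = 0 by exact: vanish_u t0T nOa xi.
have q0 : q x = 0 by rewrite /q /dotv big1// => j _; rewrite [u t x ord0 j]U0 mulr0.
(* The free constant of the momentum balance is used here: the pressure has compact support only up
   to [c]. *)
have P0 : P t x - c = 0.
  apply: (compact_support_element (k := k_P) hO hT _ Pc nOa xi).
  by apply: feB; [have [] := P_space|exact: fe_cst].
rewrite big1 => [|j _]; last by rewrite U0 mulr0 mul0r.
by rewrite P0 q0 !(mulr0, addr0).
Qed.

Lemma angular_momentum_conserved :
  is_dt T (fun s => \int[mu]_(x in Omega) (\sum_j m s x ord0 j * rotation x j)) t 0.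
Proof.
have [B B0 OB] := domain_bound hT.
have brot j : bounded_measurable Omega (rotation ^~ j).
  split.
    apply: measurable_funTS; apply: rV_continuous_measurable.
    apply: continuous_fun_sum => i _; apply: continuous_funM.
      exact: continuous_fun_cst.
    exact: coord_continuous.
  exists (\sum_i `|A j i| * B) => x Ox.
  apply: le_trans (ler_norm_sum _ _ _) _; apply: ler_sum => i _.
  rewrite normrM ler_wpM2l//; apply: le_trans (coord_le_norm x i) _.
  exact: OB (subset_closure Ox).
suff : is_dt T (fun s => \int[mu]_(x in Omega) (\sum_j m s x ord0 j * rotation x j)) t
    (\int[mu]_(x in Omega) (\sum_j pdt T m t x ord0 j * rotation x j)).
  by rewrite dt_angular_momentum0.
apply: is_dt_Rintegral => //.
- move=> s s0T; apply: bounded_measurable_sum => j; apply: bounded_measurableM => //.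
  exact: fe_fun_bounded_measurable hO hT _ _ (momentum_fe j s0T).
- apply: bounded_measurable_sum => j; apply: bounded_measurableM => //.
  exact: fe_fun_bounded_measurable hO hT _ _ (dt_momentum_fe j).
- apply: uniform_dt_sum => j.
  (* A rotation is not periodic, hence not a finite element function; it is bounded on [Omega], so
     the product rule is applied there instead of on the whole space. *)
  have H : uniform_dt T Omega (fun s x => m s x ord0 j * rotation x j) t
      (fun x => pdt T m t x ord0 j * rotation x j + m t x ord0 j * 0).
    apply: (uniform_dtM (f := fun s x => m s x ord0 j) (g := fun s x => rotation x j)).
    + by have [C CB] := bounded_fe (momentum_fe j t0T); exists C => x _; exact: CB.
    + exact: (brot j).2.
    + by have [C CB] := bounded_fe (dt_momentum_fe j); exists C => x _; exact: CB.
    + by exists 0 => x _; rewrite normr0.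
    + by move=> e e0; have := momentum_dt j e0; apply: filterS => s Hs x _; exact: Hs.
    + exact: uniform_dt_cst.
  by move: H; under [X in uniform_dt _ _ _ _ X]eq_fun do rewrite mulr0 addr0.
Qed.

End angular_momentum.

End solution.

(** * Shift invariance of the density equation *)

Section shift.
Context {R : realType} {d : nat}.
Local Notation mu := (lebesgue_rV d).
Context {Omega : set 'rV[R]_d} {L : 'M[R]_d} {I : finType}
  {v : I -> 'I_d.+1 -> 'rV[R]_d} {sigma : R}.
Hypotheses (d_gt0 : (0 < d)%N) (hO : periodic_domain Omega L)
  (hT : triangulation Omega L v sigma).

Let mO : measurable Omega := domain_measurable hO.
Let Ooo : (mu Omega < +oo)%E := domain_finite hO.

Lemma mean_shift (f : 'rV[R]_d -> R) c : bounded_measurable Omega f ->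
  mu Omega != 0%E -> mean Omega (fun x => f x + c) = mean Omega f + c.
Proof.
move=> bf m0; rewrite /mean (bRintegralD mO Ooo bf (bounded_measurable_cst _ _)).
rewrite Rintegral_cst// mulrDr; congr (_ + _).
rewrite mulrCA mulVf ?mulr1//; apply: contra m0 => /eqP m0.
by rewrite -[mu Omega]fineK ?ge0_fin_numE// m0.
Qed.

Lemma pdt_shift T (rho : R -> 'rV[R]_d -> R) c t :
  pdt T (fun s x => rho s x + c) t = pdt T rho t.
Proof.
apply/funext => x; rewrite /pdt /dt.
have -> : (fun s => (s - t)^-1 *: (rho s x + c - (rho t x + c))) =
    (fun s => (s - t)^-1 *: (rho s x - rho t x)).
  by apply/funext => s; rewrite opprD addrACA subrr addr0.
by [].
Qed.

Lemma grad_shift (f : 'rV[R]_d -> R) c : grad (fun x => f x + c) = grad f.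
Proof.
apply/funext => x; apply/rowP => i; rewrite !mxE /partial /derive.
set F := fun h : R => h^-1 *: _; set G := (X in _ = lim (X @ _)).
suff -> : F = G by [].
by apply/funext => h; rewrite /F /G/= opprD addrACA subrr addr0.
Qed.

(** Derivatives do not see a constant, so only the term with [rho] minus its reference value can
    change: either its factor is zero, or the mean moves by the same [c]. *)
Lemma density_equation_shift_invariant T alpha_rho rd k_rho k_u :
  alpha_rho = 0 \/ rd = MeanDensity ->
  shift_invariant Omega T alpha_rho rd (fe_space L v k_rho) (fe_vspace L v k_u).
Proof.
move=> hrd c _ rho u hrho _.
(* On a null cell the mean would stay 0 under the shift, but then every integral vanishes and both
   equations hold trivially. *)
have [m0|m0] := eqVneq (mu Omega) 0%E.
  have ip0 f g : ip Omega f g = 0 by rewrite /ip Rintegral_null.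
  by split => _ t _ w _; rewrite !ip0 mulr0 !addr0.
have third t w : t \in `[0, T] ->
    alpha_rho * ip Omega (fun x => divergence (u t) x *
      (rho t x + c - ref_value Omega rd (fun t x => rho t x + c) t)) w =
    alpha_rho * ip Omega (fun x => divergence (u t) x *
      (rho t x - ref_value Omega rd rho t)) w.
  move=> t0T; case: hrd => [a0|rdE].
    by rewrite a0; exact: etrans (mul0r _) (esym (mul0r _)).
  have frho : fe_fun (L := L) (v := v) (rho t) by exists k_rho; have [] := hrho t t0T.
  have E : ref_value Omega rd (fun s x => rho s x + c) t = ref_value Omega rd rho t + c.
    rewrite rdE /=; apply: mean_shift => //.
    exact: fe_fun_bounded_measurable hO hT _ _ frho.
  rewrite E; congr (_ * ip Omega _ w); apply/funext => x; congr (_ * _).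
  by rewrite opprD addrACA subrr addr0.
have key t w : t \in `[0, T] ->
    ip Omega (pdt T (fun s x => rho s x + c) t) w
    + ip Omega (fun x => dotv (u t x) (grad (fun y => rho t y + c) x)) w
    + alpha_rho * ip Omega (fun x => divergence (u t) x *
        (rho t x + c - ref_value Omega rd (fun s x => rho s x + c) t)) w =
    ip Omega (pdt T rho t) w + ip Omega (fun x => dotv (u t x) (grad (rho t) x)) w
    + alpha_rho * ip Omega (fun x => divergence (u t) x *
        (rho t x - ref_value Omega rd rho t)) w.
  move=> t0T; apply: (congr2 +%R _ (third t w t0T)).
  by rewrite (pdt_shift T rho c t) (grad_shift (rho t) c).
split => H t t0T w Mw; first by apply: etrans (key t w t0T) _; exact: H.
by apply: etrans (esym (key t w t0T)) _; exact: H.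
Qed.

End shift.

(** In this form an index out of range gives an empty selection, so planar and spatial vectors are
    treated alike. *)
Lemma coordE (R : realType) d (a : 'rV[R]_d) n :
  Defs.coord a n = \sum_(j < d) ((j : nat) == n)%:R * a ord0 j.
Proof.
rewrite /Defs.coord; case: insubP => [i _ <-|nd].
  rewrite (bigD1 i)//= eqxx mul1r big1 ?addr0// => j /negbTE.
  by rewrite -val_eqE /= => ->; rewrite mul0r.
rewrite big1// => j _; case: eqP => [jn|_]; last by rewrite mul0r.
by rewrite -jn ltn_ord in nd.
Qed.

(** The Levi-Civita symbol with first index [l], restricted to indices below [d]. For [d = 2] it is
    nonzero only for [l = 2], the rotation in the plane. *)
Definition rotation_matrix (R : realType) d (l : nat) (j i : 'I_d) : R :=
  ((j : nat) == (l + 1) %% 3)%N%:R * ((i : nat) == (l + 2) %% 3)%N%:R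
  - ((j : nat) == (l + 2) %% 3)%N%:R * ((i : nat) == (l + 1) %% 3)%N%:R.

Lemma cross_rotation (R : realType) d (a x : 'rV[R]_d) l :
  cross a x ord0 l = \sum_j a ord0 j * rotation (rotation_matrix R l) x j.
Proof.
rewrite mxE !coordE !mulr_suml -sumrB; apply: eq_bigr => j _.
rewrite /rotation mulr_sumr !mulr_sumr -sumrB; apply: eq_bigr => i _.
by rewrite /rotation_matrix; ring.
Qed.

Theorem theorem3p1 (R : realType) (d : nat) (hd : d = 2%N \/ d = 3%N)
    (Omega : set 'rV[R]_d) (L : 'M[R]_d) (hOmega : periodic_domain Omega L)
    (I : finType) (vert : I -> 'I_d.+1 -> 'rV[R]_d) (sigma : R)
    (hmesh : triangulation Omega L vert sigma)
    (k_rho k_u k_P : nat)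
    (hk_rho : (1 <= k_rho)%N) (hk_u : (1 <= k_u)%N) (hk_P : (1 <= k_P)%N)
    (hk_Pu : (k_P < k_u)%N)
    (T : R) (hT : 0 < T)
    (alpha_rho alpha_m alpha_P alpha_uu : R)
    (halpha_uu : alpha_uu = 0 \/ alpha_uu = 1)
    (rd : reference_density R)
    (rho P uu_bar : R -> 'rV[R]_d -> R) (u : R -> 'rV[R]_d -> 'rV[R]_d) :
  let M := fe_space L vert k_rho in
  let V := fe_vspace L vert k_u in
  let Q := fe_space0 Omega L vert k_P in
  let mu := lebesgue_rV d in
  let m := momentum rho u in
  let rho_bar := ref_value Omega rd rho in
  semidiscrete_solution Omega T alpha_rho alpha_m alpha_P alpha_uu rd
    M V Q rho u P uu_bar ->
  (* 1: kinetic energy *)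
  (alpha_uu = 1 -> alpha_m - alpha_P - 2^-1 * alpha_rho = 2^-1 ->
     conserved T (fun t =>
       \int[mu]_(x in Omega) (rho t x * dotv (u t x) (u t x)))) /\
  (* 2: momentum *)
  (alpha_uu = 0 -> alpha_m = 1 ->
     conserved T (fun t => vintegral Omega (m t))) /\
  (* 3: angular momentum *)
  (alpha_uu = 0 -> alpha_m = 1 ->
     (forall t, t \in `[0, T] ->
        compact_support_in Omega (u t) /\
        exists c : R, compact_support_in Omega (fun x => P t x - c)) ->
     conserved T (fun t => vintegral Omega (fun x => cross (m t x) x))) /\
  (* 4 *)
  (alpha_rho = 2^-1 ->
     forall t, t \in `[0, T] ->
       exists2 D : R,
         is_dt T (fun s => 2^-1 * \int[mu]_(x in Omega) (rho s x ^+ 2)) t D &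
         D - \int[mu]_(x in Omega) (rho_bar t * pdt T rho t x) = 0) /\
  (* 5 *)
  (alpha_rho = 2^-1 ->
     (forall t, t \in `[0, T] -> rho_bar t = mean Omega (rho t)) ->
     conserved T (fun t =>
       \int[mu]_(x in Omega) (rho t x ^+ 2)
       - (fine (mu Omega))^-1 * (\int[mu]_(x in Omega) rho t x) ^+ 2)) /\
  (* 6: squared density *)
  ((alpha_rho = 2^-1 /\ (k_rho <= k_P)%N) \/ (2 * k_rho <= k_P)%N ->
     conserved T (fun t => \int[mu]_(x in Omega) (rho t x ^+ 2))) /\
  (* 7: mass *)
  ((k_rho <= k_P)%N \/ alpha_rho = 1 ->
     conserved T (fun t => \int[mu]_(x in Omega) rho t x)) /\
  (* 8: shift invariance *)
  (alpha_rho = 0 \/ rd = MeanDensity ->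
     shift_invariant Omega T alpha_rho rd M V).
Proof.
move=> M V Q mu m rho_bar sol.
have d_gt0 : (0 < d)%N by case: hd => ->.
have ku_gt0 : (0 < k_u)%N by [].
have mO := domain_measurable hOmega.
have Ooo := domain_finite hOmega.
have bd t : t \in `[0, T] -> bounded_measurable Omega (pdt T rho t).
  by move=> t0T; exact: fe_fun_bounded_measurable hOmega hmesh _ _ (dt_rho_fe sol t0T).
(* For [alpha_rho = 2^-1] the term with [rho ^ 2] drops out, and the factor [2^-1] of the other one
   is also that of the mass rate, [1 - alpha_rho]. *)
have square t : t \in `[0, T] -> alpha_rho = 2^-1 ->
    ip Omega (pdt T rho t) (rho t) = rho_bar t * \int[mu]_(x in Omega) pdt T rho t x.
  move=> t0T alphaE; rewrite (dt_mass_squareE d_gt0 hOmega hmesh sol t0T).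
  rewrite (dt_massE d_gt0 hOmega hmesh sol t0T) alphaE subrr mul0r add0r.
  by rewrite mulrA; congr (_ * _); rewrite -/rho_bar; field.
split; [|split; [|split; [|split; [|split; [|split; [|split]]]]]].
- move=> uu1 alphaE t t0T.
  have H := kinetic_energy_dt hOmega hmesh hT sol t0T.
  by rewrite (kinetic_energy_balance d_gt0 hOmega hmesh sol t0T uu1 alphaE) in H.
- move=> uu0 am1 t t0T; apply: is_dt_rV => // j; rewrite mxE.
  have H := momentum_conserved d_gt0 hOmega hmesh hT sol t0T j uu0 am1.
  rewrite (_ : (fun s => _) = (fun s => \int[mu]_(x in Omega) m s x ord0 j))//.
  by apply/funext => s; rewrite mxE.
- move=> uu0 am1 support t t0T; apply: is_dt_rV => // l; rewrite mxE.
  have anti (j i : 'I_d) : rotation_matrix R l j i = - rotation_matrix R l i j :> R.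
    by rewrite /rotation_matrix; ring.
  have H := angular_momentum_conserved d_gt0 hOmega hmesh hT sol t0T anti uu0 am1 ku_gt0 support.
  rewrite (_ : (fun s => _) = (fun s => \int[mu]_(x in Omega)
      (\sum_j m s x ord0 j * rotation (rotation_matrix R l) x j)))//.
  apply/funext => s; rewrite mxE; apply: eq_Rintegral => x _.
  by rewrite cross_rotation.
- move=> alphaE t t0T.
  exists (2^-1 * (2 * ip Omega (pdt T rho t) (rho t))).
    by apply: is_dtZ; exact: (mass_square_dt hOmega hmesh sol t0T).
  rewrite (square t t0T alphaE) (bRintegralZ mO Ooo); last exact: bd.
  by rewrite mulKf ?pnatr_eq0// subrr.
- move=> alphaE meanE t t0T.
  have H1 := mass_square_dt hOmega hmesh sol t0T.
  have H2 := mass_dt hOmega hmesh sol t0T.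
  have H := is_dtD H1 (is_dtZ (c := - (fine (mu Omega))^-1) (is_dtM H2 H2)).
  rewrite (_ : (fun s => _) = (fun t => \int[mu]_(x in Omega) (rho t x ^+ 2)
       - (fine (mu Omega))^-1 * (\int[mu]_(x in Omega) rho t x) ^+ 2)) in H; last first.
    by apply/funext => s; rewrite expr2 mulNr.
  rewrite (_ : _ + _ = 0) in H; first exact: H.
  (* The reference value is the mass divided by the volume, so the rate of the integral of [rho ^ 2]
     is that of the squared mass over the volume. *)
  rewrite (square t t0T alphaE) meanE// /mean; ring.
- move=> hk t t0T; have H := mass_square_dt hOmega hmesh sol t0T.
  suff sq0 : ip Omega (pdt T rho t) (rho t) = 0 by rewrite sq0 mulr0 in H.
  rewrite (dt_mass_squareE d_gt0 hOmega hmesh sol t0T).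
  have Mrho : M (rho t) by exact: (rho_space sol t0T).
  have div1 : (k_rho <= k_P)%N ->
      \int[mu]_(x in cells Omega vert) (dive (component (u t)) x * rho t x) = 0.
    by move=> kk; apply: (weak_divergence d_gt0 hOmega hmesh sol t0T); exact: feW kk Mrho.
  case: hk => [[-> kk]|kk]; first by rewrite subrr mul0r add0r div1// mulr0.
  rewrite div1; last by apply: leq_trans kk; rewrite leq_pmull.
  (* [rho ^ 2] has degree at most [2 * k_rho], so it is itself admissible in the divergence
     constraint and [alpha_rho] is arbitrary. *)
  rewrite (weak_divergence d_gt0 hOmega hmesh sol t0T); first by rewrite !mulr0 addr0.
  by apply: feW (feM Mrho Mrho); rewrite addnn -mul2n.
- move=> hk t t0T; have H := mass_dt hOmega hmesh sol t0T.
  suff d0 : \int[mu]_(x in Omega) pdt T rho t x = 0 by rewrite d0 in H.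
  rewrite (dt_massE d_gt0 hOmega hmesh sol t0T).
  case: hk => [kk|->]; last by rewrite subrr mul0r.
  rewrite (weak_divergence d_gt0 hOmega hmesh sol t0T) ?mulr0//.
  exact: feW kk (rho_space sol t0T).
- exact: (density_equation_shift_invariant hOmega hmesh).
Qed.
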